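(* Let $\tau=\frac{-b+\sqrt{-d}}{2a}$ where $a,b,c$ are mutually coprime integers with $a>0$, $a\tau^2+b\tau+c=0$ and $-d=b^2-4ac$, and suppose $\tau$ lies in $C_{1/u,\infty}$. Then $$\frac{F^2}{6}\left[(u-1)-\frac{u^2+18u-27}{u-9}s_2(\tau)\right]-u(u-1)\frac{d}{du}F^2=\frac{a}{\pi\sqrt{d}}u^{2/3}(u-1)^{1/3},$$ where $u=u(\tau)$, $F={}_2F_1\!\left(\frac13,\frac13;1;\frac1u\right)$, and $\frac{d}{du}F^2$ denotes the derivative of $x\mapsto{}_2F_1(\frac13,\frac13;1;\frac1x)^2$ evaluated at $x=u(\tau)$.
   Context: $\mathfrak H$ is the upper half-plane, $q=e^{2\pi i\tau}$, $E_2=1-24\sum_{n\ge1}n\frac{q^n}{1-q^n}$, $E_4=1+240\sum_{n\ge1}n^3\frac{q^n}{1-q^n}$, $E_6=1-504\sum_{n\ge1}n^5\frac{q^n}{1-q^n}$, $E_2^*(\tau)=E_2(\tau)-\frac{3}{\pi\mathrm{Im}(\tau)}$, $s_2(\tau)=\frac{E_4(\tau)}{E_6(\tau)}E_2^*(\tau)$. ${}_2F_1$ is the Gauss hypergeometric function. $u(\tau)=-\frac{1}{27}\left(\frac{\eta(\tau)}{\eta(3\tau)}\right)^{12}$ ($\eta$ the Dedekind eta function) is the Hauptmodul of $\Gamma_0(3)$. With $\mathcal{F}_{3B}=\{z\in\mathfrak{H}:|z+1/3|>1/3,|z-1/3|>1/3,|\mathrm{Re}(z)|<1/2\}$, $C_{1/u,\infty}$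 is the connected component of $\{\tau\in\mathcal F_{3B}:|1/u(\tau)|<1\}$ whose closure contains the cusp $\infty$ (i.e. containing points of arbitrarily large imaginary part).
   Formalization: The case E_6(τ)=0 is excluded (in this region only τ=i, given by a=c=1, b=0, d=4), because s_2(τ)=(E_4/E_6)E_2^* is undefined there; the powers u^{2/3} and (u-1)^{1/3} are taken as principal branches. *)

(* Defs.v *)
From Stdlib Require Import Reals ZArith.
From Coquelicot Require Import Coquelicot.

Open Scope R_scope.
Open Scope C_scope.

(** * Limits, series and elementary functions on [C] *)

(* Total operators in the style of [C_lim]: meaningful when the complex limit
   (resp. series) converges, see [CLim_seq_correct] and [CSeries_correct]. *)
Definition CLim_seq (x : nat -> C) : C :=
  (real (Lim_seq (fun n => Re (x n))), real (Lim_seq (fun n => Im (x n)))).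

Definition CSeries (x : nat -> C) : C := CLim_seq (sum_n x).

Lemma CLim_seq_correct (x : nat -> C) (l : C) :
  filterlim x eventually (locally l) -> CLim_seq x = l.
Proof.
intros H; destruct l as [l1 l2]; unfold CLim_seq; f_equal.
- rewrite (is_lim_seq_unique _ l1); [reflexivity|].
  apply (filterlim_comp _ _ _ x fst _ (locally (l1, l2))); [exact H|].
  apply continuous_fst.
- rewrite (is_lim_seq_unique _ l2); [reflexivity|].
  apply (filterlim_comp _ _ _ x snd _ (locally (l1, l2))); [exact H|].
  apply continuous_snd.
Qed.

Lemma CSeries_correct (x : nat -> C) (l : C) :
  is_series x l -> CSeries x = l.
Proof.
intros H; apply CLim_seq_correct.
intros P HP; exact (H P HP).
Qed.

Fixpoint Cprod_n (x : nat -> C) (n : nat) : C :=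
  match n with
  | O => 1
  | S m => Cprod_n x m * x m
  end.

Definition Cexp (z : C) : C := (exp (Re z) * cos (Im z), exp (Re z) * sin (Im z))%R.

(* Principal argument, with values in (-PI, PI] for z <> 0. *)
Definition Carg (z : C) : R :=
  (if Rle_dec 0 (Im z) then acos (Re z / Cmod z) else - acos (Re z / Cmod z))%R.

Definition Clog (z : C) : C := (ln (Cmod z), Carg z).

(* Principal branch of the power function, for z <> 0. *)
Definition Cpowr (z : C) (s : R) : C := Cexp (s * Clog z).

(** * Gauss hypergeometric function *)

Fixpoint pochhammer (a : C) (n : nat) : C :=
  match n with
  | O => 1
  | S m => pochhammer a m * (a + INR m)
  end.

(* The defining power series, convergent for |z| < 1. *)
Definition hyp2F1 (a b c z : C) : C :=
  CSeries (fun n => pochhammer a n * pochhammer b n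
                    / (pochhammer c n * INR (fact n)) * z ^ n).

(** * Modular forms and functions *)

Definition nome (tau : C) : C := Cexp (2 * PI * Ci * tau).

(* Sum over n >= 1 of n^k q^n / (1 - q^n). *)
Definition lambert (k : nat) (tau : C) : C :=
  CSeries (fun n => (INR (S n) ^ k)%R * (nome tau ^ S n / (1 - nome tau ^ S n))).

Definition E2 (tau : C) : C := 1 - 24 * lambert 1 tau.
Definition E4 (tau : C) : C := 1 + 240 * lambert 3 tau.
Definition E6 (tau : C) : C := 1 - 504 * lambert 5 tau.

Definition E2star (tau : C) : C := E2 tau - (3 / (PI * Im tau))%R.

Definition s2 (tau : C) : C := E4 tau / E6 tau * E2star tau.

(* q^(1/24) is read as exp(2 pi i tau / 24). *)
Definition eta (tau : C) : C :=
  Cexp (2 * PI * Ci * tau / 24)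
  * CLim_seq (Cprod_n (fun n => 1 - nome tau ^ S n)).

Definition u3B (tau : C) : C := - (1 / 27) * (eta tau / eta (3 * tau)) ^ 12.

(** * The region around the cusp at infinity *)

Definition F3B (z : C) : Prop :=
  (0 < Im z /\ 1 / 3 < Cmod (z + 1 / 3)%C /\ 1 / 3 < Cmod (z - 1 / 3)%C
   /\ Rabs (Re z) < 1 / 2)%R.

Definition Cconnected (A : C -> Prop) : Prop :=
  forall U V : C -> Prop,
    open U -> open V ->
    (forall z, A z -> U z \/ V z) ->
    (exists z, A z /\ U z) -> (exists z, A z /\ V z) ->
    exists z, A z /\ U z /\ V z.

(* K is a connected component of A. *)
Definition is_component (A K : C -> Prop) : Prop :=
  (exists z, K z) /\ (forall z, K z -> A z) /\ Cconnected K /\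
  (forall L : C -> Prop,
     (forall z, L z -> A z) -> Cconnected L ->
     (forall z, K z -> L z) -> forall z, L z -> K z).

(* Membership in the component reaching the cusp. That component is unique:
   |1/u| tends to 0 at the cusp, so a whole half-strip |Re z| < 1/2, Im z > M
   lies in the set below. *)
Definition C_inf (tau : C) : Prop :=
  exists K : C -> Prop,
    is_component (fun z => F3B z /\ (Cmod (1 / u3B z)%C < 1)%R) K
    /\ (forall M : R, exists z, K z /\ (M < Im z)%R)
    /\ K tau.

(* Main.v *)
(** With [D = q d/dq], [t = 1/u = -27 q prod ((1 - q^3n) / (1 - q^n))^12],
    [b = eta(tau)^3 / eta(3 tau)] and [A = (3 E2(3 tau) - E2(tau)) / 2], the
    infinite products give [D t = t A] and [D b = b (E2 - A) / 12].  Everything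
    rests on [E4 (1 - t) = A^2 (1 - 9 t)], [A = b^2 (1 - t)^(2/3)] and
    [b = 2F1(1/3, 1/3; 1; t)]: the identity to prove then reduces to algebra.

    Ramanujan's differential equations for [E2], [E4], [E6] and the identity
    [E4(tau) + 9 E4(3 tau) = 10 A^2] are convolution identities for divisor
    sums; they come from elementary bijections between the solutions of
    [a x + b y = n] in positive integers, in the manner of Liouville.  Applying
    [D] twice to the second one yields the 3-division polynomial
    [27 A^4 - 18 A^2 E4 - 8 A E6 - E4^2 = 0], which says exactly that
    [(E4 - A^2) / (E4 - 9 A^2)] satisfies the same equation [D T = T A] as [t].

    The remaining identities assert that some explicit function of [q] has
    derivative zero where [|t| < 1].  It is then locally constant, and its value
    at [q = 0] propagates along the connected component by connectedness alone.

    Finally [u = 9], where the statement divides by zero, is excluded: a second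
    solution of the hypergeometric equation expresses [q] as [- t / 27] times
    the exponential of a real power series in [t], so [t = 1/9] would give
    [q < 0], which is impossible for [|Re tau| < 1/2]. *)

Require Import Defs.
From HB Require structures.
From mathcomp Require all_boot zify_ssreflect.
From Stdlib Require Import Reals ZArith Lra Lia Ranalysis5 Classical FunctionalExtensionality.
From Coquelicot Require Import Coquelicot.

Open Scope R_scope.
Open Scope C_scope.

(** * Convolutions of divisor sums *)

Module Convolution.
Import HB.structures all_boot.
Import zify_ssreflect.
Local Open Scope R_scope.

Lemma RplusA : associative Rplus. Proof. by move=> x y z; ring. Qed.
Lemma RplusC : commutative Rplus. Proof. by move=> x y; ring. Qed.
Lemma Rplus0 : left_id 0 Rplus. Proof. by move=> x; ring. Qed.
HB.instance Definition _ := Monoid.isComLaw.Build R 0 Rplus RplusA RplusC Rplus0.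
Lemma Rmul0l : left_zero 0 Rmult. Proof. by move=> x; ring. Qed.
Lemma Rmul0r : right_zero 0 Rmult. Proof. by move=> x; ring. Qed.
HB.instance Definition _ := Monoid.isMulLaw.Build R 0 Rmult Rmul0l Rmul0r.
Lemma RmulDl : left_distributive Rmult Rplus. Proof. by move=> x y z; ring. Qed.
Lemma RmulDr : right_distributive Rmult Rplus. Proof. by move=> x y z; ring. Qed.
HB.instance Definition _ := Monoid.isAddLaw.Build R Rmult Rplus RmulDl RmulDr.

Notation "\rsum_ ( i <- r | P ) F" := (\big[Rplus/R0]_(i <- r | P) F)
  (at level 41, F at level 41, i, r at level 50).
Notation "\rsum_ ( i <- r ) F" := (\big[Rplus/R0]_(i <- r) F)
  (at level 41, F at level 41, i, r at level 50).

Lemma rsum_sub (I : Type) (s : seq I) (P : pred I) (F G : I -> R) :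
  \rsum_(i <- s | P i) (F i - G i) = \rsum_(i <- s | P i) F i - \rsum_(i <- s | P i) G i.
Proof.
by elim/big_rec3: _ => [|i x y z _ ->]; ring.
Qed.

Lemma rsum_scal (I : Type) (s : seq I) (P : pred I) (c : R) (F : I -> R) :
  \rsum_(i <- s | P i) (c * F i) = c * (\rsum_(i <- s | P i) F i).
Proof. by rewrite big_distrr. Qed.

Lemma rsum_bij (I J : eqType) (s : seq I) (s' : seq J) (P : pred I) (Q : pred J)
    (h : I -> J) (h' : J -> I) (F : J -> R) :
  uniq s -> uniq s' ->
  (forall i, i \in s -> P i -> [/\ h i \in s', Q (h i) & h' (h i) = i]) ->
  (forall j, j \in s' -> Q j -> [/\ h' j \in s, P (h' j) & h (h' j) = j]) ->
  \rsum_(i <- s | P i) F (h i) = \rsum_(j <- s' | Q j) F j.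
Proof.
move=> us us' H1 H2.
rewrite -[LHS]big_filter -[RHS]big_filter.
rewrite -(big_map h xpredT F); apply: perm_big.
apply: uniq_perm; rewrite ?filter_uniq //.
  rewrite map_inj_in_uniq ?filter_uniq // => i j.
  rewrite !mem_filter => /andP[Pi si] /andP[Pj sj] e.
  have [_ _ <-] := H1 i si Pi; have [_ _ <-] := H1 j sj Pj; by rewrite e.
move=> j; apply/mapP/idP.
  case=> i; rewrite mem_filter => /andP[Pi si] ->.
  by rewrite mem_filter; have [-> -> _] := H1 i si Pi.
rewrite mem_filter => /andP[Qj sj]; have [a b c] := H2 j sj Qj.
by exists (h' j); rewrite ?mem_filter ?a ?b.
Qed.

Definition facts (n : nat) : seq (nat * nat) :=
  [seq p <- [seq (a, x) | a <- iota 1 n, x <- iota 1 n] | p.1 * p.2 == n]%N.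

Lemma mem_facts n a x :
  ((a, x) \in facts n) = [&& 0 < a, 0 < x & a * x == n]%N.
Proof.
rewrite mem_filter /=; apply/idP/idP.
  by case/andP=> -> /allpairsP[[c d]] /=; rewrite !mem_iota; case=> ? ? [-> ->]; lia.
case/and3P=> a0 x0 /eqP e; rewrite e eqxx /=.
by apply/allpairsP; exists (a, x); split; rewrite //= mem_iota; nia.
Qed.

Lemma uniq_facts n : uniq (facts n).
Proof.
apply/filter_uniq/allpairs_uniq; rewrite ?iota_uniq //.
by move=> [a b] [c d].
Qed.

(* The quadruple [(a, b), (x, y)] stands for the solution [a x + b y = n]. *)
Definition sols (n : nat) : seq ((nat * nat) * (nat * nat)) :=
  let I := iota 1 n in let J := [seq (a, b) | a <- I, b <- I] in
  [seq t <- [seq (p, q) | p <- J, q <- J] | t.1.1 * t.2.1 + t.1.2 * t.2.2 == n]%N.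

Lemma mem_sols n a b x y : (((a, b), (x, y)) \in sols n) =
  [&& 0 < a, 0 < b, 0 < x, 0 < y & a * x + b * y == n]%N.
Proof.
rewrite mem_filter /=; apply/idP/idP.
  case/andP=> -> /allpairsP[[c d]] /= [].
  move=> /allpairsP[[a1 b1]] /=; rewrite !mem_iota => -[h1 h2 e1].
  move=> /allpairsP[[x1 y1]] /=; rewrite !mem_iota => -[h3 h4 e2].
  by rewrite e1 e2 => -[-> -> -> ->]; lia.
case/and5P=> a0 b0 x0 y0 /eqP e; rewrite e eqxx /=.
apply/allpairsP; exists ((a, b), (x, y)); split => //=;
  apply/allpairsP; [exists (a, b)| exists (x, y)]; split; rewrite //= mem_iota; nia.
Qed.

Lemma uniq_sols n : uniq (sols n).
Proof.
apply/filter_uniq/allpairs_uniq; rewrite ?allpairs_uniq ?iota_uniq //;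
 by [move=> [a b] [c d] | move=> [a b] [c d] _ _ /= [-> ->]].
Qed.

Definition swap (t : (nat * nat) * (nat * nat)) := ((t.1.2, t.1.1), (t.2.2, t.2.1)).

Lemma sols_swap n P F :
  \rsum_(t <- sols n | P (swap t)) F (swap t) = \rsum_(t <- sols n | P t) F t.
Proof.
apply: (@rsum_bij _ _ _ _ _ _ swap swap); rewrite ?uniq_sols //.
all: move=> [[a b] [x y]]; rewrite /swap /= !mem_sols => H ->; split=> //; lia.
Qed.

Lemma sols_shift n F :
  \rsum_(t <- sols n | (t.1.2 < t.1.1)%N) F t =
  \rsum_(t <- sols n | (t.2.1 < t.2.2)%N)
     F ((t.1.1 + t.1.2, t.1.2), (t.2.1, t.2.2 - t.2.1))%N.
Proof.
symmetry; apply: (@rsum_bij _ _ _ _ _ _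
  (fun t => ((t.1.1 + t.1.2, t.1.2), (t.2.1, t.2.2 - t.2.1))%N)
  (fun t => ((t.1.1 - t.1.2, t.1.2), (t.2.1, t.2.2 + t.2.1))%N));
  rewrite ?uniq_sols //.
all: move=> [[a b] [x y]] /=; rewrite !mem_sols => /and5P[a0 b0 x0 y0 /eqP e] h.
- have [z ez] : exists z, (y = x + z)%N by exists (y - x)%N; lia.
  subst y; split; [|lia|by congr ((_, _), (_, _)); lia].
  by rewrite addKn; lia.
- have [z ez] : exists z, (a = b + z)%N by exists (a - b)%N; lia.
  subst a; split; [|lia|by congr ((_, _), (_, _)); lia].
  by rewrite addKn; lia.
Qed.

Lemma sols_shift' n F :
  \rsum_(t <- sols n | (t.1.1 < t.1.2)%N) F t =
  \rsum_(t <- sols n | (t.2.2 < t.2.1)%N)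
     F ((t.1.1, t.1.1 + t.1.2), (t.2.1 - t.2.2, t.2.2))%N.
Proof.
rewrite -sols_swap /= sols_shift -sols_swap /=.
by apply: eq_bigr => -[[a b] [x y]] _; rewrite /swap /= addnC.
Qed.

Lemma sols_split (m1 m2 : (nat * nat) * (nat * nat) -> nat) n F :
  \rsum_(t <- sols n) F t =
  \rsum_(t <- sols n | (m1 t < m2 t)%N) F t + \rsum_(t <- sols n | (m2 t < m1 t)%N) F t
   + \rsum_(t <- sols n | m1 t == m2 t) F t.
Proof.
rewrite (bigID (fun t => m1 t < m2 t)%N) /= -RplusA; congr (_ + _).
rewrite (bigID (fun t => m2 t < m1 t)%N) /=; congr (_ + _).
  by apply: eq_bigl => t; lia.
by apply: eq_bigl => t; lia.
Qed.

Section Liouville.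
Variables (f : nat -> R) (n : nat).
Notation dist a b := ((a - b) + (b - a))%N.
Notation aa t := (t.1.1). Notation bb t := (t.1.2).
Notation xx t := (t.2.1). Notation yy t := (t.2.2).
Notation diag_ab F := (\rsum_(t <- sols n | (t.1.1 == t.1.2)%N) F t).
Notation diag_xy F := (\rsum_(t <- sols n | (t.2.1 == t.2.2)%N) F t).

Lemma liouville_gen (g1 g2 : nat -> nat -> R) :
  (forall a b, g1 a b = g1 b a) -> (forall a b, g2 a b = g2 b a) ->
  \rsum_(t <- sols n) (g1 (aa t) (bb t) * f (dist (aa t) (bb t))) =
    diag_ab (fun t => g1 (aa t) (aa t) * f 0%N)
    + 2 * (\rsum_(t <- sols n | (xx t < yy t)%N) (g1 (aa t + bb t)%N (bb t) * f (aa t)))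
  /\ \rsum_(t <- sols n) (g2 (aa t) (bb t) * f (aa t + bb t)%N) =
    diag_xy (fun t => g2 (aa t) (bb t) * f (aa t + bb t)%N)
    + 2 * (\rsum_(t <- sols n | (bb t < aa t)%N) (g2 (aa t - bb t)%N (bb t) * f (aa t))).
Proof.
move=> s1 s2; split.
- rewrite (sols_split (fun t => aa t) (fun t => bb t)) -sols_swap /= !sols_shift.
  rewrite RplusC; congr (_ + _).
    apply: eq_bigr => -[[a b] [x y]] /= /eqP ->; congr (_ * f _); lia.
  rewrite (_ : forall z, 2 * z = z + z); last by move=> z; ring.
  congr (_ + _); apply: eq_bigr => -[[a b] [x y]] /= h.
    by rewrite s1; congr (_ * f _); lia.
  by congr (_ * f _); lia.
- rewrite (sols_split (fun t => xx t) (fun t => yy t)) RplusC; congr (_ + _).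
  rewrite sols_shift /=.
  rewrite (_ : forall z, 2 * z = z + z); last by move=> z; ring.
  congr (_ + _).
    by apply: eq_bigr => -[[a b] [x y]] /= h; rewrite addnK.
  rewrite -sols_swap /=; apply: eq_bigr => -[[a b] [x y]] /= h.
  by rewrite addnK s2 addnC.
Qed.

Lemma liouville :
  \rsum_(t <- sols n) (f (dist (aa t) (bb t)) - f (aa t + bb t)%N) =
  2 * (diag_ab (fun t => f (aa t)) - diag_xy (fun t => f (aa t)))
  + diag_ab (fun t => f 0%N) - diag_xy (fun t => f (aa t + bb t)%N).
Proof.
have [//|//|] := @liouville_gen (fun _ _ => 1) (fun _ _ => 1).
rewrite rsum_sub.
have e1 P F : \rsum_(t <- sols n | P t) (1 * F t) = \rsum_(t <- sols n | P t) F t.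
  by apply: eq_bigr => t _; rewrite Rmult_1_l.
rewrite !e1 => -> ->.
have h1 := @sols_split (fun t => xx t) (fun t => yy t) n (fun t => f (aa t)).
have h2 := @sols_split (fun t => aa t) (fun t => bb t) n (fun t => f (aa t)).
have h3 := @sols_shift' n (fun t => f (aa t)).
rewrite /= in h1 h2 h3; lra.
Qed.

Lemma liouville_weighted :
  \rsum_(t <- sols n) (INR (aa t) * INR (bb t) *
     ((f (aa t + bb t)%N + f (dist (aa t) (bb t))) / 2 - f (aa t) - f (bb t))) =
  / 2 * diag_xy (fun t => INR (aa t) * INR (bb t) * f (aa t + bb t)%N)
  + / 2 * diag_ab (fun t => INR (aa t) * INR (aa t) * f 0%N)
  - diag_xy (fun t => (INR (aa t) * INR (bb t) + INR (bb t) ^ 2) * f (aa t)).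
Proof.
have [||] := @liouville_gen (fun a b => INR a * INR b) (fun a b => INR a * INR b).
- by move=> a b; ring.
- by move=> a b; ring.
set S1 := \big[_/_]_(_ <- _) _; set D1 := \big[_/_]_(_ <- _ | _) _.
set S2 := \big[_/_]_(_ <- _ | _) _ => H1.
set S3 := \big[_/_]_(_ <- _) _; set D3 := \big[_/_]_(_ <- _ | _) _.
set S4 := \big[_/_]_(_ <- _ | _) _ => H2.
pose G (t : (nat * nat) * (nat * nat)) := (INR (aa t) * INR (bb t)) * f (aa t).
transitivity (/ 2 * S3 + / 2 * S1 - 2 * (\rsum_(t <- sols n) G t)).
  have e : \rsum_(t <- sols n) (INR (aa t) * INR (bb t) * f (bb t)) = \rsum_(t <- sols n) G t.
    by rewrite -(@sols_swap n xpredT); apply: eq_bigr => t _; rewrite /G /=; ring.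
  rewrite (_ : forall z, 2 * z = z + z); last by move=> z; ring.
  rewrite -{2}e /S3 /S1 -!rsum_scal -!big_split -rsum_sub /=.
  by apply: eq_bigr => t _; rewrite /G; field.
pose G1 (t : (nat * nat) * (nat * nat)) := (INR (aa t) * INR (bb t) - INR (bb t) ^ 2) * f (aa t).
pose G2 (t : (nat * nat) * (nat * nat)) := (INR (aa t) * INR (bb t) + INR (bb t) ^ 2) * f (aa t).
have e4 : S4 = \rsum_(t <- sols n | (bb t < aa t)%N) G1 t.
  apply: eq_bigr => -[[a b] [x y]] /= h; rewrite /G1 /=.
  by rewrite minus_INR; [ring|lia].
have e2 : S2 = \rsum_(t <- sols n | (xx t < yy t)%N) G2 t.
  apply: eq_bigr => -[[a b] [x y]] /= h; rewrite /G2 /=.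
  by rewrite plus_INR; ring.
have h1 := @sols_split (fun t => xx t) (fun t => yy t) n G2.
have h2 := @sols_split (fun t => aa t) (fun t => bb t) n G1.
have h3 := @sols_shift' n G1.
have e3 : \rsum_(t <- sols n | (yy t < xx t)%N) G1 (aa t, (aa t + bb t)%N, (xx t - yy t, yy t)%N)
   = (-1) * (\rsum_(t <- sols n | (yy t < xx t)%N) G2 t).
  rewrite -rsum_scal; apply: eq_bigr => -[[a b] [x y]] /= h; rewrite /G1 /G2 /=.
  by rewrite plus_INR; ring.
have e5 : \rsum_(t <- sols n | aa t == bb t) G1 t = 0.
  rewrite (_ : 0 = 0 * (\rsum_(t <- sols n | aa t == bb t) G1 t)); last by ring.
  rewrite -rsum_scal; apply: eq_bigr => -[[a b] [x y]] /= /eqP ->; rewrite /G1 /=; ring.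
have e6 : \rsum_(t <- sols n) G1 t + \rsum_(t <- sols n) G2 t = 2 * (\rsum_(t <- sols n) G t).
  rewrite -rsum_scal -big_split; apply: eq_bigr => t _; rewrite /G1 /G2 /G /=; ring.
rewrite /= in h1 h2 h3 e3.
rewrite -/D1 -/D3 -/(G2 _).
under [X in _ = _ + _ - X]eq_bigr => t _ do rewrite -/(G2 t).
lra.
Qed.

Definition facts_below : seq ((nat * nat) * nat) :=
  [seq (p, l) | p <- facts n, l <- iota 1 p.1.-1].

Lemma mem_facts_below d m l : ((d, m, l) \in facts_below) = [&& 0 < l, l < d, 0 < m & d * m == n]%N.
Proof.
apply/idP/idP.
  case/allpairsPdep => -[d' m'] [l'] []; rewrite mem_facts mem_iota /= => h1 h2 [-> -> ->].
  lia.
move=> h; apply/allpairsPdep; exists (d, m), l; split => //; rewrite ?mem_facts ?mem_iota /=; lia.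
Qed.

Lemma uniq_facts_below : uniq facts_below.
Proof.
apply: allpairs_uniq_dep; first exact: uniq_facts.
  by move=> p _; exact: iota_uniq.
by move=> [p l] [p' l'] _ _ /= [-> ->].
Qed.

Lemma diag_xyE (F : nat -> nat -> R) :
  diag_xy (fun t => F (aa t) (bb t)) =
  \rsum_(p <- facts n) \rsum_(l <- iota 1 p.1.-1) F l (p.1 - l)%N.
Proof.
pose G (q : (nat * nat) * nat) := F q.2 (q.1.1 - q.2)%N.
rewrite -(@big_allpairs_dep _ _ _ _ (fun _ => nat) _ (fun p l => (p, l)) _ _ G).
rewrite -(@rsum_bij _ _ _ _ (fun t => xx t == yy t) xpredT (fun t => ((aa t + bb t, xx t), aa t)%N)
  (fun q => ((q.2, q.1.1 - q.2), (q.1.2, q.1.2))%N)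
  G (uniq_sols n) uniq_facts_below).
- by apply: eq_bigr => -[[a b] [x y]] _; rewrite /G /= addKn.
- move=> [[a b] [x y]] /=; rewrite mem_facts_below mem_sols => h /eqP e; subst y; split => //.
    by move: h; nia.
  by rewrite addKn.
move=> [[d m] l] /=; rewrite mem_facts_below mem_sols => h _.
have [z ez] : exists z, (d = l + z)%N by exists (d - l)%N; lia.
subst d; rewrite addKn; split; rewrite ?eqxx //; nia.
Qed.

Lemma facts_swap (F : nat * nat -> R) :
  \rsum_(p <- facts n) F (p.2, p.1) = \rsum_(p <- facts n) F p.
Proof.
apply: (@rsum_bij _ _ _ _ _ _ (fun p => (p.2, p.1)) (fun p => (p.2, p.1)));
 rewrite ?uniq_facts //; move=> [a x] /=; rewrite !mem_facts; split=> //; lia.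
Qed.

Lemma diag_abE (F : nat -> R) :
  diag_ab (fun t => F (aa t)) = \rsum_(p <- facts n) ((INR p.2 - 1) * F p.1).
Proof.
rewrite -sols_swap /=.
transitivity (\rsum_(p <- facts n) \rsum_(l <- iota 1 p.1.-1) F p.2).
  pose G (q : (nat * nat) * nat) := F q.1.2.
  rewrite -(@big_allpairs_dep _ _ _ _ (fun _ => nat) _ (fun p l => (p, l)) _ _ G).
  rewrite -(@rsum_bij _ _ _ _ (fun t => bb t == aa t) xpredT (fun t => ((xx t + yy t, bb t), xx t)%N)
    (fun q => ((q.1.2, q.1.2), (q.2, q.1.1 - q.2))%N)
    G (uniq_sols n) uniq_facts_below) //.
  - move=> [[a b] [x y]] /=; rewrite mem_facts_below mem_sols => h /eqP e; subst b; split => //.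
      by move: h; nia.
    by rewrite addKn.
  move=> [[d m] l] /=; rewrite mem_facts_below mem_sols => h _.
  have [z ez] : exists z, (d = l + z)%N by exists (d - l)%N; lia.
  subst d; rewrite addKn; split; rewrite ?eqxx //; nia.
rewrite -facts_swap /=; rewrite big_seq [RHS]big_seq; apply: eq_bigr => -[d m].
rewrite mem_facts /= => h.
rewrite big_const_seq count_predT size_iota.
have -> : INR m - 1 = INR m.-1 by case: m h => [|m] h; [lia|rewrite S_INR /=; ring].
elim: (m.-1) => [|k IH]; first by rewrite /=; ring.
by rewrite S_INR iterS IH; ring.
Qed.
End Liouville.

Lemma telescope (d : nat) (p Q : R -> R) :
  (0 < d)%N -> Q 1 = 0 -> (forall x, Q (x + 1) - Q x = p x) ->
  \rsum_(l <- iota 1 d.-1) p (INR l) = Q (INR d).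
Proof.
move=> d0 Q1 HQ; case: d d0 => // d _; rewrite [d.+1.-1]/=.
elim: d => [|d IH]; first by rewrite big_nil /= Q1.
rewrite (_ : iota 1 d.+1 = iota 1 d ++ [:: d.+1]); last by rewrite -[in LHS](addn1 d) iotaD add1n.
by rewrite big_cat IH big_seq1 (S_INR d.+1) -(HQ (INR _)) /Monoid.Law.sort; cbn -[INR]; ring.
Qed.

Lemma eq_rsum_facts n (F G : nat * nat -> R) :
  (forall d m, (0 < d)%N -> (0 < m)%N -> (d * m)%N = n -> F (d, m) = G (d, m)) ->
  \rsum_(p <- facts n) F p = \rsum_(p <- facts n) G p.
Proof.
move=> H; apply: eq_big_seq => -[d m]; rewrite mem_facts => /and3P[? ? /eqP ?].
exact: H.
Qed.

Lemma liouville_facts (f : nat -> R) (Q : R -> R) n :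
  (forall d, (0 < d)%N -> \rsum_(l <- iota 1 d.-1) f l = Q (INR d)) ->
  \rsum_(t <- sols n)
     (f ((t.1.1 - t.1.2) + (t.1.2 - t.1.1))%N - f (t.1.1 + t.1.2)%N) =
  \rsum_(p <- facts n) (2 * ((INR p.2 - 1) * f p.1 - Q (INR p.1))
     + (INR p.2 - 1) * f 0%N - (INR p.1 - 1) * f p.1).
Proof.
move=> HQ; rewrite liouville diag_abE (diag_abE _ (fun _ => f 0%N)).
rewrite (diag_xyE _ (fun a b => f a)) (diag_xyE _ (fun a b => f (a + b)%N)).
rewrite -rsum_sub -rsum_scal -big_split -rsum_sub /=.
apply: eq_rsum_facts => d m d0 m0 _ /=; rewrite HQ //; congr (_ - _).
rewrite big_seq; rewrite (eq_bigr (fun _ => 1 * f d)); last first.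
  by move=> l; rewrite mem_iota => h; rewrite Rmult_1_l; congr f; lia.
rewrite -big_seq -big_distrl /=; congr (_ * _).
by rewrite (@telescope d (fun _ => 1) (fun x => x - 1)) // => *; ring.
Qed.

Lemma liouville_weighted_facts (f : nat -> R) (Q : nat -> R) n :
  (forall d, (0 < d)%N ->
     \rsum_(l <- iota 1 d.-1) ((INR d - INR l) * INR d * f l) = Q d) ->
  \rsum_(t <- sols n) (INR t.1.1 * INR t.1.2 *
     ((f (t.1.1 + t.1.2)%N + f ((t.1.1 - t.1.2) + (t.1.2 - t.1.1))%N) / 2
      - f t.1.1 - f t.1.2)) =
  \rsum_(p <- facts n) (/ 2 * ((INR p.1 ^ 3 - INR p.1) / 6 * f p.1)
     + / 2 * ((INR p.2 - 1) * (INR p.1 * INR p.1 * f 0%N)) - Q p.1).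
Proof.
move=> HQ; rewrite liouville_weighted (diag_abE _ (fun a => INR a * INR a * f 0%N)).
rewrite (diag_xyE _ (fun a b => INR a * INR b * f (a + b)%N)).
rewrite (diag_xyE _ (fun a b => (INR a * INR b + INR b ^ 2) * f a)).
rewrite -!rsum_scal -big_split -rsum_sub /=.
apply: eq_rsum_facts => d m d0 m0 _ /=; congr (/ 2 * _ + _ - _).
  rewrite big_seq (eq_bigr (fun l => INR l * (INR d - INR l) * f d)); last first.
    move=> l; rewrite mem_iota => h; rewrite minus_INR; last by lia.
    by congr (_ * f _); lia.
  rewrite -big_seq -big_distrl /=; congr (_ * _).
  pose Q1 x := INR d * (x ^ 2 - x) / 2 - (2 * x ^ 3 - 3 * x ^ 2 + x) / 6.
  rewrite (@telescope d (fun x => x * (INR d - x)) Q1) // /Q1; last by move=> x; field.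
    by field.
  by field.
rewrite -HQ // big_seq [RHS]big_seq; apply: eq_bigr => l; rewrite mem_iota => h.
by rewrite minus_INR; [ring|lia].
Qed.

Lemma INR_dist_sqr a b : INR ((a - b) + (b - a))%N ^ 2 = (INR a - INR b) ^ 2.
Proof.
case: (leqP a b) => h.
  rewrite (_ : ((a - b) + (b - a))%N = (b - a)%N); last by lia.
  by rewrite minus_INR; [ring|lia].
rewrite (_ : ((a - b) + (b - a))%N = (a - b)%N); last by lia.
by rewrite minus_INR; [ring|lia].
Qed.

Lemma INR_dist_pow k a b :
  INR ((a - b) + (b - a))%N ^ (2 * k)%coq_nat = ((INR a - INR b) ^ 2) ^ k.
Proof. by rewrite pow_mult INR_dist_sqr. Qed.

Lemma rsum_sols_swap n (F : nat -> nat -> R) :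
  \rsum_(t <- sols n) F t.1.2 t.1.1 = \rsum_(t <- sols n) F t.1.1 t.1.2.
Proof. by rewrite -[RHS](@sols_swap n xpredT). Qed.

Lemma sols_1_1 n :
  \rsum_(t <- sols n) (INR t.1.1 * INR t.1.2) =
  \rsum_(p <- facts n) (5 / 12 * INR p.1 ^ 3 + INR p.1 / 12 - INR p.1 ^ 2 * INR p.2 / 2).
Proof.
unshelve epose proof (@liouville_facts (fun x => INR x ^ 2) (fun x => (2 * x ^ 3 - 3 * x ^ 2 + x) / 6) n _) as H.
  move=> d d0.
  by apply: (@telescope d (fun x => x ^ 2)) => // [|x]; field.
transitivity (- / 4 * (\rsum_(t <- sols n) (-4 * (INR t.1.1 * INR t.1.2)))).
  by rewrite rsum_scal; field.
transitivity (- / 4 * (\rsum_(t <- sols n)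
     (INR ((t.1.1 - t.1.2) + (t.1.2 - t.1.1))%N ^ 2 - INR (t.1.1 + t.1.2)%N ^ 2))).
  congr (_ * _); apply: eq_bigr => t _; rewrite INR_dist_sqr plus_INR; ring.
rewrite H -rsum_scal; apply: eq_bigr => p _ /=; field.
Qed.

Lemma sols_1_3 n :
  \rsum_(t <- sols n) (INR t.1.1 * INR t.1.2 ^ 3) =
  \rsum_(p <- facts n) (7 / 80 * INR p.1 ^ 5 + INR p.1 ^ 3 / 24
     - INR p.1 ^ 4 * INR p.2 / 8 - INR p.1 / 240).
Proof.
unshelve epose proof (@liouville_facts (fun x => INR x ^ 4)
  (fun x => (6 * x ^ 5 - 15 * x ^ 4 + 10 * x ^ 3 - x) / 30) n _) as H.
  move=> d d0.
  by apply: (@telescope d (fun x => x ^ 4)) => // [|x]; field.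
have e := rsum_sols_swap n (fun a b => INR a * INR b ^ 3).
transitivity (- / 16 * (8 * (\rsum_(t <- sols n) (-1 * (INR t.1.1 * INR t.1.2 ^ 3))) +
   8 * (\rsum_(t <- sols n) (-1 * (INR t.1.2 * INR t.1.1 ^ 3))))).
  by cbv beta in e; rewrite !rsum_scal e; field.
transitivity (- / 16 * (\rsum_(t <- sols n)
     (INR ((t.1.1 - t.1.2) + (t.1.2 - t.1.1))%N ^ 4 - INR (t.1.1 + t.1.2)%N ^ 4))).
  rewrite -!rsum_scal -big_split -rsum_scal; apply: eq_bigr => t _.
  by rewrite (INR_dist_pow 2) plus_INR; cbn -[INR]; field.
rewrite H -rsum_scal; apply: eq_bigr => p _ /=; field.
Qed.

Lemma sols_3_3 n :
  \rsum_(t <- sols n) (INR t.1.1 ^ 3 * INR t.1.2 ^ 3) =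
  \rsum_(p <- facts n) ((INR p.1 ^ 7 - INR p.1 ^ 3) / 120).
Proof.
unshelve epose proof (@liouville_weighted_facts (fun x => INR x ^ 4)
  (fun d => let x := INR d in
    x ^ 2 * (6 * x ^ 5 - 15 * x ^ 4 + 10 * x ^ 3 - x) / 30
     - x * (2 * x ^ 6 - 6 * x ^ 5 + 5 * x ^ 4 - x ^ 2) / 12) n _) as H.
  move=> d d0.
  pose Q x := INR d ^ 2 * (6 * x ^ 5 - 15 * x ^ 4 + 10 * x ^ 3 - x) / 30
     - INR d * (2 * x ^ 6 - 6 * x ^ 5 + 5 * x ^ 4 - x ^ 2) / 12.
  by apply: (@telescope d (fun x => (INR d - x) * INR d * x ^ 4) Q) => // [|x]; rewrite /Q; field.
transitivity (/ 6 * (\rsum_(t <- sols n) (INR t.1.1 * INR t.1.2 *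
     ((INR (t.1.1 + t.1.2)%N ^ 4 + INR ((t.1.1 - t.1.2) + (t.1.2 - t.1.1))%N ^ 4) / 2
      - INR t.1.1 ^ 4 - INR t.1.2 ^ 4)))).
  rewrite -rsum_scal; apply: eq_bigr => t _.
  by rewrite (INR_dist_pow 2) plus_INR; cbn -[INR]; field.
rewrite H -rsum_scal; apply: eq_bigr => p _ /=; field.
Qed.

Lemma sols_1_5 n :
  \rsum_(t <- sols n) (24 * (INR t.1.1 * INR t.1.2 ^ 5)) =
  \rsum_(p <- facts n) (20 / 21 * INR p.1 ^ 7 - 2 * INR p.1 ^ 6 * INR p.2
   + INR p.1 ^ 5 + INR p.1 / 21).
Proof.
unshelve epose proof (@liouville_facts (fun x => INR x ^ 6)
  (fun x => (6 * x ^ 7 - 21 * x ^ 6 + 21 * x ^ 5 - 7 * x ^ 3 + x) / 42) n _) as H.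
  move=> d d0.
  by apply: (@telescope d (fun x => x ^ 6)) => // [|x]; field.
have e := rsum_sols_swap n (fun a b => INR a * INR b ^ 5).
transitivity (-1 * (12 * (\rsum_(t <- sols n) (-1 * (INR t.1.1 * INR t.1.2 ^ 5))) +
   12 * (\rsum_(t <- sols n) (-1 * (INR t.1.2 * INR t.1.1 ^ 5))) +
   (-40) * (\rsum_(t <- sols n) (INR t.1.1 ^ 3 * INR t.1.2 ^ 3)))
   + (-40) * (\rsum_(t <- sols n) (INR t.1.1 ^ 3 * INR t.1.2 ^ 3))).
  by cbv beta in e; rewrite !rsum_scal e; ring.
transitivity (-1 * (\rsum_(t <- sols n)
     (INR ((t.1.1 - t.1.2) + (t.1.2 - t.1.1))%N ^ 6 - INR (t.1.1 + t.1.2)%N ^ 6))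
   + (-40) * (\rsum_(t <- sols n) (INR t.1.1 ^ 3 * INR t.1.2 ^ 3))).
  congr (_ + _); rewrite -!rsum_scal -!big_split -rsum_scal; apply: eq_bigr => t _.
  by rewrite (INR_dist_pow 3) plus_INR; cbn -[INR]; field.
rewrite H sols_3_3 -!rsum_scal -big_split; apply: eq_bigr => p _ /=; field.
Qed.

Lemma INR3 : INR 3 = 3. Proof. by rewrite /=; ring. Qed.

Definition ind3 (n : nat) : R := if (3 %| n)%N then 1 else 0.

Lemma rsum_ind3 (D : R) (k : nat) :
  \rsum_(l <- iota 1 k) ((D - INR l) * ind3 l) =
  let j := INR (k %/ 3) in D * j - 3 * j * (j + 1) / 2.
Proof.
elim: k => [|k IH]; first by rewrite big_nil div0n /=; field.
rewrite (_ : iota 1 k.+1 = iota 1 k ++ [:: k.+1]); last by rewrite -[in LHS](addn1 k) iotaD add1n.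
rewrite big_cat big_seq1 IH /ind3; cbn -[INR divn dvdn].
case: ifP => h.
  have [e he] : exists e, (k.+1 = 3 * e.+1)%N by exists (k %/ 3); lia.
  have -> : (k.+1 %/ 3 = (k %/ 3).+1)%N by lia.
  have -> : INR k.+1 = 3 * INR (k %/ 3) + 3.
    rewrite (_ : k.+1 = 3 * (k %/ 3).+1)%N; last by lia.
    by rewrite (mult_INR 3) INR3 S_INR; ring.
  by rewrite S_INR; field.
have -> : (k.+1 %/ 3 = k %/ 3)%N by lia.
by field.
Qed.

Lemma sols_ind3 n :
  \rsum_(t <- sols n) ((INR t.1.1 * (1 - ind3 t.1.1)) * (INR t.1.2 * (1 - ind3 t.1.2))) =
  \rsum_(p <- facts n) (2 / 9 * INR p.1 ^ 3 * ind3 p.1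
     + / 6 * (INR p.1 ^ 3 - INR p.1) * (1 - ind3 p.1)).
Proof.
unshelve epose proof (@liouville_weighted_facts ind3
  (fun d => let x := INR d in
   ind3 d * (x ^ 3 - 3 * x ^ 2) / 6 + (1 - ind3 d) * (x ^ 3 - 3 * x ^ 2 + 2 * x) / 6) n _) as H.
  move=> d d0.
  transitivity (INR d * (\rsum_(l <- iota 1 d.-1) ((INR d - INR l) * ind3 l))).
    by rewrite -rsum_scal; apply: eq_bigr => l _; ring.
  rewrite rsum_ind3; cbn -[INR divn dvdn]; rewrite /ind3; case: ifP => h.
    have e : (d = 3 * (d.-1 %/ 3).+1)%N by lia.
    have -> : INR d = 3 * INR (d.-1 %/ 3) + 3.
      by rewrite [in LHS]e (mult_INR 3) INR3 S_INR; ring.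
    by field.
  have [e|e] : (d = 3 * (d.-1 %/ 3) + 1 \/ d = 3 * (d.-1 %/ 3) + 2)%N by lia.
  - have -> : INR d = 3 * INR (d.-1 %/ 3) + 1.
      by rewrite [in LHS]e plus_INR (mult_INR 3) INR3; cbn -[divn]; ring.
    by field.
  - have -> : INR d = 3 * INR (d.-1 %/ 3) + 2.
      by rewrite [in LHS]e plus_INR (mult_INR 3) INR3; cbn -[divn]; ring.
    by field.
transitivity (2 / 3 * (\rsum_(t <- sols n) (INR t.1.1 * INR t.1.2 *
     ((ind3 (t.1.1 + t.1.2)%N + ind3 ((t.1.1 - t.1.2) + (t.1.2 - t.1.1))%N) / 2
      - ind3 t.1.1 - ind3 t.1.2)))
   + 2 / 3 * (\rsum_(t <- sols n) (INR t.1.1 * INR t.1.2))).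
  rewrite -!rsum_scal -big_split; apply: eq_bigr => -[[a b] xy] _; cbn -[INR addn subn ind3].
  have -> : (ind3 (a + b) + ind3 ((a - b) + (b - a))) / 2 - ind3 a - ind3 b =
     3 / 2 * (1 - ind3 a) * (1 - ind3 b) - 1; last by field.
  rewrite /ind3.
  have h1 : ((3 %| a + b) = ((a + b) %% 3 == 0))%N by lia.
  have h2 : ((3 %| (a - b) + (b - a)) = (a %% 3 == b %% 3))%N by lia.
  case: ifP => e1; case: ifP => e2; case: ifP => e3; case: ifP => e4; try field; lia.
rewrite H sols_1_1 -!rsum_scal -big_split; apply: eq_bigr => p _; cbn -[INR ind3].
rewrite (_ : ind3 0%N = 1) // /ind3; case: ifP => _; field.
Qed.

Definition divsum (g : nat -> nat -> R) (n : nat) : R := \rsum_(p <- facts n) g p.1 p.2.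

Lemma sum_f_R0_iota (f : nat -> R) n : sum_f_R0 f n = \rsum_(k <- iota 0 n.+1) f k.
Proof.
elim: n => [|n IH]; first by rewrite /= big_seq1.
rewrite (_ : iota 0 n.+2 = iota 0 n.+1 ++ [:: n.+1]); last by rewrite -[in LHS](addn1 n.+1) iotaD.
by rewrite big_cat big_seq1 -IH.
Qed.

Lemma divsum_conv (g h : nat -> nat -> R) n :
  sum_f_R0 (fun k => divsum g k * divsum h (n - k)%coq_nat) n =
  \rsum_(t <- sols n) (g t.1.1 t.2.1 * h t.1.2 t.2.2).
Proof.
rewrite sum_f_R0_iota.
pose W k := [seq (p, q) | p <- facts k, q <- facts (n - k)].
pose G (u : nat * ((nat * nat) * (nat * nat))) := g u.2.1.1 u.2.1.2 * h u.2.2.1 u.2.2.2.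
transitivity (\rsum_(u <- [seq (k, w) | k <- iota 0 n.+1, w <- W k]) G u).
  rewrite (@big_allpairs_dep _ _ _ _ (fun _ => _) _ (fun k w => (k, w)) _ _ G).
  apply: eq_bigr => k _; rewrite big_allpairs.
  by rewrite /divsum big_distrlr.
symmetry.
rewrite -(@rsum_bij _ _ _ _ (fun t => true) xpredT
   (fun t => ((t.1.1 * t.2.1)%N, ((t.1.1, t.2.1), (t.1.2, t.2.2))))
   (fun u => ((u.2.1.1, u.2.2.1), (u.2.1.2, u.2.2.2))) G (uniq_sols n)) //.
- apply: allpairs_uniq_dep; first exact: iota_uniq.
    move=> k _; apply: allpairs_uniq; rewrite ?uniq_facts //.
    by move=> [p q] [p' q'] _ _ /= [-> ->].
  by move=> [p l] [p' l'] _ _ /= [-> ->].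
- move=> [[a b] [x y]] /=; rewrite mem_sols => h1 _; split => //.
  apply/allpairsPdep; exists (a * x)%N, ((a, x), (b, y)); split => //.
    by rewrite mem_iota; lia.
  apply/allpairsP; exists ((a, x), (b, y)); split => //=; rewrite mem_facts; lia.
move=> [k [[a x] [b y]]] /=.
move=> /allpairsPdep[k' [w []]]; rewrite mem_iota => hk /allpairsP[[[a' x'] [b' y']] []] /=.
rewrite !mem_facts => h1 h2 -> [-> -> -> -> ->] _.
rewrite mem_sols; split => //; first by lia.
by congr (_, _); lia.
Qed.

Lemma divsum_ext (g h : nat -> nat -> R) n :
  (forall a x, (a * x = n)%coq_nat -> g a x = h a x) -> divsum g n = divsum h n.
Proof. by move=> H; apply: eq_rsum_facts => d m _ _ e /=; apply: H; rewrite multE. Qed.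

Lemma divsum_plus (g h : nat -> nat -> R) n :
  divsum (fun a x => g a x + h a x) n = divsum g n + divsum h n.
Proof. exact: big_split. Qed.

Lemma divsum_scal c (g : nat -> nat -> R) n :
  divsum (fun a x => c * g a x) n = c * divsum g n.
Proof. exact: rsum_scal. Qed.

Lemma divsum_0 (g : nat -> nat -> R) : divsum g 0 = 0.
Proof. by rewrite /divsum big_nil. Qed.

Lemma divsum_1 (g : nat -> nat -> R) : divsum g 1 = g 1%N 1%N.
Proof. by rewrite /divsum /facts /= big_seq1. Qed.

Definition div_term (g : nat -> nat -> R) (n a : nat) : R :=
  if (Nat.ltb 0 a && Nat.ltb 0 n && Nat.eqb (Nat.modulo n a) 0)%bool
  then g a (Nat.div n a) else 0.

Lemma divsum_sum_f_R0 (g : nat -> nat -> R) n :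
  divsum g n = sum_f_R0 (div_term g n) n.
Proof.
rewrite sum_f_R0_iota.
rewrite (bigID (fun a => (0 < a) && (a %| n))%N).
rewrite [X in _ = _ + X]big1_seq; last first.
  move=> a /andP[h1 _]; rewrite /div_term.
  case: (Nat.ltb_spec 0 a) => // ha; case: (Nat.ltb_spec 0 n) => // hn /=.
  case: (Nat.eqb_spec (Nat.modulo n a) 0) => // e.
  have ee := Nat.div_mod_eq n a; case/negP: h1.
  apply/andP; split; first by lia.
  by apply/dvdnP; exists (Nat.div n a); rewrite e Nat.add_0_r in ee; rewrite mulnC.
rewrite /divsum Monoid.mulm1.
case: n => [|n].
  by rewrite big_nil big_seq_cond big1 // => i; rewrite /div_term andbF.
rewrite -(@rsum_bij _ _ _ _ xpredT (fun a => (0 < a) && (a %| n.+1))%N (fun p => p.1)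
   (fun a => (a, Nat.div n.+1 a)) (div_term g n.+1) (uniq_facts n.+1) (iota_uniq _ _)).
- apply: eq_rsum_facts => d m d0 m0 e /=; rewrite /div_term -e.
  have -> : (Nat.ltb 0 d) by apply/Nat.ltb_lt; lia.
  have -> : (Nat.ltb 0 (d * m)) by apply/Nat.ltb_lt; lia.
  rewrite (_ : (d * m)%N = (m * d)%coq_nat); last by lia.
  rewrite Nat.Div0.mod_mul Nat.div_mul /=; lia || done.
- move=> [a x]; rewrite mem_facts => /and3P[a0 x0 /eqP e] _; split.
  + by rewrite [fst _]/= mem_iota; nia.
  + by rewrite [fst _]/= a0 -e dvdn_mulr.
  by rewrite [fst _]/= -e (_ : (a * x)%N = (x * a)%coq_nat) ?Nat.div_mul //; lia.
move=> a; rewrite mem_iota => ha /andP[a0 /dvdnP[x e]].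
rewrite mem_facts e (_ : (x * a)%N = (x * a)%coq_nat); last by lia.
rewrite Nat.div_mul; last by lia.
split => //; nia.
Qed.

Lemma conv_1_1 n :
  sum_f_R0 (fun k => divsum (fun a _ => INR a) k * divsum (fun a _ => INR a) (n - k)%coq_nat) n
  = divsum (fun d m => 5 / 12 * INR d ^ 3 + INR d / 12 - INR d ^ 2 * INR m / 2) n.
Proof. by rewrite divsum_conv sols_1_1. Qed.

Lemma conv_1_3 n :
  sum_f_R0 (fun k => divsum (fun a _ => INR a) k * divsum (fun a _ => INR a ^ 3) (n - k)%coq_nat) n
  = divsum (fun d m => 7 / 80 * INR d ^ 5 + INR d ^ 3 / 24
     - INR d ^ 4 * INR m / 8 - INR d / 240) n.
Proof. by rewrite divsum_conv sols_1_3. Qed.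

Lemma conv_3_3 n :
  sum_f_R0 (fun k => divsum (fun a _ => INR a ^ 3) k * divsum (fun a _ => INR a ^ 3) (n - k)%coq_nat) n
  = divsum (fun d m => (INR d ^ 7 - INR d ^ 3) / 120) n.
Proof. by rewrite divsum_conv sols_3_3. Qed.

Lemma conv_1_5 n :
  sum_f_R0 (fun k => divsum (fun a _ => INR a) k * divsum (fun a _ => INR a ^ 5) (n - k)%coq_nat) n
  = divsum (fun d m => / 24 * (20 / 21 * INR d ^ 7 - 2 * INR d ^ 6 * INR m
      + INR d ^ 5 + INR d / 21)) n.
Proof.
rewrite divsum_conv /divsum rsum_scal -sols_1_5 -rsum_scal.
by apply: eq_bigr => t _; field.
Qed.

Lemma conv_ind3 n :
  let g := fun (a _ : nat) => INR a * (1 - ind3 a) in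
  sum_f_R0 (fun k => divsum g k * divsum g (n - k)%coq_nat) n
  = divsum (fun d m => 2 / 9 * INR d ^ 3 * ind3 d
     + / 6 * (INR d ^ 3 - INR d) * (1 - ind3 d)) n.
Proof. by rewrite /= divsum_conv sols_ind3. Qed.

Lemma ind3_mod n : Nat.modulo n 3 <> O -> ind3 n = 0.
Proof. by move=> h; rewrite /ind3; case: ifP => // /dvdnP[k e]; case: h; rewrite e; exact: Nat.Div0.mod_mul. Qed.

Lemma divsum_ind3 (g : nat -> nat -> R) n :
  divsum (fun a x => ind3 a * g (Nat.div a 3) x) n =
  if Nat.eqb (Nat.modulo n 3) 0 then divsum g (Nat.div n 3) else 0.
Proof.
transitivity (\rsum_(p <- facts n | (3 %| p.1)%N) g (Nat.div p.1 3) p.2).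
  rewrite [RHS]big_mkcond; apply: eq_bigr => p _; rewrite /ind3; case: ifP => _; ring.
case: (Nat.eqb_spec (Nat.modulo n 3) 0) => h.
  have [k ek] : exists k, (n = 3 * k)%N.
    exists (Nat.div n 3); have := Nat.div_mod_eq n 3; rewrite h Nat.add_0_r; exact.
  rewrite ek (_ : (3 * k)%N = (k * 3)%coq_nat); last by lia.
  rewrite Nat.div_mul //; symmetry.
  rewrite -(@rsum_bij _ _ _ _ xpredT (fun p => (3 %| p.1)%N) (fun p => (3 * p.1, p.2)%N)
    (fun p => (Nat.div p.1 3, p.2)) (fun p => g (Nat.div p.1 3) p.2) (uniq_facts k)
    (uniq_facts (k * 3)%coq_nat)).
  - apply: eq_bigr => -[a x] _; cbn [fst snd].
    rewrite (_ : (3 * a)%N = (a * 3)%coq_nat); last by lia.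
    by rewrite Nat.div_mul.
  - move=> [a x]; rewrite mem_facts => /and3P[a0 x0 /eqP e] _.
    rewrite [fst _]/= [snd _]/= mem_facts; split; first by lia.
      by rewrite dvdn_mulr.
    by rewrite [fst _]/= (_ : (3 * a)%N = (a * 3)%coq_nat) ?Nat.div_mul //; lia.
  move=> [a x]; rewrite mem_facts [fst _]/= => /and3P[a0 x0 /eqP e] /dvdnP[c ec].
  rewrite ec (_ : (c * 3)%N = (c * 3)%coq_nat) ?Nat.div_mul // mem_facts.
  subst a; cbn [fst snd]; split => //; first by lia.
  by congr (_, _); lia.
rewrite big1_seq // => -[a x] /andP[/dvdnP[c ec]]; rewrite mem_facts => /and3P[a0 x0 /eqP e].
case: h; rewrite [fst _]/= in ec; rewrite -e ec (_ : (c * 3 * x)%N = (c * x * 3)%coq_nat); last by lia.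
exact: Nat.Div0.mod_mul.
Qed.

End Convolution.

(** * Complex derivatives *)

Lemma locally_Cmod (z : C) (P : C -> Prop) :
  locally z P <-> exists d, (0 < d)%R /\ forall y, (Cmod (y - z) < d)%R -> P y.
Proof.
split.
- intros H. apply (@locally_norm_le_locally C_AbsRing C_NormedModule) in H.
  destruct H as [d Hd]. exists d. split. apply cond_pos. intros y Hy. apply Hd. exact Hy.
- intros [d [Hd H]]. apply (@locally_le_locally_norm C_AbsRing C_NormedModule).
  exists (mkposreal d Hd). intros y Hy. apply H. exact Hy.
Qed.

Lemma open_Cmod (U : C -> Prop) :
  open U <-> forall z, U z -> exists d, (0 < d)%R /\ forall y, (Cmod (y - z) < d)%R -> U y.
Proof.
split; intros H z Hz; specialize (H z Hz); now apply locally_Cmod in H || apply locally_Cmod.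
Qed.

Definition Cder (f : C -> C) (z l : C) : Prop := @is_derive C_AbsRing C_NormedModule f z l.

Lemma Cder_intro (f : C -> C) (z l : C) :
  (forall eps, (0 < eps)%R -> exists d, (0 < d)%R /\ forall y, (Cmod (y - z) < d)%R ->
     (Cmod (f y - f z - (y - z) * l) <= eps * Cmod (y - z))%R) -> Cder f z l.
Proof.
intros H. split.
- apply is_linear_scal_l.
- intros x Hx eps.
  assert (E := @is_filter_lim_locally_unique C_AbsRing (AbsRing_NormedModule C_AbsRing) z x Hx). subst x.
  destruct (H eps (cond_pos eps)) as [d [Hd Hy]].
  exists (mkposreal d Hd). exact Hy.
Qed.

Lemma Cder_elim (f : C -> C) (z l : C) : Cder f z l ->
  forall eps, (0 < eps)%R -> exists d, (0 < d)%R /\ forall y, (Cmod (y - z) < d)%R ->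
     (Cmod (f y - f z - (y - z) * l) <= eps * Cmod (y - z))%R.
Proof.
intros [_ H] eps He.
specialize (H z (fun P HP => HP) (mkposreal eps He)).
destruct H as [d Hd]. exists d. split; [apply cond_pos|]. exact Hd.
Qed.

Lemma Cder_unique f z l1 l2 : Cder f z l1 -> Cder f z l2 -> l1 = l2.
Proof.
intros H1 H2. apply is_C_derive_unique in H1. apply is_C_derive_unique in H2. congruence.
Qed.

Lemma Cder_eq f z l l' : Cder f z l -> l = l' -> Cder f z l'.
Proof. now intros H <-. Qed.

Lemma Cder_ext_loc (f g : C -> C) z l d : (0 < d)%R ->
  (forall y, (Cmod (y - z) < d)%R -> f y = g y) -> Cder f z l -> Cder g z l.
Proof.
intros Hd H. apply (@is_derive_ext_loc C_AbsRing C_NormedModule).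
exists (mkposreal d Hd). exact H.
Qed.

Lemma Cder_ext (f g : C -> C) z l : (forall y, f y = g y) -> Cder f z l -> Cder g z l.
Proof. intros H. apply (@is_derive_ext C_AbsRing C_NormedModule). exact H. Qed.

Lemma Cder_AbsRing (f : C -> C) z l :
  @is_derive C_AbsRing (AbsRing_NormedModule C_AbsRing) f z l <-> Cder f z l.
Proof.
split.
- intros [_ H]. apply Cder_intro. intros eps He.
  destruct (H z (fun P HP => HP) (mkposreal eps He)) as [d Hd].
  exists d. split; [apply cond_pos|]. exact Hd.
- intros H. split.
  + apply is_linear_scal_l.
  + intros x Hx eps.
    assert (E := @is_filter_lim_locally_unique C_AbsRing (AbsRing_NormedModule C_AbsRing) z x Hx).
    subst x. destruct (Cder_elim f z l H eps (cond_pos eps)) as [d [Hd Hy]].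
    exists (mkposreal d Hd). exact Hy.
Qed.

Lemma Cder_const c z : Cder (fun _ => c) z 0.
Proof. apply (@is_derive_const C_AbsRing C_NormedModule). Qed.

Lemma Cder_id z : Cder (fun x => x) z 1.
Proof. apply Cder_AbsRing, (@is_derive_id C_AbsRing). Qed.

Lemma Cder_plus f g z a b : Cder f z a -> Cder g z b -> Cder (fun x => f x + g x) z (a + b).
Proof. apply (@is_derive_plus C_AbsRing C_NormedModule). Qed.

Lemma Cder_minus f g z a b : Cder f z a -> Cder g z b -> Cder (fun x => f x - g x) z (a - b).
Proof. apply (@is_derive_minus C_AbsRing C_NormedModule). Qed.

Lemma Cder_mult f g z a b : Cder f z a -> Cder g z b ->
  Cder (fun x => f x * g x) z (a * g z + f z * b).
Proof.
intros Hf Hg. apply Cder_AbsRing in Hf. apply Cder_AbsRing in Hg.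
apply Cder_AbsRing, (@is_derive_mult C_AbsRing); auto. intros; apply Cmult_comm.
Qed.

Lemma Cder_comp f g z a b : Cder f (g z) a -> Cder g z b -> Cder (fun x => f (g x)) z (b * a).
Proof.
intros Hf Hg. apply Cder_AbsRing in Hg. apply (@is_derive_comp C_AbsRing C_NormedModule f g); auto.
Qed.

Lemma Cmod_minus_sym x y : Cmod (x - y) = Cmod (y - x).
Proof. rewrite <- (Cmod_opp (x - y)). f_equal. ring. Qed.

Lemma Cmod_triang_inv x y : (Cmod x - Cmod y <= Cmod (x - y))%R.
Proof.
replace x with ((x - y) + y) at 1 by ring.
generalize (Cmod_triangle (x - y) y). lra.
Qed.

Lemma Cmult_integral (x y : C) : x * y = 0 -> x = 0 \/ y = 0.
Proof.
intros H. destruct (Ceq_dec x 0) as [|Hx]; [auto|]. right.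
replace y with (/ x * (x * y)) by (field; auto). rewrite H. ring.
Qed.

Lemma Cder_inv (z : C) : z <> 0 -> Cder (fun x => / x) z (- / (z * z)).
Proof.
intros Hz. apply Cder_intro. intros eps He.
assert (Hm : (0 < Cmod z)%R) by (apply Cmod_gt_0; exact Hz).
set (m := Cmod z) in *.
exists (Rmin (m / 2) (eps * m ^ 3 / 2)). split.
{ apply Rmin_glb_lt; [lra|]. apply Rdiv_lt_0_compat; [|lra]. apply Rmult_lt_0_compat; [lra|].
  now apply pow_lt. }
intros y Hy.
assert (Hy1 : (Cmod (y - z) < m / 2)%R) by (eapply Rlt_le_trans; [exact Hy|apply Rmin_l]).
assert (Hy2 : (Cmod (y - z) < eps * m ^ 3 / 2)%R) by (eapply Rlt_le_trans; [exact Hy|apply Rmin_r]).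
assert (Hym : (m / 2 < Cmod y)%R).
{ generalize (Cmod_triang_inv z y). rewrite Cmod_minus_sym. fold m. lra. }
assert (y <> 0) by (apply Cmod_gt_0; lra).
replace (/ y - / z - (y - z) * - / (z * z)) with ((y - z) * (y - z) / (y * z * z))
  by (field; split; auto).
rewrite Cmod_div by (repeat apply Cmult_neq_0; auto).
rewrite !Cmod_mult. fold m.
set (t := Cmod (y - z)) in *. assert (0 <= t)%R by apply Cmod_ge_0.
apply Rmult_le_reg_r with (Cmod y * m * m)%R.
{ repeat apply Rmult_lt_0_compat; lra. }
replace (t * t / (Cmod y * m * m) * (Cmod y * m * m))%R with (t * t)%R by (field; lra).
apply Rle_trans with (t * (eps * m ^ 3 / 2))%R.
{ apply Rmult_le_compat_l; lra. }
replace (eps * t * (Cmod y * m * m))%R with (t * (eps * (m * m) * Cmod y))%R by ring.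
apply Rmult_le_compat_l; [lra|].
replace (eps * m ^ 3 / 2)%R with (eps * (m * m) * (m / 2))%R by field.
apply Rmult_le_compat_l; [|lra]. apply Rmult_le_pos; nra.
Qed.

Lemma Cder_cont f z l : Cder f z l -> forall eps, (0 < eps)%R ->
  exists d, (0 < d)%R /\ forall y, (Cmod (y - z) < d)%R -> (Cmod (f y - f z) < eps)%R.
Proof.
intros H eps He.
assert (Hl := Cmod_ge_0 l).
destruct (Cder_elim f z l H 1 Rlt_0_1) as [d [Hd Hy]].
exists (Rmin d (eps / (2 + Cmod l))). split.
{ apply Rmin_glb_lt; [lra|]. apply Rdiv_lt_0_compat; lra. }
intros y Hyd.
assert (H1 : (Cmod (y - z) < d)%R) by (eapply Rlt_le_trans; [exact Hyd|apply Rmin_l]).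
assert (H2 : (Cmod (y - z) < eps / (2 + Cmod l))%R) by (eapply Rlt_le_trans; [exact Hyd|apply Rmin_r]).
specialize (Hy y H1).
replace (f y - f z) with ((f y - f z - (y - z) * l) + (y - z) * l) by ring.
eapply Rle_lt_trans; [apply Cmod_triangle|]. rewrite Cmod_mult.
assert (0 <= Cmod (y - z))%R by apply Cmod_ge_0.
assert (Cmod (y - z) * (2 + Cmod l) < eps)%R.
{ apply Rmult_lt_reg_r with (/ (2 + Cmod l))%R. apply Rinv_0_lt_compat; lra.
  rewrite Rmult_assoc, Rinv_r by lra. unfold Rdiv in H2. lra. }
nra.
Qed.

(** * The exponential function *)

Lemma Cexp_plus z w : Cexp (z + w) = Cexp z * Cexp w.
Proof.
destruct z as [x y], w as [x' y']. unfold Cexp, Cmult. simpl.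
rewrite exp_plus, cos_plus, sin_plus. f_equal; ring.
Qed.

Lemma Cexp_RtoC (x : R) : Cexp x = RtoC (exp x).
Proof. unfold Cexp, RtoC, Re, Im. simpl. rewrite cos_0, sin_0. f_equal; ring. Qed.

Lemma Cexp_0 : Cexp 0 = 1.
Proof. rewrite Cexp_RtoC, exp_0. reflexivity. Qed.

Lemma Cexp_neq_0 z : Cexp z <> 0.
Proof.
intros H. assert (Cexp z * Cexp (- z) = 1).
{ rewrite <- Cexp_plus, Cplus_opp_r. apply Cexp_0. }
rewrite H, Cmult_0_l in H0. apply C1_nz. auto.
Qed.

Lemma Cexp_opp z : Cexp (- z) = / Cexp z.
Proof.
assert (Cexp z * Cexp (- z) = 1).
{ rewrite <- Cexp_plus, Cplus_opp_r. apply Cexp_0. }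
generalize (Cexp_neq_0 z). intros Hz. rewrite <- (Cmult_1_l (/ Cexp z)), <- H. field. auto.
Qed.

Lemma Cexp_minus z w : Cexp (z - w) = Cexp z / Cexp w.
Proof. unfold Cminus. rewrite Cexp_plus, Cexp_opp. reflexivity. Qed.

Lemma Cexp_INR_mult (n : nat) z : Cexp (INR n * z) = Cexp z ^ n.
Proof.
induction n as [|n IH].
- simpl. rewrite Cmult_0_l. apply Cexp_0.
- rewrite S_INR, RtoC_plus, Cmult_plus_distr_r, Cexp_plus, IH. simpl. rewrite Cmult_1_l. ring.
Qed.

Lemma Cmod_Cexp z : Cmod (Cexp z) = exp (Re z).
Proof.
unfold Cmod, Cexp. simpl.
replace (_ + _)%R with (exp (Re z) ^ 2)%R.
- rewrite sqrt_pow2; [reflexivity|]. left. apply exp_pos.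
- generalize (sin2_cos2 (Im z)). unfold Rsqr. intros H.
  transitivity (exp (Re z) ^ 2 * (sin (Im z) * sin (Im z) + cos (Im z) * cos (Im z)))%R.
  + rewrite H. ring.
  + ring.
Qed.

Lemma derivable_pt_lim_0_elim (f : R -> R) l : derivable_pt_lim f 0 l ->
  forall eps, (0 < eps)%R -> exists d, (0 < d)%R /\ forall h, (Rabs h < d)%R ->
    (Rabs (f h - f 0 - l * h) <= eps * Rabs h)%R.
Proof.
intros H eps He. destruct (H eps He) as [d Hd]. exists d. split; [apply cond_pos|].
intros h Hh. destruct (Req_dec h 0) as [->|Hh0].
- rewrite Rmult_0_r, Rminus_diag, Rminus_0_r, Rabs_R0. lra.
- specialize (Hd h Hh0 Hh). rewrite Rplus_0_l in Hd.
  replace (f h - f 0 - l * h)%R with (((f h - f 0) / h - l) * h)%R by (field; auto).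
  rewrite Rabs_mult. apply Rmult_le_compat_r; [apply Rabs_pos|lra].
Qed.

Lemma Cmod_le_Rabs z : (Cmod z <= Rabs (Re z) + Rabs (Im z))%R.
Proof.
destruct z as [x y]. unfold Re, Im. simpl fst; simpl snd.
replace (x, y) with (RtoC x + RtoC y * Ci) by (apply injective_projections; simpl; ring).
eapply Rle_trans; [apply Cmod_triangle|]. rewrite Cmod_mult, !Cmod_R, Cmod_Ci. lra.
Qed.

Lemma Rabs_Re_le z : (Rabs (Re z) <= Cmod z)%R.
Proof. eapply Rle_trans; [|apply Rmax_Cmod]. apply Rmax_l. Qed.

Lemma Rabs_Im_le z : (Rabs (Im z) <= Cmod z)%R.
Proof. eapply Rle_trans; [|apply Rmax_Cmod]. apply Rmax_r. Qed.

Lemma Cder_exp_0 : Cder Cexp 0 1.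
Proof.
apply Cder_intro. intros eps0 He0.
set (eps := Rmin (eps0 / 8) 1).
assert (He : (0 < eps)%R) by (apply Rmin_glb_lt; lra).
assert (He1 : (eps <= eps0 / 8)%R) by apply Rmin_l.
assert (He2 : (eps <= 1)%R) by apply Rmin_r. clearbody eps.
destruct (derivable_pt_lim_0_elim exp 1 derivable_pt_lim_exp_0 eps He) as [d1 [Hd1 H1]].
destruct (derivable_pt_lim_0_elim sin 1 derivable_pt_lim_sin_0 eps He) as [d2 [Hd2 H2]].
destruct (derivable_pt_lim_0_elim cos 0 derivable_pt_lim_cos_0 eps He) as [d3 [Hd3 H3]].
exists (Rmin (Rmin d1 d2) (Rmin d3 eps)). split.
{ repeat apply Rmin_glb_lt; auto. }
intros h Hh. rewrite Cexp_0.
replace (h - 0) with h in * by ring.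
assert (L : (Cmod h < d1 /\ Cmod h < d2 /\ Cmod h < d3 /\ Cmod h < eps)%R).
{ apply Rmin_Rgt in Hh. destruct Hh as [Ha Hb].
  apply Rmin_Rgt in Ha. apply Rmin_Rgt in Hb. lra. }
destruct L as [L1 [L2 [L3 L4]]].
eapply Rle_trans; [apply Cmod_le_Rabs|].
assert (Rx := Rabs_Re_le h). assert (Ry := Rabs_Im_le h).
destruct h as [x y]. unfold Re, Im in *. simpl fst in *; simpl snd in *.
set (m := Cmod (x, y)) in *.
specialize (H1 x ltac:(lra)). specialize (H2 y ltac:(lra)). specialize (H3 y ltac:(lra)).
rewrite exp_0 in H1. rewrite sin_0 in H2. rewrite cos_0 in H3.
set (e := (exp x - 1 - 1 * x)%R) in *. set (c := (cos y - 1 - 0 * y)%R) in *.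
set (t := (sin y - 0 - 1 * y)%R) in *.
assert (Hc : (Rabs (cos y) <= 1)%R) by (apply Rabs_le; generalize (COS_bound y); lra).
assert (Hs : (Rabs (sin y) <= 1)%R) by (apply Rabs_le; generalize (SIN_bound y); lra).
assert (Hs2 : (Rabs (sin y) <= 2 * m)%R).
{ replace (sin y) with (t + y)%R by (unfold t; ring).
  eapply Rle_trans; [apply Rabs_triang|]. generalize (Rabs_pos y). nra. }
assert (A1 : (Rabs (e * cos y) <= eps * m)%R).
{ rewrite Rabs_mult. generalize (Rabs_pos e) (Rabs_pos (cos y)) (Rabs_pos x). nra. }
assert (A2 : (Rabs ((1 + x) * c) <= 2 * (eps * m))%R).
{ rewrite Rabs_mult.
  assert (Rabs (1 + x) <= 2)%R.
  { eapply Rle_trans; [apply Rabs_triang|]. rewrite Rabs_R1. lra. }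
  generalize (Rabs_pos c) (Rabs_pos (1 + x)) (Rabs_pos y). nra. }
assert (A3 : (Rabs (e * sin y) <= eps * m)%R).
{ rewrite Rabs_mult. generalize (Rabs_pos e) (Rabs_pos (sin y)) (Rabs_pos x). nra. }
assert (A4 : (Rabs (x * sin y) <= 2 * (eps * m))%R).
{ rewrite Rabs_mult. generalize (Rabs_pos x) (Rabs_pos (sin y)). nra. }
assert (A5 : (Rabs t <= eps * m)%R).
{ generalize (Rabs_pos y). nra. }
assert (B1 := Rabs_triang (e * cos y) ((1 + x) * c)).
assert (B2 := Rabs_triang (e * sin y + x * sin y) t).
assert (B3 := Rabs_triang (e * sin y) (x * sin y)).
assert (0 <= m)%R by apply Cmod_ge_0.
assert (eps * m <= eps0 / 8 * m)%R by (apply Rmult_le_compat_r; lra).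
assert (0 <= eps0 * m)%R by (apply Rmult_le_pos; lra).
match goal with |- (Rabs ?A + Rabs ?B <= _)%R =>
  replace A with (e * cos y + (1 + x) * c)%R by (unfold e, c; simpl; ring);
  replace B with (e * sin y + x * sin y + t)%R by (unfold e, t; simpl; ring) end.
lra.
Qed.

Lemma Cder_exp z : Cder Cexp z (Cexp z).
Proof.
apply Cder_ext with (fun x => Cexp z * Cexp (x - z)).
{ intros y. rewrite <- Cexp_plus. f_equal. ring. }
apply (Cder_eq _ _ (0 * Cexp (z - z) + Cexp z * ((1 - 0) * 1))); [|ring].
apply (Cder_mult (fun _ => Cexp z) (fun x => Cexp (x - z))); [apply Cder_const|].
apply (Cder_comp Cexp (fun x => x - z)).
- replace (z - z) with (RtoC 0) by ring. apply Cder_exp_0.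
- apply Cder_minus; [apply Cder_id|apply Cder_const].
Qed.

(** * Functions with zero derivative *)

Lemma norm_C_R (z : C) : @norm R_AbsRing C_R_NormedModule z = Cmod z.
Proof.
unfold norm; simpl. unfold prod_norm, Cmod; simpl. f_equal.
change (@norm R_AbsRing _ (fst z)) with (Rabs (fst z)).
change (@norm R_AbsRing _ (snd z)) with (Rabs (snd z)).
generalize (Rsqr_abs (fst z)) (Rsqr_abs (snd z)). unfold Rsqr. lra.
Qed.

Lemma Cder_segment (f : C -> C) (z w l : C) (s : R) :
  Cder f (z + s * w) l ->
  @is_derive R_AbsRing C_R_NormedModule (fun t : R => f (z + t * w)) s (w * l).
Proof.
intros H. split.
- apply is_linear_scal_l.
- intros x Hx eps.
  assert (E := @is_filter_lim_locally_unique R_AbsRing (AbsRing_NormedModule R_AbsRing) s x Hx).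
  subst x.
  assert (Hw := Cmod_ge_0 w).
  assert (He : (0 < eps / (1 + Cmod w))%R).
  { apply Rdiv_lt_0_compat; [apply cond_pos|lra]. }
  destruct (Cder_elim f _ l H _ He) as [d [Hd Hy]].
  assert (Hd' : (0 < d / (1 + Cmod w))%R) by (apply Rdiv_lt_0_compat; lra).
  exists (mkposreal _ Hd'). intros t Ht.
  assert (Ht' : (Rabs (t - s) < d / (1 + Cmod w))%R) by exact Ht.
  assert (E : z + t * w - (z + s * w) = RtoC (t - s) * w).
  { rewrite RtoC_minus. ring. }
  specialize (Hy (z + t * w)). rewrite E, Cmod_mult, Cmod_R in Hy.
  assert (L : (Rabs (t - s) * (1 + Cmod w) < d)%R).
  { apply Rmult_lt_reg_r with (/ (1 + Cmod w))%R. apply Rinv_0_lt_compat; lra.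
    rewrite Rmult_assoc, Rinv_r by lra. unfold Rdiv in Ht'. lra. }
  assert (P := Rabs_pos (t - s)).
  specialize (Hy ltac:(nra)).
  rewrite norm_C_R.
  match goal with |- (Cmod ?A <= _)%R =>
    replace A with (f (z + t * w) - f (z + s * w) - RtoC (t - s) * w * l) end.
  2:{ unfold minus, plus, opp, scal; simpl. unfold prod_scal, scal, mult; simpl.
      apply injective_projections; simpl; unfold plus, opp; simpl; unfold mult; simpl; ring. }
  change (norm (minus t s)) with (Rabs (t - s)).
  eapply Rle_trans; [exact Hy|].
  assert (Cmod w / (1 + Cmod w) <= 1)%R.
  { apply Rmult_le_reg_r with (1 + Cmod w)%R; [lra|]. unfold Rdiv. rewrite Rmult_assoc, Rinv_l; lra. }
  replace (eps / (1 + Cmod w) * (Rabs (t - s) * Cmod w))%R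
    with (eps * Rabs (t - s) * (Cmod w / (1 + Cmod w)))%R by (field; lra).
  assert (0 <= eps * Rabs (t - s))%R by (apply Rmult_le_pos; [left; apply cond_pos|auto]).
  nra.
Qed.

Lemma Cder_0_segment (f : C -> C) (z y : C) :
  (forall s : R, (0 <= s <= 1)%R -> Cder f (z + s * (y - z)) 0) -> f y = f z.
Proof.
intros H.
assert (E := @eq_is_derive C_R_NormedModule (fun t : R => f (z + t * (y - z))) 0 1).
cbv beta in E. symmetry.
replace (f z) with (f (z + 0%R * (y - z))) by (f_equal; ring).
replace (f y) with (f (z + 1%R * (y - z))) by (f_equal; ring).
apply E; [|lra]. intros t Ht.
replace (@zero C_R_NormedModule) with ((y - z) * 0) by (rewrite Cmult_0_r; reflexivity).
apply Cder_segment. auto.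
Qed.

Definition euler (f : C -> C) (q v : C) : Prop := exists l, Cder f q l /\ q * l = v.

Lemma euler_cont f z v : euler f z v -> forall eps, (0 < eps)%R ->
  exists d, (0 < d)%R /\ forall y, (Cmod (y - z) < d)%R -> (Cmod (f y - f z) < eps)%R.
Proof. intros [l [H _]]. apply Cder_cont with l. exact H. Qed.

Lemma euler_0_ball (f : C -> C) (z : C) d :
  (forall y, (Cmod (y - z) < d)%R -> euler f y 0) ->
  z = 0 \/ (d <= Cmod z)%R ->
  forall y, (Cmod (y - z) < d)%R -> f y = f z.
Proof.
intros H Hz y Hy.
assert (Hseg : forall s : R, (0 <= s <= 1)%R -> (Cmod (z + s * (y - z) - z) < d)%R).
{ intros s Hs. replace (z + s * (y - z) - z) with (s * (y - z)) by ring.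
  rewrite Cmod_mult, Cmod_R, Rabs_right by lra.
  assert (0 <= Cmod (y - z))%R by apply Cmod_ge_0. nra. }
assert (H0 : forall x, (Cmod (x - z) < d)%R -> x <> 0 -> Cder f x 0).
{ intros x Hx Hx0. destruct (H x Hx) as [l [Hl E]].
  destruct (Cmult_integral _ _ E) as [E'|E']; [contradiction|]. now subst l. }
destruct Hz as [Hz|Hz].
- subst z. replace (y - 0) with y in Hy by ring.
  destruct (Ceq_dec y 0) as [->|Hy0]; [reflexivity|].
  apply NNPP. intros Hne.
  assert (Hp : (0 < Cmod (f y - f 0))%R).
  { apply Cmod_gt_0. intros E. apply Hne. replace (f y) with (f y - f 0 + f 0) by ring.
    rewrite E. ring. }
  assert (Hd : (0 < d)%R) by (eapply Rle_lt_trans; [apply Cmod_ge_0|exact Hy]).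
  destruct (euler_cont f 0 0 (H 0 ltac:(replace (0 - 0) with (RtoC 0) by ring; rewrite Cmod_0; lra))
    _ Hp) as [d' [Hd' Hc]].
  assert (Hm : (0 < Cmod y)%R) by (apply Cmod_gt_0; auto).
  set (r := Rmin 1 (d' / (2 * Cmod y))).
  assert (Hr : (0 < r)%R).
  { apply Rmin_glb_lt; [lra|]. apply Rdiv_lt_0_compat; lra. }
  assert (Hr1 : (r <= 1)%R) by apply Rmin_l.
  assert (Hr2 : (r * Cmod y < d')%R).
  { apply Rle_lt_trans with (d' / (2 * Cmod y) * Cmod y)%R.
    - apply Rmult_le_compat_r; [lra|apply Rmin_r].
    - replace (d' / (2 * Cmod y) * Cmod y)%R with (d' / 2)%R by (field; lra). lra. }
  assert (E : f y = f (r * y)).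
  { apply Cder_0_segment. intros s Hs.
    replace (r * y + s * (y - r * y)) with (RtoC (r + s * (1 - r)) * y)
      by (rewrite RtoC_plus, RtoC_mult, RtoC_minus; ring).
    assert (0 < r + s * (1 - r) <= 1)%R by nra.
    apply H0.
    - replace (RtoC (r + s * (1 - r)) * y - 0) with (RtoC (r + s * (1 - r)) * y) by ring.
      rewrite Cmod_mult, Cmod_R, Rabs_right by lra. nra.
    - apply Cmult_neq_0; auto. intros E. apply RtoC_inj in E. lra. }
  specialize (Hc (r * y)). rewrite <- E in Hc.
  assert (Cmod (f y - f 0) < Cmod (f y - f 0))%R; [|lra].
  apply Hc. replace (r * y - 0) with (r * y) by ring.
  rewrite Cmod_mult, Cmod_R, Rabs_right by lra. exact Hr2.
- apply Cder_0_segment. intros s Hs. apply H0; [auto|].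
  intros E. specialize (Hseg s Hs). rewrite E in Hseg.
  replace (0 - z) with (- z) in Hseg by ring. rewrite Cmod_opp in Hseg. lra.
Qed.

Lemma euler_0_open (O : C -> Prop) (f : C -> C) (c : C) :
  open O -> (forall q, O q -> euler f q 0) -> open (fun q => O q /\ f q = c).
Proof.
intros HO Hf. apply open_Cmod. intros z [Oz E].
destruct (proj1 (open_Cmod O) HO z Oz) as [d [Hd Hb]].
destruct (Ceq_dec z 0) as [Hz|Hz].
- exists d. split; [exact Hd|]. intros y Hy. split; [auto|].
  rewrite <- E. apply euler_0_ball with d; auto.
- assert (0 < Cmod z)%R by (apply Cmod_gt_0; auto).
  exists (Rmin d (Cmod z)). split; [apply Rmin_glb_lt; auto|].
  intros y Hy. assert (Cmod (y - z) < d)%R by (eapply Rlt_le_trans; [exact Hy|apply Rmin_l]).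
  split; [auto|]. rewrite <- E. apply euler_0_ball with (Rmin d (Cmod z)); auto.
  + intros x Hx. apply Hf, Hb. eapply Rlt_le_trans; [exact Hx|apply Rmin_l].
  + right. apply Rmin_r.
Qed.

(** * The Euler operator [q d/dq] *)

Lemma euler_unique f q v w : euler f q v -> euler f q w -> v = w.
Proof. intros [l [H <-]] [l' [H' <-]]. now rewrite (Cder_unique _ _ _ _ H H'). Qed.

Lemma euler_eq f q v w : euler f q v -> v = w -> euler f q w.
Proof. now intros H <-. Qed.

Lemma euler_ext f g q v : (forall x, f x = g x) -> euler f q v -> euler g q v.
Proof. intros E [l [H H']]. exists l. split; [|auto]. now apply Cder_ext with f. Qed.

Lemma euler_ext_open (O : C -> Prop) f g q v : open O -> O q ->
  (forall x, O x -> f x = g x) -> euler f q v -> euler g q v.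
Proof.
intros HO Oq E [l [H H']]. exists l. split; [|auto].
destruct (proj1 (open_Cmod O) HO q Oq) as [d [Hd Hb]].
apply Cder_ext_loc with f d; auto.
Qed.

Lemma euler_const c q : euler (fun _ => c) q 0.
Proof. exists 0. split; [apply Cder_const|ring]. Qed.

Lemma euler_id q : euler (fun x => x) q q.
Proof. exists 1. split; [apply Cder_id|ring]. Qed.

Lemma euler_plus f g q a b : euler f q a -> euler g q b -> euler (fun x => f x + g x) q (a + b).
Proof. intros [l [H <-]] [l' [H' <-]]. exists (l + l'). split; [now apply Cder_plus|ring]. Qed.

Lemma euler_minus f g q a b : euler f q a -> euler g q b -> euler (fun x => f x - g x) q (a - b).
Proof. intros [l [H <-]] [l' [H' <-]]. exists (l - l'). split; [now apply Cder_minus|ring]. Qed.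

Lemma euler_mult f g q a b : euler f q a -> euler g q b ->
  euler (fun x => f x * g x) q (a * g q + f q * b).
Proof. intros [l [H <-]] [l' [H' <-]]. eexists. split; [apply Cder_mult; eassumption|ring]. Qed.

Lemma euler_scal c f q a : euler f q a -> euler (fun x => c * f x) q (c * a).
Proof.
intros H. apply euler_eq with (0 * f q + c * a); [|ring].
apply (euler_mult (fun _ => c)); [apply euler_const|auto].
Qed.

Lemma euler_comp f phi q l a : Cder f (phi q) l -> euler phi q a ->
  euler (fun x => f (phi x)) q (a * l).
Proof. intros Hf [k [H <-]]. exists (k * l). split; [now apply Cder_comp|ring]. Qed.

Lemma euler_exp phi q a : euler phi q a -> euler (fun x => Cexp (phi x)) q (a * Cexp (phi q)).
Proof. intros H. apply euler_comp; [apply Cder_exp|auto]. Qed.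

Lemma euler_inv f q a : euler f q a -> f q <> 0 -> euler (fun x => / f x) q (- a / (f q * f q)).
Proof.
intros H Hf. apply euler_eq with (a * (- / (f q * f q))); [|field; auto].
apply (euler_comp Cinv); [now apply Cder_inv|auto].
Qed.

Lemma euler_div f g q a b : euler f q a -> euler g q b -> g q <> 0 ->
  euler (fun x => f x / g x) q ((a * g q - f q * b) / (g q * g q)).
Proof.
intros Hf Hg H. eapply euler_eq.
- apply euler_mult; [exact Hf|]. apply euler_inv; eauto.
- cbv beta. field. auto.
Qed.

Lemma euler_pow f q a n : euler f q a ->
  euler (fun x => f x ^ S n) q (INR (S n) * f q ^ n * a).
Proof.
intros H. induction n as [|n IH].
- apply euler_ext with f; [intros; simpl; ring|]. apply euler_eq with a; [auto|]. simpl. ring.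
- apply euler_ext with (fun x => f x * f x ^ S n); [reflexivity|].
  eapply euler_eq; [apply euler_mult; eauto|].
  rewrite (S_INR (S n)), RtoC_plus. simpl (f q ^ S n). ring.
Qed.

Lemma open_neq_0 (O : C -> Prop) (f : C -> C) : open O ->
  (forall q, O q -> exists v, euler f q v) -> open (fun q => O q /\ f q <> 0).
Proof.
intros HO Hf. apply open_Cmod. intros z [Oz Hz].
destruct (proj1 (open_Cmod O) HO z Oz) as [d [Hd Hb]].
destruct (Hf z Oz) as [v Hv].
destruct (euler_cont f z v Hv (Cmod (f z))) as [d' [Hd' Hc]]; [apply Cmod_gt_0; auto|].
exists (Rmin d d'). split; [apply Rmin_glb_lt; auto|].
intros y Hy. split.
- apply Hb. eapply Rlt_le_trans; [exact Hy|apply Rmin_l].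
- intros E. specialize (Hc y). rewrite E in Hc.
  replace (0 - f z) with (- f z) in Hc by ring. rewrite Cmod_opp in Hc.
  assert (Cmod (f z) < Cmod (f z))%R; [|lra]. apply Hc. eapply Rlt_le_trans; [exact Hy|apply Rmin_r].
Qed.

Lemma open_Cmod_lt_1 (O : C -> Prop) (f : C -> C) : open O ->
  (forall q, O q -> exists v, euler f q v) -> open (fun q => O q /\ (Cmod (f q) < 1)%R).
Proof.
intros HO Hf. apply open_Cmod. intros z [Oz Hz].
destruct (proj1 (open_Cmod O) HO z Oz) as [d [Hd Hb]].
destruct (Hf z Oz) as [v Hv].
destruct (euler_cont f z v Hv (1 - Cmod (f z))) as [d' [Hd' Hc]]; [lra|].
exists (Rmin d d'). split; [apply Rmin_glb_lt; auto|].
intros y Hy. split.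
- apply Hb. eapply Rlt_le_trans; [exact Hy|apply Rmin_l].
- assert (Cmod (f y - f z) < 1 - Cmod (f z))%R.
  { apply Hc. eapply Rlt_le_trans; [exact Hy|apply Rmin_r]. }
  generalize (Cmod_triang_inv (f y) (f z)). lra.
Qed.

Lemma open_disc : open (fun q => (Cmod q < 1)%R).
Proof.
apply open_Cmod. intros z Hz. exists (1 - Cmod z)%R. split; [lra|].
intros y Hy. generalize (Cmod_triang_inv y z). lra.
Qed.

(** * Complex series *)

Lemma filterlim_Cmod (x : nat -> C) (l : C) :
  filterlim x eventually (locally l) <->
  forall eps, (0 < eps)%R -> exists N, forall n, (N <= n)%nat -> (Cmod (x n - l) < eps)%R.
Proof.
split.
- intros H eps He. apply (H (fun y => (Cmod (y - l) < eps)%R)).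
  apply locally_Cmod. exists eps. auto.
- intros H P HP. apply locally_Cmod in HP. destruct HP as [d [Hd HP]].
  destruct (H d Hd) as [N HN]. exists N. auto.
Qed.

Definition Cser (x : nat -> C) (l : C) : Prop := @is_series C_AbsRing C_NormedModule x l.

Lemma Cser_filterlim x l : Cser x l <-> filterlim (sum_n x) eventually (locally l).
Proof. split; intros H P HP; apply (H P HP). Qed.

Lemma Re_sum_n (x : nat -> C) n : Re (sum_n x n) = sum_n (fun k => Re (x k)) n.
Proof.
induction n as [|n IH]; [now rewrite !sum_O|]. rewrite !sum_Sn, <- IH. reflexivity.
Qed.

Lemma Im_sum_n (x : nat -> C) n : Im (sum_n x n) = sum_n (fun k => Im (x k)) n.
Proof.
induction n as [|n IH]; [now rewrite !sum_O|]. rewrite !sum_Sn, <- IH. reflexivity.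
Qed.

Lemma Cser_Re_Im x l :
  is_series (fun n => Re (x n)) (Re l) -> is_series (fun n => Im (x n)) (Im l) -> Cser x l.
Proof.
intros H1 H2. apply Cser_filterlim, filterlim_Cmod. intros eps He.
assert (He2 : (0 < eps / 2)%R) by lra.
destruct (H1 (fun y => Rabs (y - Re l) < eps / 2)%R) as [N1 HN1].
{ exists (mkposreal _ He2). intros y Hy. exact Hy. }
destruct (H2 (fun y => Rabs (y - Im l) < eps / 2)%R) as [N2 HN2].
{ exists (mkposreal _ He2). intros y Hy. exact Hy. }
exists (max N1 N2). intros n Hn.
eapply Rle_lt_trans; [apply Cmod_le_Rabs|].
specialize (HN1 n ltac:(lia)). specialize (HN2 n ltac:(lia)).
rewrite <- Re_sum_n in HN1. rewrite <- Im_sum_n in HN2.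
change (Re (sum_n x n - l)) with (Re (sum_n x n) - Re l)%R.
change (Im (sum_n x n - l)) with (Im (sum_n x n) - Im l)%R.
lra.
Qed.

Lemma is_series_Re x l : Cser x l -> is_series (fun n => Re (x n)) (Re l).
Proof.
intros H. apply Cser_filterlim in H.
assert (H' : filterlim (fun n => fst (sum_n x n)) eventually (locally (fst l))).
{ apply (filterlim_comp _ _ _ (sum_n x) fst _ (locally l)); [exact H|].
  destruct l. apply continuous_fst. }
intros P HP. specialize (H' P HP). destruct H' as [N HN]. exists N. intros n Hn.
rewrite <- Re_sum_n. exact (HN n Hn).
Qed.

Lemma is_series_Im x l : Cser x l -> is_series (fun n => Im (x n)) (Im l).
Proof.
intros H. apply Cser_filterlim in H.
assert (H' : filterlim (fun n => snd (sum_n x n)) eventually (locally (snd l))).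
{ apply (filterlim_comp _ _ _ (sum_n x) snd _ (locally l)); [exact H|].
  destruct l. apply continuous_snd. }
intros P HP. specialize (H' P HP). destruct H' as [N HN]. exists N. intros n Hn.
rewrite <- Im_sum_n. exact (HN n Hn).
Qed.

Lemma Cser_CSeries_abs (x : nat -> C) (b : nat -> R) :
  (forall n, (Cmod (x n) <= b n)%R) -> ex_series b -> Cser x (CSeries x).
Proof.
intros H1 H2.
assert (E : @ex_series C_AbsRing C_CompleteNormedModule x).
{ apply (@ex_series_le C_AbsRing C_CompleteNormedModule) with b; auto. }
destruct E as [l Hl]. assert (Hl' : Cser x l) by exact Hl.
rewrite (CSeries_correct x l Hl). exact Hl'.
Qed.

Lemma Cser_ext x y l : (forall n, x n = y n) -> Cser x l -> Cser y l.
Proof. intros H. apply is_series_ext. exact H. Qed.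

Lemma Cser_plus x y l k : Cser x l -> Cser y k -> Cser (fun n => x n + y n) (l + k).
Proof. apply (@is_series_plus C_AbsRing C_NormedModule). Qed.

Lemma Cser_minus x y l k : Cser x l -> Cser y k -> Cser (fun n => x n - y n) (l - k).
Proof. apply (@is_series_minus C_AbsRing C_NormedModule). Qed.

Lemma Cser_scal c x l : Cser x l -> Cser (fun n => c * x n) (c * l).
Proof. apply (@is_series_scal C_AbsRing C_NormedModule). Qed.

Lemma Cmod_sum_n_le (x : nat -> C) (b : nat -> R) n :
  (forall n, (Cmod (x n) <= b n)%R) -> (Cmod (sum_n x n) <= sum_n b n)%R.
Proof.
intros H. induction n as [|n IH]; [rewrite !sum_O; auto|].
rewrite !sum_Sn. eapply Rle_trans; [apply Cmod_triangle|].
apply Rplus_le_compat; auto.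
Qed.

Lemma Cmod_Cser_le (x : nat -> C) (b : nat -> R) (l : C) (B : R) :
  Cser x l -> is_series b B -> (forall n, (Cmod (x n) <= b n)%R) -> (Cmod l <= B)%R.
Proof.
intros Hx Hb H. apply Rnot_lt_le. intros Hlt.
set (e := ((Cmod l - B) / 2)%R). assert (He : (0 < e)%R) by (unfold e; lra).
apply Cser_filterlim in Hx. destruct (proj1 (filterlim_Cmod _ _) Hx e He) as [N1 HN1].
destruct (Hb (fun y => Rabs (y - B) < e)%R) as [N2 HN2].
{ exists (mkposreal _ He). intros y Hy. exact Hy. }
set (n := max N1 N2). specialize (HN1 n ltac:(lia)). specialize (HN2 n ltac:(lia)).
assert (H1 := Cmod_sum_n_le x b n H).
assert (H2 := Cmod_triang_inv l (sum_n x n)). rewrite Cmod_minus_sym in H2.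
apply Rabs_def2 in HN2. destruct HN2 as [H3 H4].
assert (H5 : (sum_n (G := R_AbelianMonoid) b n - B < e)%R) by exact H3.
assert (H6 : (Cmod (sum_n (G := C_AbelianMonoid) x n - l) < e)%R) by exact HN1.
unfold e in *. lra.
Qed.

Lemma sum_n_C_sum_f_R0 (f : nat -> R) n : RtoC (sum_f_R0 f n) = sum_n (fun k => RtoC (f k)) n.
Proof.
induction n as [|n IH]; [now rewrite sum_O|]. rewrite sum_Sn, <- IH. simpl. now rewrite RtoC_plus.
Qed.

Lemma Cser_mult (u v : nat -> C) lu lv :
  Cser u lu -> Cser v lv ->
  ex_series (fun n => Cmod (u n)) -> ex_series (fun n => Cmod (v n)) ->
  Cser (fun n => sum_n (fun k => u k * v (n - k)%nat) n) (lu * lv).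
Proof.
intros Hu Hv Au Av.
assert (F : forall (w : nat -> C) (g : C -> R), (forall z, (Rabs (g z) <= Cmod z)%R) ->
   ex_series (fun n => Cmod (w n)) -> ex_series (fun n => Rabs (g (w n)))).
{ intros w g Hg Hw. apply (@ex_series_le R_AbsRing R_CompleteNormedModule) with (2 := Hw).
  intros n. change (Rabs (Rabs (g (w n))) <= Cmod (w n))%R. rewrite Rabs_Rabsolu. apply Hg. }
assert (R1 := is_series_mult _ _ _ _ (is_series_Re _ _ Hu) (is_series_Re _ _ Hv)
   (F u Re Rabs_Re_le Au) (F v Re Rabs_Re_le Av)).
assert (R2 := is_series_mult _ _ _ _ (is_series_Im _ _ Hu) (is_series_Im _ _ Hv)
   (F u Im Rabs_Im_le Au) (F v Im Rabs_Im_le Av)).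
assert (R3 := is_series_mult _ _ _ _ (is_series_Re _ _ Hu) (is_series_Im _ _ Hv)
   (F u Re Rabs_Re_le Au) (F v Im Rabs_Im_le Av)).
assert (R4 := is_series_mult _ _ _ _ (is_series_Im _ _ Hu) (is_series_Re _ _ Hv)
   (F u Im Rabs_Im_le Au) (F v Re Rabs_Re_le Av)).
apply Cser_Re_Im.
- rewrite re_mult. eapply is_series_ext; [|exact (is_series_minus _ _ _ _ R1 R2)].
  intros n. rewrite Re_sum_n. rewrite sum_n_Reals.
  change (sum_f_R0 (fun k => Re (u k) * Re (v (n - k)%nat))%R n
     - sum_f_R0 (fun k => Im (u k) * Im (v (n - k)%nat))%R n =
     sum_f_R0 (fun k => Re (u k * v (n - k)%nat)%C) n)%R.
  rewrite <- minus_sum. apply sum_eq. intros k _. now rewrite re_mult.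
- rewrite im_mult. eapply is_series_ext; [|exact (is_series_plus _ _ _ _ R3 R4)].
  intros n. rewrite Im_sum_n. rewrite sum_n_Reals.
  change (sum_f_R0 (fun k => Re (u k) * Im (v (n - k)%nat))%R n
     + sum_f_R0 (fun k => Im (u k) * Re (v (n - k)%nat))%R n =
     sum_f_R0 (fun k => Im (u k * v (n - k)%nat)%C) n)%R.
  rewrite <- plus_sum. apply sum_eq. intros k _. now rewrite im_mult.
Qed.

(** * Power series with coefficients of polynomial growth *)

Definition polyb (a : nat -> R) : Prop :=
  exists M k, (0 <= M)%R /\ forall n, (Rabs (a n) <= M * (INR n + 1) ^ k)%R.

Lemma INR_S_ge_1 n : (1 <= INR n + 1)%R.
Proof. generalize (pos_INR n). lra. Qed.

Lemma INR_S_pow_pos n k : (0 < (INR n + 1) ^ k)%R.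
Proof. apply pow_lt. generalize (pos_INR n). lra. Qed.

Lemma polyb_ext a b : (forall n, a n = b n) -> polyb a -> polyb b.
Proof. intros E [M [k [HM H]]]. exists M, k. split; auto. intros n. rewrite <- E. auto. Qed.

Lemma polyb_le a b : polyb b -> (forall n, (Rabs (a n) <= b n)%R) -> polyb a.
Proof.
intros [M [k [HM H]]] Hab. exists M, k. split; auto. intros n.
eapply Rle_trans; [apply Hab|]. eapply Rle_trans; [apply Rle_abs|]. apply H.
Qed.

Lemma polyb_const c : polyb (fun _ => c).
Proof. exists (Rabs c), 0%nat. split; [apply Rabs_pos|]. intros n. simpl. lra. Qed.

Lemma polyb_plus a b : polyb a -> polyb b -> polyb (fun n => a n + b n)%R.
Proof.
intros [M [k [HM H]]] [M' [k' [HM' H']]]. exists (M + M')%R, (k + k')%nat. split; [lra|].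
intros n. eapply Rle_trans; [apply Rabs_triang|]. rewrite Rmult_plus_distr_r.
specialize (H n). specialize (H' n). rewrite pow_add.
assert (P := INR_S_ge_1 n).
assert (1 <= (INR n + 1) ^ k)%R by now apply pow_R1_Rle.
assert (1 <= (INR n + 1) ^ k')%R by now apply pow_R1_Rle.
apply Rplus_le_compat; (eapply Rle_trans; [eassumption|]); apply Rmult_le_compat_l; auto; nra.
Qed.

Lemma polyb_mult a b : polyb a -> polyb b -> polyb (fun n => a n * b n)%R.
Proof.
intros [M [k [HM H]]] [M' [k' [HM' H']]]. exists (M * M')%R, (k + k')%nat. split; [nra|].
intros n. rewrite Rabs_mult, pow_add.
replace (M * M' * ((INR n + 1) ^ k * (INR n + 1) ^ k'))%R
  with ((M * (INR n + 1) ^ k) * (M' * (INR n + 1) ^ k'))%R by ring.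
apply Rmult_le_compat; auto using Rabs_pos.
Qed.

Lemma polyb_scal c a : polyb a -> polyb (fun n => c * a n)%R.
Proof. apply (polyb_mult (fun _ => c)), polyb_const. Qed.

Lemma polyb_INR : polyb INR.
Proof.
exists 1%R, 1%nat. split; [lra|]. intros n. rewrite Rabs_right; simpl; generalize (pos_INR n); lra.
Qed.

Lemma polyb_shift a : polyb a -> polyb (fun n => a (S n)).
Proof.
intros [M [k [HM H]]]. exists (M * 2 ^ k)%R, k. split.
- apply Rmult_le_pos; auto. apply pow_le. lra.
- intros n. eapply Rle_trans; [apply H|]. rewrite Rmult_assoc, <- Rpow_mult_distr.
  apply Rmult_le_compat_l; auto. apply pow_incr. rewrite S_INR. generalize (pos_INR n). lra.
Qed.

Lemma polyb_conv a b : polyb a -> polyb b ->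
  polyb (fun n => sum_f_R0 (fun k => a k * b (n - k)%nat)%R n).
Proof.
intros [M [k [HM H]]] [M' [k' [HM' H']]].
exists (M * M')%R, (S (k + k'))%nat. split; [nra|]. intros n.
eapply Rle_trans; [apply Rsum_abs|].
apply Rle_trans with (sum_f_R0 (fun _ => (M * (INR n + 1) ^ k) * (M' * (INR n + 1) ^ k'))%R n).
- apply sum_Rle. intros j Hj. rewrite Rabs_mult. apply Rmult_le_compat; try apply Rabs_pos.
  + eapply Rle_trans; [apply H|]. apply Rmult_le_compat_l; auto.
    apply pow_incr. apply le_INR in Hj. generalize (pos_INR j). lra.
  + eapply Rle_trans; [apply H'|]. apply Rmult_le_compat_l; auto.
    apply pow_incr. assert (n - j <= n)%nat as Hn by lia. apply le_INR in Hn.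
    generalize (pos_INR (n - j)). lra.
- rewrite sum_cte, S_INR. simpl. rewrite pow_add. right. ring.
Qed.

Lemma ex_series_poly_geom k r : (0 <= r < 1)%R ->
  ex_series (fun n => (INR n + 1) ^ k * r ^ n)%R.
Proof.
intros Hr.
assert (CV : forall k, CV_radius (fun n => (INR n + 1) ^ k)%R = Finite 1).
{ clear. induction k as [|k IH].
  - rewrite (CV_radius_finite_DAlembert _ 1).
    + f_equal. field.
    + intros n. simpl. lra.
    + lra.
    + apply is_lim_seq_ext with (fun _ => 1%R); [|apply is_lim_seq_const].
      intros n. simpl. rewrite Rdiv_1_r. now rewrite Rabs_R1.
  - rewrite <- IH. rewrite <- (CV_radius_incr_1 (fun n => (INR n + 1) ^ k)%R).
    rewrite <- (CV_radius_derive (PS_incr_1 _)). apply CV_radius_ext.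
    intros n. unfold PS_derive. rewrite S_INR. simpl. ring. }
assert (H := CV_disk_inside (fun n => (INR n + 1) ^ k)%R r).
rewrite CV in H. apply ex_series_Rabs, H. simpl. rewrite Rabs_right; lra.
Qed.

Lemma polyb_ex_series a r : polyb a -> (0 <= r < 1)%R ->
  ex_series (fun n => Rabs (a n) * r ^ n)%R.
Proof.
intros [M [k [HM H]]] Hr.
apply (@ex_series_le R_AbsRing R_CompleteNormedModule)
  with (fun n => M * ((INR n + 1) ^ k * r ^ n))%R.
- intros n. change (Rabs (Rabs (a n) * r ^ n) <= M * ((INR n + 1) ^ k * r ^ n))%R.
  assert (0 <= r ^ n)%R by (apply pow_le; lra).
  rewrite Rabs_mult, Rabs_Rabsolu, (Rabs_right (r ^ n)) by lra.
  rewrite <- Rmult_assoc. apply Rmult_le_compat_r; auto.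
- apply (@ex_series_scal R_AbsRing R_NormedModule M). apply ex_series_poly_geom. exact Hr.
Qed.

Definition CPS (a : nat -> R) (q : C) : C := CSeries (fun n => RtoC (a n) * q ^ n).

Lemma Cmod_term a q n : Cmod (RtoC (a n) * q ^ n) = (Rabs (a n) * Cmod q ^ n)%R.
Proof. now rewrite Cmod_mult, Cmod_R, Cmod_pow. Qed.

Lemma CPS_correct a q : polyb a -> (Cmod q < 1)%R -> Cser (fun n => RtoC (a n) * q ^ n) (CPS a q).
Proof.
intros Ha Hq. apply Cser_CSeries_abs with (fun n => Rabs (a n) * Cmod q ^ n)%R.
- intros n. rewrite Cmod_term. lra.
- apply polyb_ex_series; auto. split; [apply Cmod_ge_0|auto].
Qed.

Lemma CPS_eq a q l : Cser (fun n => RtoC (a n) * q ^ n) l -> CPS a q = l.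
Proof. apply CSeries_correct. Qed.

Lemma CPS_ext a b q : (forall n, a n = b n) -> polyb a -> (Cmod q < 1)%R -> CPS a q = CPS b q.
Proof.
intros E Ha Hq. symmetry. apply CPS_eq. eapply Cser_ext; [|apply CPS_correct; eauto].
intros n. simpl. now rewrite E.
Qed.

Lemma CPS_plus a b q : polyb a -> polyb b -> (Cmod q < 1)%R ->
  CPS (fun n => a n + b n)%R q = CPS a q + CPS b q.
Proof.
intros Ha Hb Hq. apply CPS_eq. eapply Cser_ext; [|apply Cser_plus; apply CPS_correct; auto].
intros n. simpl. rewrite RtoC_plus. ring.
Qed.

Lemma CPS_scal c a q : polyb a -> (Cmod q < 1)%R -> CPS (fun n => c * a n)%R q = c * CPS a q.
Proof.
intros Ha Hq. apply CPS_eq. eapply Cser_ext; [|apply Cser_scal; apply CPS_correct; auto].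
intros n. simpl. rewrite RtoC_mult. ring.
Qed.

Lemma CPS_mult a b q : polyb a -> polyb b -> (Cmod q < 1)%R ->
  CPS (fun n => sum_f_R0 (fun k => a k * b (n - k)%nat)%R n) q = CPS a q * CPS b q.
Proof.
intros Ha Hb Hq. apply CPS_eq.
assert (Hm := Cmod_ge_0 q).
eapply Cser_ext; [|apply Cser_mult; [apply CPS_correct; [exact Ha|exact Hq]|
   apply CPS_correct; [exact Hb|exact Hq]|..]].
- intros n. cbv beta.
  rewrite sum_n_C_sum_f_R0, Cmult_comm.
  rewrite <- (sum_n_mult_l (K := C_Ring) (q ^ n)). apply sum_n_ext_loc. intros k Hk.
  change (RtoC (a k) * q ^ k * (RtoC (b (n - k)%nat) * q ^ (n - k))
    = q ^ n * RtoC (a k * b (n - k)%nat)).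
  rewrite RtoC_mult. replace n with (k + (n - k))%nat at 3 by lia.
  rewrite Cpow_add_r. ring.
- eapply ex_series_ext; [|apply (polyb_ex_series a (Cmod q)); auto].
  intros n. symmetry. apply Cmod_term.
- eapply ex_series_ext; [|apply (polyb_ex_series b (Cmod q)); auto].
  intros n. symmetry. apply Cmod_term.
Qed.

Lemma CPS_decr a q : polyb a -> (Cmod q < 1)%R -> CPS a q = a 0%nat + q * CPS (fun n => a (S n)) q.
Proof.
intros Ha Hq. apply CPS_eq. apply is_series_decr_1.
match goal with |- is_series _ ?L => replace L with (q * CPS (fun n => a (S n)) q) end.
- apply (Cser_ext (fun n => q * (RtoC (a (S n)) * q ^ n))); [intros n; simpl; ring|].
  apply Cser_scal, CPS_correct; [apply (polyb_shift a Ha)|auto].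
- unfold plus, opp; simpl. ring.
Qed.

Lemma CPS_0 a : polyb a -> CPS a 0 = a 0%nat.
Proof. intros Ha. rewrite CPS_decr; auto; [ring|rewrite Cmod_0; lra]. Qed.

Lemma pow_taylor_bound (y z : C) (r : R) (n : nat) :
  (0 < r)%R -> (Cmod y <= r)%R -> (Cmod z <= r)%R ->
  (Cmod (y ^ n - z ^ n - (y - z) * (INR n * z ^ pred n)) * r ^ 2
    <= INR n ^ 2 * r ^ n * Cmod (y - z) ^ 2)%R.
Proof.
intros Hr Hy Hz.
assert (Ht := Cmod_ge_0 (y - z)). assert (Hy0 := Cmod_ge_0 y). assert (Hz0 := Cmod_ge_0 z).
induction n as [|n IH].
{ simpl. replace (1 - 1 - (y - z) * (0 * 1)) with (RtoC 0) by ring. rewrite Cmod_0. lra. }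
assert (E : y ^ S n - z ^ S n - (y - z) * (INR (S n) * z ^ pred (S n)) =
   y * (y ^ n - z ^ n - (y - z) * (INR n * z ^ pred n)) + INR n * z ^ pred n * ((y - z) * (y - z))).
{ rewrite S_INR, RtoC_plus. destruct n as [|n]; [simpl; ring|]. simpl pred. simpl Cpow. ring. }
rewrite E. clear E.
set (t := Cmod (y - z)) in *.
set (e := y ^ n - z ^ n - (y - z) * (INR n * z ^ pred n)) in *.
assert (B : (Cmod (INR n * z ^ pred n * ((y - z) * (y - z))) * r ^ 2 <= INR n * r ^ S n * t ^ 2)%R).
{ rewrite !Cmod_mult, Cmod_R, Cmod_pow. fold t. rewrite Rabs_right by (generalize (pos_INR n); lra).
  destruct n as [|n]; [simpl; lra|]. simpl pred.
  replace (INR (S n) * r ^ S (S n) * t ^ 2)%R with (INR (S n) * (r ^ n * r ^ 2) * t ^ 2)%R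
    by (simpl; ring).
  replace (INR (S n) * Cmod z ^ n * (t * t) * r ^ 2)%R
    with (INR (S n) * (Cmod z ^ n * r ^ 2) * t ^ 2)%R by ring.
  apply Rmult_le_compat_r; [apply pow2_ge_0|].
  apply Rmult_le_compat_l; [apply pos_INR|].
  apply Rmult_le_compat_r; [apply pow2_ge_0|]. apply pow_incr. lra. }
assert (A : (Cmod (y * e) * r ^ 2 <= INR n ^ 2 * r ^ S n * t ^ 2)%R).
{ rewrite Cmod_mult. replace (INR n ^ 2 * r ^ S n * t ^ 2)%R with (r * (INR n ^ 2 * r ^ n * t ^ 2))%R
    by (simpl; ring).
  rewrite Rmult_assoc. apply Rmult_le_compat; auto.
  apply Rmult_le_pos; [apply Cmod_ge_0|apply pow2_ge_0]. }
apply Rle_trans with ((Cmod (y * e) + Cmod (INR n * z ^ pred n * ((y - z) * (y - z)))) * r ^ 2)%R.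
{ apply Rmult_le_compat_r; [apply pow2_ge_0|apply Cmod_triangle]. }
rewrite Rmult_plus_distr_r.
eapply Rle_trans; [apply Rplus_le_compat; eassumption|].
rewrite S_INR.
assert (0 <= r ^ S n * t ^ 2)%R.
{ apply Rmult_le_pos; [apply pow_le; lra|apply pow2_ge_0]. }
assert (0 <= INR n)%R by apply pos_INR.
replace (INR n ^ 2 * r ^ S n * t ^ 2 + INR n * r ^ S n * t ^ 2)%R
  with ((INR n ^ 2 + INR n) * (r ^ S n * t ^ 2))%R by ring.
replace ((INR n + 1) ^ 2 * r ^ S n * t ^ 2)%R with ((INR n + 1) ^ 2 * (r ^ S n * t ^ 2))%R by ring.
apply Rmult_le_compat_r; nra.
Qed.

Lemma Cder_CPS a q : polyb a -> (Cmod q < 1)%R ->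
  exists l, Cder (CPS a) q l /\ q * l = CPS (fun n => INR n * a n)%R q.
Proof.
intros Ha Hq.
assert (Hq0 := Cmod_ge_0 q).
set (r := ((1 + Cmod q) / 2)%R).
assert (Hr : (Cmod q < r < 1)%R) by (unfold r; lra).
assert (Hr2 : (0 < r ^ 2)%R) by (apply pow_lt; lra).
assert (Ha2 : polyb (fun n => INR n ^ 2 * a n)%R).
{ apply polyb_mult; auto. apply (polyb_ext (fun n => INR n * INR n)%R); [intros; ring|].
  apply polyb_mult; apply polyb_INR. }
assert (Ha1 : polyb (fun n => INR n * a n)%R) by (apply polyb_mult; auto; apply polyb_INR).
assert (Ser := polyb_ex_series _ r Ha2 ltac:(lra)).
assert (Ser1 := polyb_ex_series _ r Ha1 ltac:(lra)).
set (l := CSeries (fun n => RtoC (a n) * (INR n * q ^ pred n))).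
assert (Hl : Cser (fun n => RtoC (a n) * (INR n * q ^ pred n)) l).
{ apply Cser_CSeries_abs with (fun n => / r * (Rabs (INR n * a n) * r ^ n))%R.
  - intros n. rewrite !Cmod_mult, !Cmod_R, Cmod_pow, Rabs_mult.
    destruct n as [|n]; [simpl; rewrite Rabs_R0; lra|]. simpl pred.
    replace (/ r * (Rabs (INR (S n)) * Rabs (a (S n)) * r ^ S n))%R
      with (Rabs (a (S n)) * (Rabs (INR (S n)) * r ^ n))%R by (simpl; field; lra).
    apply Rmult_le_compat_l; [apply Rabs_pos|]. apply Rmult_le_compat_l; [apply Rabs_pos|].
    apply pow_incr. lra.
  - apply (@ex_series_scal R_AbsRing R_NormedModule (/ r)%R). exact Ser1. }
exists l. split.
- destruct Ser as [B HB].
  assert (HB0 : (0 <= B)%R).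
  { apply Rle_trans with (Cmod 0); [rewrite Cmod_0; lra|].
    apply (Cmod_Cser_le (fun _ => 0) _ 0 B) with (2 := HB).
    - assert (X := Cser_scal 0 _ _ (CPS_correct a q Ha Hq)). rewrite Cmult_0_l in X.
      apply (Cser_ext _ _ _) with (2 := X). intros n. cbv beta. ring.
    - intros n. rewrite Cmod_0. apply Rmult_le_pos; [apply Rabs_pos|apply pow_le; lra]. }
  assert (Key : forall y, (Cmod y < r)%R ->
     (Cmod (CPS a y - CPS a q - (y - q) * l) <= B / r ^ 2 * Cmod (y - q) ^ 2)%R).
  { intros y Hy.
    assert (S1 := Cser_minus _ _ _ _ (Cser_minus _ _ _ _ (CPS_correct a y Ha ltac:(lra))
      (CPS_correct a q Ha Hq)) (Cser_scal (y - q) _ _ Hl)).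
    assert (S2 : is_series (fun n => (Cmod (y - q) ^ 2 / r ^ 2) * (Rabs (INR n ^ 2 * a n) * r ^ n))%R
       ((Cmod (y - q) ^ 2 / r ^ 2) * B)%R).
    { apply (@is_series_scal R_AbsRing R_NormedModule). exact HB. }
    replace (B / r ^ 2 * Cmod (y - q) ^ 2)%R with (Cmod (y - q) ^ 2 / r ^ 2 * B)%R by (field; lra).
    apply (Cmod_Cser_le _ _ _ _ S1 S2). intros n. cbv beta.
    replace (RtoC (a n) * y ^ n - RtoC (a n) * q ^ n - (y - q) * (RtoC (a n) * (INR n * q ^ pred n)))
      with (RtoC (a n) * (y ^ n - q ^ n - (y - q) * (INR n * q ^ pred n))) by ring.
    rewrite Cmod_mult, Cmod_R, Rabs_mult.
    rewrite (Rabs_right (INR n ^ 2)) by (apply Rle_ge, pow2_ge_0).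
    assert (T := pow_taylor_bound y q r n ltac:(lra) ltac:(lra) ltac:(lra)).
    apply Rmult_le_reg_r with (r ^ 2)%R; [auto|].
    replace (Cmod (y - q) ^ 2 / r ^ 2 * (INR n ^ 2 * Rabs (a n) * r ^ n) * r ^ 2)%R
      with (Rabs (a n) * (INR n ^ 2 * r ^ n * Cmod (y - q) ^ 2))%R by (field; lra).
    rewrite Rmult_assoc. apply Rmult_le_compat_l; [apply Rabs_pos|exact T]. }
  apply Cder_intro. intros eps He.
  set (K := (B / r ^ 2)%R) in *.
  assert (HK : (0 <= K)%R) by (apply Rmult_le_pos; [auto|left; apply Rinv_0_lt_compat; auto]).
  exists (Rmin (r - Cmod q) (eps / (1 + K))). split.
  { apply Rmin_glb_lt; [lra|]. apply Rdiv_lt_0_compat; lra. }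
  intros y Hy. apply Rmin_Rgt in Hy. destruct Hy as [Hy1 Hy2].
  assert (HT := Cmod_triang_inv y q).
  eapply Rle_trans; [apply Key; lra|].
  assert (0 <= Cmod (y - q))%R by apply Cmod_ge_0.
  assert (L : (Cmod (y - q) * (1 + K) < eps)%R).
  { apply Rmult_lt_reg_r with (/ (1 + K))%R. apply Rinv_0_lt_compat; lra.
    rewrite Rmult_assoc, Rinv_r by lra. unfold Rdiv in Hy2. lra. }
  nra.
- symmetry. apply CPS_eq. eapply Cser_ext; [|apply Cser_scal; exact Hl].
  intros n. simpl. rewrite RtoC_mult. destruct n as [|n]; [simpl; ring|]. simpl pred. simpl Cpow. ring.
Qed.

Lemma euler_CPS a q : polyb a -> (Cmod q < 1)%R ->
  euler (CPS a) q (CPS (fun n => INR n * a n)%R q).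
Proof. apply Cder_CPS. Qed.

Lemma euler_CPS_comp a phi q w : polyb a -> (Cmod (phi q) < 1)%R -> euler phi q (phi q * w) ->
  euler (fun x => CPS a (phi x)) q (CPS (fun n => INR n * a n)%R (phi q) * w).
Proof.
intros Ha Hq H. destruct (Cder_CPS a (phi q) Ha Hq) as [l [Hl E]].
eapply euler_eq; [apply (euler_comp (CPS a) phi q l _ Hl H)|]. rewrite <- E. ring.
Qed.

Lemma CPS_one z : (Cmod z < 1)%R -> CPS (fun _ => 1%R) z = / (1 - z).
Proof.
intros Hz. assert (Hz1 : 1 - z <> 0).
{ intros E. assert (z = 1) by (replace z with (1 - (1 - z)) by ring; rewrite E; ring).
  subst z. rewrite Cmod_1 in Hz. lra. }
assert (H := CPS_decr (fun _ => 1%R) z (polyb_const 1) Hz).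
cbv beta in H. set (p := CPS (fun _ => 1%R) z) in *.
assert (p * (1 - z) = 1) by (replace (p * (1 - z)) with (p - z * p) by ring; rewrite H at 1; ring).
replace p with (p * (1 - z) * / (1 - z)) by (field; auto). rewrite H0. ring.
Qed.

Definition posc (a : nat -> R) (n : nat) : R := match n with O => 0%R | S _ => a n end.

Lemma polyb_posc a : polyb a -> polyb (posc a).
Proof.
intros [M [k [HM H]]]. exists M, k. split; auto. intros [|n]; [|apply H].
simpl posc. rewrite Rabs_R0. apply Rmult_le_pos; auto. left. apply INR_S_pow_pos.
Qed.

Lemma CPS_posc_const c z : (Cmod z < 1)%R -> CPS (posc (fun _ => c)) z = c * (z / (1 - z)).
Proof.
intros Hz. rewrite CPS_decr; auto; [|apply polyb_posc, polyb_const]. simpl posc.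
rewrite (CPS_ext _ (fun _ => c * 1)%R); auto; [|intros; ring|apply polyb_const].
rewrite (CPS_scal c (fun _ => 1%R)); auto; [|apply polyb_const]. rewrite CPS_one by auto.
unfold Cdiv. ring.
Qed.

(** * The logarithm series *)

Definition logc : nat -> R := posc (fun n => - / INR n)%R.

Lemma polyb_logc : polyb logc.
Proof.
apply polyb_le with (fun _ => 1%R); [apply polyb_const|].
intros [|n]; simpl posc; [unfold logc; simpl; rewrite Rabs_R0; lra|].
unfold logc, posc. rewrite Rabs_Ropp, Rabs_right.
- rewrite <- Rinv_1. apply Rinv_le_contravar; [lra|]. rewrite S_INR. generalize (pos_INR n). lra.
- left. apply Rinv_0_lt_compat, lt_0_INR. lia.
Qed.

Definition lam : C -> C := CPS logc.

Lemma CPS_theta_logc z : (Cmod z < 1)%R -> CPS (fun n => INR n * logc n)%R z = - (z / (1 - z)).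
Proof.
intros Hz. rewrite <- (CPS_ext (posc (fun _ => -1)%R)); auto.
- rewrite CPS_posc_const by auto. change (-1)%R with (- (1))%R. rewrite RtoC_opp. ring.
- intros [|n]; unfold logc, posc; [simpl; ring|]. field. apply not_0_INR. lia.
- apply polyb_posc, polyb_const.
Qed.

Lemma one_minus_neq_0 (z : C) : (Cmod z < 1)%R -> 1 - z <> 0.
Proof.
intros Hz E. assert (z = 1) by (replace z with (1 - (1 - z)) by ring; rewrite E; ring).
subst z. rewrite Cmod_1 in Hz. lra.
Qed.

Lemma lam_0 : lam 0 = 0.
Proof. apply CPS_0, polyb_logc. Qed.

Lemma Cexp_lam z : (Cmod z < 1)%R -> Cexp (lam z) = 1 - z.
Proof.
intros Hz.
assert (H : Cexp (lam z) / (1 - z) = Cexp (lam 0) / (1 - 0)).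
{ apply (euler_0_ball (fun z => Cexp (lam z) / (1 - z)) 0 1).
  - intros y Hy. replace (y - 0) with y in Hy by ring.
    eapply euler_eq.
    + apply (euler_div (fun z => Cexp (lam z)) (fun z => 1 - z)).
      * apply euler_exp, (euler_CPS logc); [apply polyb_logc|auto].
      * apply euler_minus; [apply euler_const|apply euler_id].
      * apply one_minus_neq_0; auto.
    + rewrite CPS_theta_logc by auto. fold lam. assert (Q := one_minus_neq_0 y Hy). field. auto.
  - now left.
  - replace (z - 0) with z by ring. exact Hz. }
rewrite lam_0, Cexp_0 in H.
assert (Q := one_minus_neq_0 z Hz).
replace (Cexp (lam z)) with (Cexp (lam z) / (1 - z) * (1 - z)) by (field; auto).
rewrite H. field.
Qed.

(** * Lambert series *)

Import Convolution.

Definition sparse (k : nat) (a : nat -> R) (n : nat) : R :=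
  if Nat.eqb (n mod k) 0 then a (n / k)%nat else 0%R.

Lemma polyb_sparse k a : polyb a -> polyb (sparse k a).
Proof.
intros [M [j [HM H]]]. exists M, j. split; auto. intros n. unfold sparse.
destruct (Nat.eqb _ _).
- eapply Rle_trans; [apply H|]. apply Rmult_le_compat_l; auto. apply pow_incr.
  assert (n / k <= n)%nat as Hn.
  { destruct k as [|k]; [simpl; lia|]. apply Nat.Div0.div_le_upper_bound. nia. }
  apply le_INR in Hn. generalize (pos_INR (n / k)). lra.
- rewrite Rabs_R0. apply Rmult_le_pos; auto. left. apply INR_S_pow_pos.
Qed.

Lemma CPS_sparse k a q : (0 < k)%nat -> polyb a -> (Cmod q < 1)%R ->
  CPS (sparse k a) q = CPS a (q ^ k).
Proof.
intros Hk Ha Hq.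
assert (Hqk : (Cmod (q ^ k) < 1)%R).
{ rewrite Cmod_pow. assert (P := Cmod_ge_0 q). apply pow_lt_1_compat; auto. }
apply CPS_eq. assert (H := CPS_correct a (q ^ k) Ha Hqk).
apply Cser_filterlim, filterlim_Cmod. apply Cser_filterlim in H.
intros eps He. destruct (proj1 (filterlim_Cmod _ _) H eps He) as [N HN].
exists (N * k)%nat. intros n Hn.
assert (E : forall n, sum_n (fun n => RtoC (sparse k a n) * q ^ n) n =
   sum_n (fun n => RtoC (a n) * (q ^ k) ^ n) (n / k)).
{ clear - Hk. induction n as [|n IH].
  - rewrite Nat.Div0.div_0_l, !sum_O. unfold sparse. rewrite Nat.Div0.mod_0_l, Nat.Div0.div_0_l.
    simpl. reflexivity.
  - rewrite sum_Sn, IH. unfold sparse.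
    assert (E1 := Nat.div_mod_eq n k). assert (E2 := Nat.div_mod_eq (S n) k).
    assert (B1 := Nat.mod_upper_bound n k ltac:(lia)).
    assert (B2 := Nat.mod_upper_bound (S n) k ltac:(lia)).
    destruct (Nat.eqb_spec (S n mod k) 0) as [Z|Z].
    + assert (E3 : (S n / k = S (n / k))%nat) by nia.
      rewrite E3, sum_Sn. f_equal. rewrite <- Cpow_mult_r.
      replace (k * S (n / k))%nat with (S n) by nia. reflexivity.
    + assert (E3 : (S n / k = n / k)%nat) by nia. rewrite E3.
      change (sum_n (G := C_AbelianMonoid) (fun n => RtoC (a n) * (q ^ k) ^ n) (n / k)
         + RtoC 0 * q ^ S n = sum_n (G := C_AbelianMonoid) (fun n => RtoC (a n) * (q ^ k) ^ n) (n / k)).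
      ring. }
specialize (HN (n / k)%nat). rewrite E. apply HN.
apply Nat.div_le_lower_bound; lia.
Qed.

Definition gbound (g : nat -> nat -> R) : Prop :=
  exists M k, (0 <= M)%R /\ forall a x, (0 < a)%nat -> (0 < x)%nat ->
    (Rabs (g a x) <= M * (INR (a * x) + 1) ^ k)%R.

Lemma div_term_bound g M k : (0 <= M)%R -> (forall a x, (0 < a)%nat -> (0 < x)%nat ->
    (Rabs (g a x) <= M * (INR (a * x) + 1) ^ k)%R) ->
  forall n a, (Rabs (div_term g n a) <= M * (INR n + 1) ^ k)%R.
Proof.
intros HM H n a. unfold div_term.
destruct (Nat.ltb_spec 0 a); simpl.
2:{ rewrite Rabs_R0. apply Rmult_le_pos; auto. left. apply INR_S_pow_pos. }
destruct (Nat.ltb_spec 0 n); simpl.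
2:{ rewrite Rabs_R0. apply Rmult_le_pos; auto. left. apply INR_S_pow_pos. }
destruct (Nat.eqb_spec (n mod a) 0).
2:{ rewrite Rabs_R0. apply Rmult_le_pos; auto. left. apply INR_S_pow_pos. }
assert (E := Nat.div_mod_eq n a).
assert (0 < n / a)%nat by nia.
replace (INR n) with (INR (a * (n / a))) by (f_equal; lia). auto.
Qed.

Lemma div_term_0 g n a : (n < a)%nat -> div_term g n a = 0%R.
Proof.
intros H. unfold div_term.
destruct (Nat.ltb_spec 0 n); [|now rewrite Bool.andb_false_r].
destruct (Nat.eqb_spec (n mod a) 0) as [E|]; [|now rewrite Bool.andb_false_r].
rewrite Nat.mod_small in E; lia.
Qed.

Lemma sum_f_R0_stable (f : nat -> R) n m : (n <= m)%nat ->
  (forall a, (n < a)%nat -> f a = 0%R) -> sum_f_R0 f m = sum_f_R0 f n.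
Proof.
intros H Hf. induction H as [|m H IH]; [reflexivity|]. simpl. rewrite IH, Hf by lia. ring.
Qed.

Lemma polyb_divsum g : gbound g -> polyb (divsum g).
Proof.
intros [M [k [HM H]]].
assert (B := div_term_bound g M k HM H).
exists M, (S k). split; auto. intros n. rewrite divsum_sum_f_R0.
eapply Rle_trans; [apply Rsum_abs|].
apply Rle_trans with (sum_f_R0 (fun _ => M * (INR n + 1) ^ k)%R n).
- apply sum_Rle. intros j _. apply B.
- rewrite sum_cte, S_INR. simpl. right. ring.
Qed.

Lemma Lambert_series g q : gbound g -> (Cmod q < 1)%R ->
  Cser (fun n => CPS (posc (g (S n))) (q ^ S n)) (CPS (divsum g) q).
Proof.
intros Hg Hq. assert (Pd := polyb_divsum g Hg).
destruct Hg as [M [k [HM H]]].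
assert (B := div_term_bound g M k HM H).
assert (Pg : forall n, polyb (posc (g (S n)))).
{ intros n. exists (M * INR (S n) ^ k)%R, k. split.
  - apply Rmult_le_pos; auto. apply pow_le, pos_INR.
  - intros [|x]; simpl posc.
    + rewrite Rabs_R0. apply Rmult_le_pos; [|left; apply INR_S_pow_pos].
      apply Rmult_le_pos; auto. apply pow_le, pos_INR.
    + eapply Rle_trans; [apply H; lia|]. rewrite Rmult_assoc, <- Rpow_mult_distr.
      apply Rmult_le_compat_l; auto. apply pow_incr. split.
      * generalize (pos_INR (S n * S x)). lra.
      * rewrite mult_INR. assert (1 <= INR (S n))%R by (rewrite S_INR; generalize (pos_INR n); lra).
        generalize (pos_INR (S x)). nra. }
set (d := fun N j => sum_f_R0 (div_term g j) (S N)).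
assert (Psum : forall N, polyb (d N)).
{ intros N. exists (M * INR (S (S N)))%R, k. split.
  - apply Rmult_le_pos; auto. apply pos_INR.
  - intros n. eapply Rle_trans; [apply Rsum_abs|].
    apply Rle_trans with (sum_f_R0 (fun _ => M * (INR n + 1) ^ k)%R (S N)).
    + apply sum_Rle. intros j _. apply B.
    + rewrite sum_cte. right. ring. }
assert (T : forall n, CPS (posc (g (S n))) (q ^ S n) = CPS (fun j => div_term g j (S n)) q).
{ intros n. rewrite <- CPS_sparse; auto; [|lia]. apply CPS_ext; auto; [|apply polyb_sparse; auto].
  intros j. unfold sparse, div_term.
  destruct (Nat.ltb_spec 0 j); [|assert (j = 0)%nat by lia; subst j;
    rewrite Nat.Div0.mod_0_l, Nat.Div0.div_0_l; reflexivity].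
  change (Nat.ltb 0 (S n)) with true. cbn [andb].
  destruct (Nat.eqb_spec (j mod S n) 0); [|reflexivity].
  assert (E := Nat.div_mod_eq j (S n)).
  destruct (j / S n)%nat eqn:Ej; [nia|reflexivity]. }
assert (Hd : forall N, sum_n (fun n => CPS (posc (g (S n))) (q ^ S n)) N = CPS (d N) q).
{ assert (P1 : forall n, polyb (fun j => div_term g j (S n))).
  { intros n. exists M, k. split; auto. }
  induction N as [|N IH].
  - rewrite sum_O, T. apply CPS_ext; auto. intros n. unfold d. simpl. unfold div_term at 2. simpl. ring.
  - rewrite sum_Sn, IH, T.
    change (CPS (d N) q + CPS (fun j => div_term g j (S (S N))) q = CPS (d (S N)) q).
    rewrite <- CPS_plus; auto. }
set (D := fun j => (INR j * (M * (INR j + 1) ^ S k))%R).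
assert (PD : polyb D).
{ apply polyb_mult; [apply polyb_INR|]. exists M, (S k). split; auto. intros n.
  rewrite Rabs_right; [lra|]. apply Rle_ge, Rmult_le_pos; auto. left. apply INR_S_pow_pos. }
destruct (polyb_ex_series D (Cmod q) PD) as [S HS].
{ split; [apply Cmod_ge_0|auto]. }
assert (Key : forall N, (Cmod (CPS (d N) q - CPS (divsum g) q) <= / INR (Datatypes.S N) * S)%R).
{ intros N.
  assert (S1 := Cser_minus _ _ _ _ (CPS_correct _ q (Psum N) Hq) (CPS_correct _ q Pd Hq)).
  assert (S2 : is_series (fun j => / INR (Datatypes.S N) * (Rabs (D j) * Cmod q ^ j))%R
     (/ INR (Datatypes.S N) * S)%R).
  { apply (@is_series_scal R_AbsRing R_NormedModule). exact HS. }
  apply (Cmod_Cser_le _ _ _ _ S1 S2). intros j. cbv beta.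
  replace (RtoC (d N j) * q ^ j - RtoC (divsum g j) * q ^ j)
    with (RtoC (d N j - divsum g j) * q ^ j) by (rewrite RtoC_minus; ring).
  rewrite Cmod_mult, Cmod_R, Cmod_pow, <- Rmult_assoc.
  apply Rmult_le_compat_r; [apply pow_le, Cmod_ge_0|].
  assert (HN : (0 < INR (Datatypes.S N))%R) by (apply lt_0_INR; lia).
  destruct (le_lt_dec j (Datatypes.S N)) as [L|L].
  - replace (d N j - divsum g j)%R with 0%R.
    + rewrite Rabs_R0. apply Rmult_le_pos; [left; apply Rinv_0_lt_compat; auto|apply Rabs_pos].
    + unfold d. rewrite divsum_sum_f_R0, (sum_f_R0_stable _ j (Datatypes.S N)); auto; [ring|].
      intros a Ha. apply div_term_0. auto.
  - assert (E : (d N j - divsum g j =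
        - sum_f_R0 (fun i => div_term g j (Datatypes.S (Datatypes.S N) + i)) (j - Datatypes.S (Datatypes.S N)))%R).
    { unfold d. rewrite divsum_sum_f_R0. rewrite (tech2 (div_term g j) (Datatypes.S N) j) by auto. ring. }
    rewrite E, Rabs_Ropp. eapply Rle_trans; [apply Rsum_abs|].
    apply Rle_trans with (sum_f_R0 (fun _ => M * (INR j + 1) ^ k)%R (j - Datatypes.S (Datatypes.S N))).
    { apply sum_Rle. intros i _. apply B. }
    rewrite sum_cte. unfold D.
    assert (HP : (0 <= M * (INR j + 1) ^ k)%R).
    { apply Rmult_le_pos; auto. left. apply INR_S_pow_pos. }
    assert (HJ : (INR (Datatypes.S N) <= INR j)%R) by (apply le_INR; lia).
    rewrite Rabs_right.
    2:{ apply Rle_ge, Rmult_le_pos; [apply pos_INR|]. apply Rmult_le_pos; auto.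
        left. apply INR_S_pow_pos. }
    replace (/ INR (Datatypes.S N) * (INR j * (M * (INR j + 1) ^ Datatypes.S k)))%R
      with ((M * (INR j + 1) ^ k) * ((INR j / INR (Datatypes.S N)) * (INR j + 1)))%R
      by (rewrite <- tech_pow_Rmult; field; lra).
    apply Rmult_le_compat_l; auto.
    assert (1 <= INR j / INR (Datatypes.S N))%R.
    { apply Rmult_le_reg_r with (INR (Datatypes.S N)); auto. unfold Rdiv.
      rewrite Rmult_assoc, Rinv_l by lra. lra. }
    assert (INR (Datatypes.S (j - Datatypes.S (Datatypes.S N))) <= INR j + 1)%R.
    { rewrite <- S_INR. apply le_INR. lia. }
    assert (0 <= INR j)%R by apply pos_INR. nra. }
apply Cser_filterlim, filterlim_Cmod. intros eps He.
assert (HS0 : (0 <= S)%R).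
{ specialize (Key O). change (INR 1) with 1%R in Key. rewrite Rinv_1 in Key.
  generalize (Cmod_ge_0 (CPS (d 0%nat) q - CPS (divsum g) q)). lra. }
destruct (INR_unbounded (S / eps)) as [N HN].
exists N. intros n Hn. rewrite Hd. eapply Rle_lt_trans; [apply Key|].
assert (L : (S / eps < INR (Datatypes.S n))%R).
{ eapply Rlt_le_trans; [exact HN|]. apply le_INR. lia. }
assert (P : (0 < INR (Datatypes.S n))%R) by (apply lt_0_INR; lia).
apply Rmult_lt_reg_l with (INR (Datatypes.S n)); auto.
rewrite <- Rmult_assoc, Rinv_r, Rmult_1_l by lra.
apply Rmult_lt_reg_r with (/ eps)%R; [apply Rinv_0_lt_compat; auto|].
rewrite Rmult_assoc, Rinv_r by lra. unfold Rdiv in L. lra.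
Qed.

(** * Eisenstein series *)

Definition sig (k : nat) : nat -> R := divsum (fun a _ => INR a ^ k)%R.
Definition ES (k : nat) : C -> C := CPS (sig k).
Definition theta (a : nat -> R) (n : nat) : R := (INR n * a n)%R.

Lemma gbound_pow k : gbound (fun a _ => INR a ^ k)%R.
Proof.
exists 1%R, k. split; [lra|]. intros a x Ha Hx.
rewrite Rabs_right by (apply Rle_ge, pow_le, pos_INR). rewrite Rmult_1_l.
apply pow_incr. split; [apply pos_INR|].
assert (a <= a * x)%nat as L by nia. apply le_INR in L. lra.
Qed.

Lemma polyb_sig k : polyb (sig k).
Proof. apply polyb_divsum, gbound_pow. Qed.

Lemma polyb_theta a : polyb a -> polyb (theta a).
Proof. apply polyb_mult, polyb_INR. Qed.

Lemma divsum_theta g n :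
  (INR n * divsum g n)%R = divsum (fun a x => INR a * INR x * g a x)%R n.
Proof.
rewrite <- divsum_scal. apply divsum_ext. intros a x <-. now rewrite mult_INR.
Qed.

Ltac polyb_auto :=
  repeat first [apply polyb_sig | apply polyb_theta | apply polyb_sparse
    | apply polyb_plus | apply polyb_scal].

Lemma sig1E n : sig 1 n = divsum (fun a _ => INR a) n.
Proof. apply divsum_ext. intros. simpl. ring. Qed.

Lemma CPS_conv (k l : nat) (c : nat -> R) q : (Cmod q < 1)%R ->
  (forall n, sum_f_R0 (fun j => sig k j * sig l (n - j))%R n = c n) ->
  ES k q * ES l q = CPS c q.
Proof.
intros Hq H. unfold ES. rewrite <- CPS_mult; auto using polyb_sig.
apply CPS_ext; auto. apply polyb_conv; apply polyb_sig.
Qed.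

Ltac rtoc := repeat first [rewrite RtoC_opp | rewrite RtoC_div by lra | rewrite RtoC_plus
  | rewrite RtoC_minus | rewrite RtoC_mult].

Section Disc.
Variable q : C.
Hypothesis Hq : (Cmod q < 1)%R.

Lemma ES_1_1 : ES 1 q * ES 1 q =
  (5 / 12)%R * ES 3 q + ((1 / 12)%R * ES 1 q + (- (1 / 2))%R * CPS (theta (sig 1)) q).
Proof.
rewrite (CPS_conv _ _ (fun n => 5 / 12 * sig 3 n + (1 / 12 * sig 1 n + (- (1 / 2)) * theta (sig 1) n))%R)
  by (auto; intros n;
  rewrite (sum_eq _ (fun k => divsum (fun a _ => INR a) k * divsum (fun a _ => INR a) (n - k))%R)
    by (intros; now rewrite !sig1E);
  rewrite conv_1_1; unfold theta, sig; rewrite divsum_theta, <- !divsum_scal, <- !divsum_plus;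
  apply divsum_ext; intros; field).
rewrite !CPS_plus, !CPS_scal; auto; polyb_auto.
Qed.

Lemma ES_1_3 : ES 1 q * ES 3 q =
  (7 / 80)%R * ES 5 q + ((1 / 24)%R * ES 3 q
    + ((- (1 / 8))%R * CPS (theta (sig 3)) q + (- (1 / 240))%R * ES 1 q)).
Proof.
rewrite (CPS_conv _ _ (fun n => 7 / 80 * sig 5 n + (1 / 24 * sig 3 n
    + ((- (1 / 8)) * theta (sig 3) n + (- (1 / 240)) * sig 1 n)))%R)
  by (auto; intros n;
  rewrite (sum_eq _ (fun k => divsum (fun a _ => INR a) k * divsum (fun a _ => INR a ^ 3) (n - k))%R)
    by (intros; now rewrite !sig1E);
  rewrite conv_1_3; unfold theta, sig; rewrite divsum_theta, <- !divsum_scal, <- !divsum_plus;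
  apply divsum_ext; intros; field).
rewrite !CPS_plus, !CPS_scal; auto; polyb_auto.
Qed.

Lemma ES_3_3 : ES 3 q * ES 3 q = (1 / 120)%R * ES 7 q + (- (1 / 120))%R * ES 3 q.
Proof.
rewrite (CPS_conv _ _ (fun n => 1 / 120 * sig 7 n + (- (1 / 120)) * sig 3 n)%R)
  by (auto; intros n; unfold sig;
  rewrite conv_3_3, <- !divsum_scal, <- !divsum_plus;
  apply divsum_ext; intros; field).
rewrite !CPS_plus, !CPS_scal; auto; polyb_auto.
Qed.

Lemma ES_1_5 : ES 1 q * ES 5 q =
  (20 / 504)%R * ES 7 q + ((- (1 / 12))%R * CPS (theta (sig 5)) q
    + ((1 / 24)%R * ES 5 q + (1 / 504)%R * ES 1 q)).
Proof.
rewrite (CPS_conv _ _ (fun n => 20 / 504 * sig 7 n + ((- (1 / 12)) * theta (sig 5) n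
    + (1 / 24 * sig 5 n + 1 / 504 * sig 1 n)))%R)
  by (auto; intros n;
  rewrite (sum_eq _ (fun k => divsum (fun a _ => INR a) k * divsum (fun a _ => INR a ^ 5) (n - k))%R)
    by (intros; now rewrite !sig1E);
  rewrite conv_1_5; unfold theta, sig; rewrite divsum_theta, <- !divsum_scal, <- !divsum_plus;
  apply divsum_ext; intros; field).
rewrite !CPS_plus, !CPS_scal; auto; polyb_auto.
Qed.

Lemma sparse_sig (k n : nat) :
  (3 ^ k * sparse 3 (sig k) n)%R = divsum (fun a _ => INR a ^ k * ind3 a)%R n.
Proof.
unfold sparse, sig.
rewrite <- (divsum_ind3 (fun a _ => INR a ^ k)%R), <- divsum_scal.
apply divsum_ext. intros a x _. destruct (Nat.eq_dec (a mod 3) 0) as [E|E].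
- assert (E1 := Nat.div_mod_eq a 3). rewrite E, Nat.add_0_r in E1.
  replace (INR a) with (3 * INR (a / 3))%R; [rewrite Rpow_mult_distr; ring|].
  rewrite E1 at 2. rewrite mult_INR. simpl. ring.
- rewrite ind3_mod by auto. ring.
Qed.

(* The function (3 E2(q^3) - E2(q)) / 2. *)
Definition A3 (x : C) : C := 1 + 12 * ES 1 x - 36 * ES 1 (x ^ 3).

Lemma ES_cube k : ES k (q ^ 3) = CPS (sparse 3 (sig k)) q.
Proof. symmetry. apply CPS_sparse; [lia|apply polyb_sig|exact Hq]. Qed.

Lemma A3_sqr : A3 q * A3 q = 1 + 24 * ES 3 q + 216 * ES 3 (q ^ 3).
Proof.
set (c := fun n => (sig 1 n + (- (3)) * sparse 3 (sig 1) n)%R).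
assert (Hc : polyb c) by (unfold c; polyb_auto).
assert (E1 : A3 q = 1 + 12 * CPS c q).
{ unfold c. rewrite CPS_plus, CPS_scal; auto; polyb_auto. unfold A3. rewrite ES_cube.
  unfold ES. rewrite RtoC_opp. ring. }
assert (E2 : CPS c q * CPS c q =
   (9 / 6)%R * CPS (sparse 3 (sig 3)) q + ((1 / 6)%R * ES 3 q + (- (1 / 6))%R * CPS c q)).
{ rewrite <- CPS_mult by auto.
  transitivity (CPS (fun n => (9 / 6) * sparse 3 (sig 3) n + (1 / 6 * sig 3 n + (- (1 / 6)) * c n))%R q).
  - apply CPS_ext; auto; [|apply polyb_conv; auto]. intros n.
    assert (Hcn : forall n, c n = divsum (fun a _ => INR a * (1 - ind3 a))%R n).
    { intros m. unfold c. replace (- (3) * sparse 3 (sig 1) m)%R with (-1 * (3 ^ 1 * sparse 3 (sig 1) m))%R by ring.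
      rewrite sparse_sig. unfold sig. rewrite <- divsum_scal, <- divsum_plus.
      apply divsum_ext. intros. simpl. ring. }
    rewrite (sum_eq _ (fun k => divsum (fun a _ => INR a * (1 - ind3 a)) k
       * divsum (fun a _ => INR a * (1 - ind3 a)) (n - k))%R) by (intros; now rewrite !Hcn).
    rewrite conv_ind3, Hcn.
    replace (9 / 6 * sparse 3 (sig 3) n)%R with (1 / 18 * (3 ^ 3 * sparse 3 (sig 3) n))%R by field.
    rewrite sparse_sig. unfold sig. rewrite <- !divsum_scal, <- !divsum_plus.
    apply divsum_ext. intros. field.
  - rewrite !CPS_plus, !CPS_scal; auto; try (polyb_auto; auto; fail). }
rewrite E1. rewrite ES_cube.
transitivity (1 + 24 * CPS c q + 144 * (CPS c q * CPS c q)); [ring|].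
rewrite E2. rtoc. unfold ES. field.
Qed.
End Disc.

Definition P2 (x : C) : C := 1 - 24 * ES 1 x.
Definition P4 (x : C) : C := 1 + 240 * ES 3 x.
Definition P6 (x : C) : C := 1 - 504 * ES 5 x.

Lemma Cmod_cube (q : C) : (Cmod q < 1)%R -> (Cmod (q ^ 3) < 1)%R.
Proof. intros H. rewrite Cmod_pow. apply pow_lt_1_compat; [|lia]. split; [apply Cmod_ge_0|auto]. Qed.

Lemma euler_ES k q : (Cmod q < 1)%R -> euler (ES k) q (CPS (theta (sig k)) q).
Proof. intros H. apply (euler_CPS (sig k)); auto. apply polyb_sig. Qed.

Lemma euler_P2 q : (Cmod q < 1)%R -> euler P2 q ((P2 q * P2 q - P4 q) / 12).
Proof.
intros Hq. eapply euler_eq.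
- apply (euler_minus (fun _ => 1) (fun x => 24 * ES 1 x)); [apply euler_const|].
  apply euler_scal, euler_ES, Hq.
- unfold P2, P4.
  replace ((1 - 24 * ES 1 q) * (1 - 24 * ES 1 q))
    with (1 - 48 * ES 1 q + 576 * (ES 1 q * ES 1 q)) by ring.
  rewrite ES_1_1 by auto. rtoc. field.
Qed.

Lemma euler_P4 q : (Cmod q < 1)%R -> euler P4 q ((P2 q * P4 q - P6 q) / 3).
Proof.
intros Hq. eapply euler_eq.
- apply (euler_plus (fun _ => 1) (fun x => 240 * ES 3 x)); [apply euler_const|].
  apply euler_scal, euler_ES, Hq.
- unfold P2, P4, P6.
  replace ((1 - 24 * ES 1 q) * (1 + 240 * ES 3 q))
    with (1 - 24 * ES 1 q + 240 * ES 3 q - 5760 * (ES 1 q * ES 3 q)) by ring.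
  rewrite ES_1_3 by auto. rtoc. field.
Qed.

Lemma euler_P6 q : (Cmod q < 1)%R -> euler P6 q ((P2 q * P6 q - P4 q * P4 q) / 2).
Proof.
intros Hq. eapply euler_eq.
- apply (euler_minus (fun _ => 1) (fun x => 504 * ES 5 x)); [apply euler_const|].
  apply euler_scal, euler_ES, Hq.
- unfold P2, P4, P6.
  replace ((1 - 24 * ES 1 q) * (1 - 504 * ES 5 q))
    with (1 - 24 * ES 1 q - 504 * ES 5 q + 12096 * (ES 1 q * ES 5 q)) by ring.
  replace ((1 + 240 * ES 3 q) * (1 + 240 * ES 3 q))
    with (1 + 480 * ES 3 q + 57600 * (ES 3 q * ES 3 q)) by ring.
  rewrite ES_1_5, ES_3_3 by auto. rtoc. field.
Qed.

Lemma euler_cube f q v : euler f (q ^ 3) v -> euler (fun x => f (x ^ 3)) q (3 * v).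
Proof.
intros [l [H <-]].
apply (euler_eq _ _ (INR 3 * q ^ 2 * q * l)).
- apply (euler_comp f (fun x => x ^ 3) q l _ H). apply (euler_pow (fun x => x) q q 2), euler_id.
- simpl INR. rtoc. simpl. ring.
Qed.

Lemma A3_P2 q : A3 q = (3 * P2 (q ^ 3) - P2 q) / 2.
Proof. unfold A3, P2. field. Qed.

Lemma P2_cube q : P2 (q ^ 3) = (2 * A3 q + P2 q) / 3.
Proof. rewrite A3_P2. field. Qed.

Lemma P4_cube q : (Cmod q < 1)%R -> P4 (q ^ 3) = (10 * (A3 q * A3 q) - P4 q) / 9.
Proof. intros Hq. rewrite A3_sqr by auto. unfold P4. field. Qed.

Lemma euler_A3 q : (Cmod q < 1)%R ->
  euler A3 q (A3 q * P2 q / 6 + P4 q / 12 - A3 q * A3 q / 4).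
Proof.
intros Hq.
apply euler_ext with (fun x => 3 / 2 * P2 (x ^ 3) - 1 / 2 * P2 x).
{ intros x. rewrite A3_P2. field. }
eapply euler_eq.
- apply (euler_minus (fun x => 3 / 2 * P2 (x ^ 3)) (fun x => 1 / 2 * P2 x)).
  + apply euler_scal, euler_cube, euler_P2, Cmod_cube, Hq.
  + apply euler_scal, euler_P2, Hq.
- rewrite P2_cube, P4_cube by auto. field.
Qed.

(* Obtained by applying the Euler operator to [P4_cube]. *)
Lemma P6_cube q : (Cmod q < 1)%R ->
  P6 (q ^ 3) = (35 * A3 q ^ 3 - 7 * (A3 q * P4 q) - P6 q) / 27.
Proof.
intros Hq.
assert (H1 : euler (fun x => P4 (x ^ 3)) q (3 * ((P2 (q ^ 3) * P4 (q ^ 3) - P6 (q ^ 3)) / 3)))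
  by apply euler_cube, euler_P4, Cmod_cube, Hq.
assert (H2 : euler (fun x => 10 / 9 * (A3 x * A3 x) - 1 / 9 * P4 x) q
  (10 / 9 * ((A3 q * P2 q / 6 + P4 q / 12 - A3 q * A3 q / 4) * A3 q
     + A3 q * (A3 q * P2 q / 6 + P4 q / 12 - A3 q * A3 q / 4))
   - 1 / 9 * ((P2 q * P4 q - P6 q) / 3))).
{ apply (euler_minus (fun x => 10 / 9 * (A3 x * A3 x)) (fun x => 1 / 9 * P4 x)).
  - apply euler_scal, euler_mult; apply euler_A3, Hq.
  - apply euler_scal, euler_P4, Hq. }
assert (H3 : forall x, (Cmod x < 1)%R -> 10 / 9 * (A3 x * A3 x) - 1 / 9 * P4 x = P4 (x ^ 3)).
{ intros x Hx. rewrite P4_cube by exact Hx. field. }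
assert (E := euler_unique _ _ _ _ H1 (euler_ext_open _ _ _ q _ open_disc Hq H3 H2)).
rewrite P2_cube, P4_cube in E by auto.
set (X := P6 (q ^ 3)) in *.
replace X with ((2 * A3 q + P2 q) / 3 * ((10 * (A3 q * A3 q) - P4 q) / 9)
  - 3 * (((2 * A3 q + P2 q) / 3 * ((10 * (A3 q * A3 q) - P4 q) / 9) - X) / 3)) by field.
rewrite E. field.
Qed.

(* The 3-division polynomial of the elliptic curve, with [A3] as abscissa. *)
Lemma division_polynomial q : (Cmod q < 1)%R ->
  8 * (A3 q * P6 q) = 27 * A3 q ^ 4 - 18 * (A3 q ^ 2 * P4 q) - P4 q ^ 2.
Proof.
intros Hq.
set (dA := A3 q * P2 q / 6 + P4 q / 12 - A3 q * A3 q / 4).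
assert (HA := euler_A3 q Hq). fold dA in HA.
assert (H1 : euler (fun x => P6 (x ^ 3)) q
  (3 * ((P2 (q ^ 3) * P6 (q ^ 3) - P4 (q ^ 3) * P4 (q ^ 3)) / 2)))
  by apply euler_cube, euler_P6, Cmod_cube, Hq.
assert (H2 : euler (fun x => 35 / 27 * A3 x ^ 3 - 7 / 27 * (A3 x * P4 x) - 1 / 27 * P6 x) q
  (35 / 27 * (INR 3 * A3 q ^ 2 * dA)
   - 7 / 27 * (dA * P4 q + A3 q * ((P2 q * P4 q - P6 q) / 3))
   - 1 / 27 * ((P2 q * P6 q - P4 q * P4 q) / 2))).
{ apply (euler_minus (fun x => 35 / 27 * A3 x ^ 3 - 7 / 27 * (A3 x * P4 x)) (fun x => 1 / 27 * P6 x)).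
  - apply (euler_minus (fun x => 35 / 27 * A3 x ^ 3) (fun x => 7 / 27 * (A3 x * P4 x))).
    + apply euler_scal. apply (euler_pow A3 q dA 2 HA).
    + apply euler_scal, euler_mult; [exact HA|apply euler_P4, Hq].
  - apply euler_scal, euler_P6, Hq. }
assert (H3 : forall x, (Cmod x < 1)%R -> 35 / 27 * A3 x ^ 3 - 7 / 27 * (A3 x * P4 x) - 1 / 27 * P6 x = P6 (x ^ 3)).
{ intros x Hx. rewrite P6_cube by exact Hx. field. }
assert (E := euler_unique _ _ _ _ H1 (euler_ext_open _ _ _ q _ open_disc Hq H3 H2)).
rewrite P2_cube, P4_cube, P6_cube in E by auto. unfold dA in E.
replace (RtoC (INR 3)) with (RtoC 3) in E by (simpl; f_equal; ring).
match type of E with ?L = ?R =>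
  assert (E' : 8 * (A3 q * P6 q) - (27 * A3 q ^ 4 - 18 * (A3 q ^ 2 * P4 q) - P4 q ^ 2)
     = - (324 / 5) * (L - R)) by field end.
rewrite E in E'.
match type of E' with ?L = _ => assert (L = 0) by (rewrite E'; ring) end.
match goal with |- ?L = ?R => replace L with ((L - R) + R) by ring end.
rewrite H. ring.
Qed.

(** * The Hauptmodul and the theta function *)

(* [Lg q = - log prod (1 - q^n)]; hence [tf q = 1 / u] and [bf q = eta(tau)^3 / eta(3 tau)]. *)
Definition etac : nat -> R := divsum (fun _ x => / INR x)%R.
Definition Lg : C -> C := CPS etac.
Definition ex (q : C) : C := 12 * Lg q - 12 * Lg (q ^ 3).
Definition tf (q : C) : C := - (27) * (q * Cexp (ex q)).
Definition bf (q : C) : C := Cexp (Lg (q ^ 3) - 3 * Lg q).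

Lemma gbound_inv : gbound (fun _ x => / INR x)%R.
Proof.
exists 1%R, 0%nat. split; [lra|]. intros a x Ha Hx. simpl. rewrite Rmult_1_r.
assert (1 <= INR x)%R by (change 1%R with (INR 1); apply le_INR; lia).
rewrite Rabs_right.
- rewrite <- Rinv_1. apply Rinv_le_contravar; lra.
- left. apply Rinv_0_lt_compat. lra.
Qed.

Lemma polyb_etac : polyb etac.
Proof. apply polyb_divsum, gbound_inv. Qed.

Lemma theta_etac n : theta etac n = sig 1 n.
Proof.
unfold theta, etac, sig. rewrite divsum_theta.
rewrite !divsum_sum_f_R0. apply sum_eq. intros a _. unfold div_term.
destruct (Nat.ltb_spec 0 a); [|reflexivity].
destruct (Nat.ltb_spec 0 n); [|reflexivity].
destruct (Nat.eqb_spec (n mod a) 0) as [E|]; [|reflexivity].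
cbn [andb]. rewrite pow_1. field. apply not_0_INR.
assert (E1 := Nat.div_mod_eq n a). nia.
Qed.

Lemma euler_Lg q : (Cmod q < 1)%R -> euler Lg q (ES 1 q).
Proof.
intros Hq. eapply euler_eq; [apply (euler_CPS etac q polyb_etac Hq)|].
apply CPS_ext; auto; [apply theta_etac|apply polyb_theta, polyb_etac].
Qed.

Lemma euler_ex q : (Cmod q < 1)%R -> euler ex q (A3 q - 1).
Proof.
intros Hq. eapply euler_eq.
- apply (euler_minus (fun x => 12 * Lg x) (fun x => 12 * Lg (x ^ 3))); apply euler_scal.
  + apply euler_Lg, Hq.
  + apply euler_cube, euler_Lg, Cmod_cube, Hq.
- unfold A3. ring.
Qed.

Lemma euler_tf q : (Cmod q < 1)%R -> euler tf q (tf q * A3 q).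
Proof.
intros Hq. eapply euler_eq.
- apply euler_scal, (euler_mult (fun x => x)); [apply euler_id|].
  apply euler_exp, euler_ex, Hq.
- unfold tf. ring.
Qed.

Lemma euler_bf q : (Cmod q < 1)%R -> euler bf q (bf q * ((P2 q - A3 q) / 12)).
Proof.
intros Hq. eapply euler_eq.
- apply euler_exp, (euler_minus (fun x => Lg (x ^ 3)) (fun x => 3 * Lg x)).
  + apply euler_cube, euler_Lg, Cmod_cube, Hq.
  + apply euler_scal, euler_Lg, Hq.
- unfold bf, P2, A3. field.
Qed.

Lemma Lg_0 : Lg 0 = 0.
Proof. unfold Lg. rewrite (CPS_0 _ polyb_etac). unfold etac. now rewrite divsum_0. Qed.

Lemma cube_0 : (RtoC 0) ^ 3 = 0.
Proof. simpl. ring. Qed.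

Lemma ex_0 : ex 0 = 0.
Proof. unfold ex. rewrite cube_0, Lg_0. ring. Qed.

Lemma tf_0 : tf 0 = 0.
Proof. unfold tf. ring. Qed.

Lemma bf_0 : bf 0 = 1.
Proof.
unfold bf. rewrite cube_0, Lg_0. rewrite <- Cexp_0. f_equal. ring.
Qed.

Lemma ES_0 k : ES k 0 = 0.
Proof. unfold ES. rewrite (CPS_0 _ (polyb_sig k)). unfold sig. now rewrite divsum_0. Qed.

Lemma P2_0 : P2 0 = 1. Proof. unfold P2. rewrite ES_0. ring. Qed.
Lemma P4_0 : P4 0 = 1. Proof. unfold P4. rewrite ES_0. ring. Qed.
Lemma A3_0 : A3 0 = 1. Proof. unfold A3. rewrite cube_0, ES_0. ring. Qed.

Lemma tf_neq_0 (q : C) : q <> 0 -> tf q <> 0.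
Proof.
intros H. unfold tf.
apply Cmult_neq_0; [|apply Cmult_neq_0; [exact H|apply Cexp_neq_0]].
intros E. apply (f_equal fst) in E. simpl in E. lra.
Qed.

Lemma bf_neq_0 q : bf q <> 0.
Proof. apply Cexp_neq_0. Qed.

(** * The nome and the eta function *)

Lemma Cmod_nome z : Cmod (nome z) = exp (- (2 * PI * Im z)).
Proof.
unfold nome. rewrite Cmod_Cexp. f_equal. destruct z as [x y]. unfold Re, Im. simpl. ring.
Qed.

Lemma Cmod_nome_lt_1 z : (0 < Im z)%R -> (Cmod (nome z) < 1)%R.
Proof.
intros H. rewrite Cmod_nome, <- exp_0. apply exp_increasing.
assert (0 < PI)%R by apply PI_RGT_0. nra.
Qed.

Lemma nome_neq_0 z : nome z <> 0.
Proof. apply Cexp_neq_0. Qed.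

Lemma nome_3 z : nome (3 * z) = nome z ^ 3.
Proof.
unfold nome. rewrite <- Cexp_INR_mult. f_equal. simpl INR.
replace (RtoC (1 + 1 + 1)) with (RtoC 3) by (f_equal; ring). ring.
Qed.

Lemma Cder_nome z : exists l, Cder nome z l.
Proof.
eexists. unfold nome. apply (Cder_comp Cexp (fun z => 2 * PI * Ci * z)); [apply Cder_exp|].
apply (Cder_mult (fun _ => 2 * PI * Ci) (fun z => z)); [apply Cder_const|apply Cder_id].
Qed.

Lemma open_nome (U : C -> Prop) : open U -> open (fun z => U (nome z)).
Proof.
intros HU. apply open_Cmod. intros z Hz.
destruct (proj1 (open_Cmod U) HU _ Hz) as [d [Hd Hb]].
destruct (Cder_nome z) as [l Hl].
destruct (Cder_cont _ _ _ Hl d Hd) as [d' [Hd' Hc]].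
exists d'. split; auto.
Qed.

Lemma lambert_ES k z : (0 < Im z)%R -> lambert k z = ES k (nome z).
Proof.
intros Hz. assert (Hq := Cmod_nome_lt_1 z Hz).
apply CSeries_correct.
assert (H := Lambert_series (fun a _ => INR a ^ k)%R (nome z) (gbound_pow k) Hq).
eapply Cser_ext; [|exact H]. intros n. cbv beta.
rewrite CPS_posc_const; [reflexivity|].
rewrite Cmod_pow. apply pow_lt_1_compat; [|lia]. split; [apply Cmod_ge_0|auto].
Qed.

Lemma E2_P2 z : (0 < Im z)%R -> E2 z = P2 (nome z).
Proof. intros H. unfold E2, P2. now rewrite lambert_ES. Qed.

Lemma E4_P4 z : (0 < Im z)%R -> E4 z = P4 (nome z).
Proof. intros H. unfold E4, P4. now rewrite lambert_ES. Qed.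

Lemma E6_P6 z : (0 < Im z)%R -> E6 z = P6 (nome z).
Proof. intros H. unfold E6, P6. now rewrite lambert_ES. Qed.

Lemma Cser_lam q : (Cmod q < 1)%R -> Cser (fun n => lam (q ^ S n)) (- Lg q).
Proof.
intros Hq.
assert (Hg : gbound (fun _ x => - (1) * / INR x)%R).
{ destruct gbound_inv as [M [k [HM H]]]. exists M, k. split; auto. intros a x Ha Hx.
  rewrite Rabs_mult, Rabs_Ropp, Rabs_R1, Rmult_1_l. auto. }
assert (H := Lambert_series _ q Hg Hq).
replace (- Lg q) with (CPS (Convolution.divsum (fun _ x => - (1) * / INR x)%R) q).
- eapply Cser_ext; [|exact H]. intros n. cbv beta. unfold lam.
  assert (Hn : (Cmod (q ^ S n) < 1)%R).
  { rewrite Cmod_pow. apply pow_lt_1_compat; [|lia]. split; [apply Cmod_ge_0|auto]. }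
  symmetry. apply CPS_ext; auto using polyb_logc.
  intros [|x]; unfold logc; simpl posc; ring.
- unfold Lg. rewrite (CPS_ext _ (fun n => (- (1)) * etac n)%R).
  + rewrite CPS_scal by auto using polyb_etac. rtoc. ring.
  + intros n. unfold etac. rewrite <- Convolution.divsum_scal. reflexivity.
  + apply polyb_divsum, Hg.
  + exact Hq.
Qed.

Lemma CLim_seq_euler_product q : (Cmod q < 1)%R ->
  CLim_seq (Cprod_n (fun n => 1 - q ^ S n)) = Cexp (- Lg q).
Proof.
intros Hq. apply CLim_seq_correct, filterlim_Cmod. intros eps He.
destruct (Cder_cont _ _ _ (Cder_exp (- Lg q)) eps He) as [d [Hd Hc]].
assert (H := Cser_lam q Hq). apply Cser_filterlim in H.
destruct (proj1 (filterlim_Cmod _ _) H d Hd) as [N HN].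
assert (E : forall n, Cprod_n (fun n => 1 - q ^ S n) (S n) = Cexp (sum_n (fun n => lam (q ^ S n)) n)).
{ assert (P : forall n, Cexp (lam (q ^ S n)) = 1 - q ^ S n).
  { intros n. apply Cexp_lam. rewrite Cmod_pow. apply pow_lt_1_compat; [|lia].
    split; [apply Cmod_ge_0|auto]. }
  induction n as [|n IH].
  - rewrite sum_O, P. simpl. ring.
  - rewrite sum_Sn. change (Cprod_n (fun n => 1 - q ^ S n) (S n) * (1 - q ^ S (S n)) =
      Cexp (sum_n (fun n => lam (q ^ S n)) n + lam (q ^ S (S n)))).
    rewrite Cexp_plus, P, <- IH. reflexivity. }
exists (S N). intros [|n] Hn; [lia|]. rewrite E. apply Hc, HN. lia.
Qed.

Lemma eta_Cexp z : (0 < Im z)%R -> eta z = Cexp (2 * PI * Ci * z / 24 - Lg (nome z)).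
Proof.
intros Hz. unfold eta, Cminus. rewrite Cexp_plus. f_equal.
apply CLim_seq_euler_product, Cmod_nome_lt_1, Hz.
Qed.

Lemma u3B_tf z : (0 < Im z)%R -> u3B z = / tf (nome z).
Proof.
intros Hz. unfold u3B.
assert (H3 : (0 < Im (3 * z))%R).
{ destruct z as [x y]. unfold Im in *. simpl in *. lra. }
rewrite (eta_Cexp z Hz), (eta_Cexp (3 * z) H3), nome_3.
rewrite <- Cexp_minus, <- Cexp_INR_mult.
set (L := Lg (nome z)). set (L3 := Lg (nome z ^ 3)).
replace (INR 12 * (2 * PI * Ci * z / 24 - L - (2 * PI * Ci * (3 * z) / 24 - L3)))
  with (- (2 * PI * Ci * z) + - ex (nome z)).
- rewrite Cexp_plus, !Cexp_opp. unfold tf. fold (nome z).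
  field. repeat split; first [apply Cexp_neq_0 | apply nome_neq_0].
- unfold ex. fold L L3. replace (RtoC (INR 12)) with (RtoC 12) by (simpl; f_equal; ring). field.
Qed.

(** * Propagation along a connected set reaching the cusp *)

Section Connected.
Variable K : C -> Prop.
Hypothesis HKc : Cconnected K.
Hypothesis HKinf : forall M : R, exists z, K z /\ (M < Im z)%R.

Definition good (O : C -> Prop) : Prop :=
  open O /\ O 0 /\ forall z, K z -> O (nome z).

Lemma good_clopen (O Z : C -> Prop) : good O -> (forall q, Z q -> O q) ->
  open Z -> open (fun q => O q /\ ~ Z q) -> Z 0 -> good Z.
Proof.
intros [HO [O0 OK]] ZO HZ HZ' Z0. split; [auto|]. split; [auto|].
intros z Kz. apply NNPP. intros nZ.
destruct (HKc (fun z => Z (nome z)) (fun z => O (nome z) /\ ~ Z (nome z))) as [w [_ [W1 [_ W2]]]].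
- apply open_nome, HZ.
- apply (open_nome (fun q => O q /\ ~ Z q)), HZ'.
- intros w Kw. destruct (classic (Z (nome w))); auto.
- destruct (proj1 (open_Cmod Z) HZ 0 Z0) as [d [Hd Hb]].
  destruct (HKinf (- ln d / (2 * PI))) as [w [Kw Hw]].
  exists w. split; auto. apply Hb. replace (nome w - 0) with (nome w) by ring.
  rewrite Cmod_nome, <- (exp_ln d) by auto. apply exp_increasing.
  assert (P := PI_RGT_0). apply Rmult_lt_compat_r with (r := (2 * PI)%R) in Hw; [|lra].
  replace (- ln d / (2 * PI) * (2 * PI))%R with (- ln d)%R in Hw by (field; lra). lra.
- exists z. auto.
- contradiction.
Qed.

Lemma good_const (O : C -> Prop) (f : C -> C) (c : C) : good O ->
  (forall q, O q -> euler f q 0) -> f 0 = c -> good (fun q => O q /\ f q = c).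
Proof.
intros HO Hf E. assert (HO' := HO). destruct HO' as [HO1 [O0 _]].
apply (good_clopen O); auto.
- now intros q [H _].
- now apply euler_0_open.
- assert (H := open_neq_0 O (fun q => f q - c) HO1).
  eapply open_ext; [|apply H].
  + intros q. split.
    * intros [H1 H2]. split; auto. intros [_ H3]. apply H2. rewrite H3. ring.
    * intros [H1 H2]. split; auto. intros H3. apply H2. split; auto.
      replace (f q) with (f q - c + c) by ring. rewrite H3. ring.
  + intros q Oq. eexists. apply euler_minus; [apply Hf, Oq|apply euler_const].
Qed.
End Connected.

(** * The curve attached to level 3 *)

Definition Nf (q : C) : C := P4 q - A3 q * A3 q.
Definition Mf (q : C) : C := P4 q - 9 * (A3 q * A3 q).
Definition nco (n : nat) : R := (216 * sig 3 n + (- (216)) * sparse 3 (sig 3) n)%R.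
(* The quotient [Nf / tf], with its removable singularity at [0] removed. *)
Definition Ph (q : C) : C := CPS (fun n => nco (S n)) q * (- / 27 * Cexp (- ex q)).
Definition El (q : C) : C := Cexp (2 / 3 * lam (tf q)).
Definition Rf (q : C) : C := A3 q / (bf q * bf q * El q).

Lemma polyb_nco : polyb nco.
Proof. unfold nco. polyb_auto. Qed.

Lemma Nf_CPS q : (Cmod q < 1)%R -> Nf q = CPS nco q.
Proof.
intros Hq. unfold Nf. rewrite A3_sqr by auto. unfold P4. rewrite (ES_cube q Hq).
unfold nco. rewrite CPS_plus, !CPS_scal; auto; polyb_auto. rtoc. unfold ES. ring.
Qed.

Lemma tf_Ph q : (Cmod q < 1)%R -> tf q * Ph q = Nf q.
Proof.
intros Hq. rewrite Nf_CPS by auto. rewrite (CPS_decr nco q polyb_nco Hq).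
replace (RtoC (nco 0)) with (RtoC 0).
- unfold tf, Ph. rewrite Cexp_opp. field. apply Cexp_neq_0.
- f_equal. unfold nco, sparse, sig. simpl. rewrite !Convolution.divsum_0. ring.
Qed.

Lemma Ph_0 : Ph 0 = - (8).
Proof.
unfold Ph. rewrite (CPS_0 _ (polyb_shift nco polyb_nco)).
rewrite ex_0. replace (- (0)) with (RtoC 0) by ring. rewrite Cexp_0.
replace (nco 1) with 216%R; [field|].
unfold nco, sig, sparse. rewrite Convolution.divsum_1. simpl. ring.
Qed.

Lemma euler_at_0 f v : euler f 0 v -> v = 0.
Proof. intros [l [_ <-]]. ring. Qed.

Lemma euler_Ph q : (Cmod q < 1)%R -> exists v, euler Ph q v.
Proof.
intros Hq. eexists. apply euler_mult.
- apply euler_CPS; auto. apply (polyb_shift nco polyb_nco).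
- apply euler_scal, euler_exp. apply euler_ext with (fun x => (- (1)) * ex x); [intros; ring|].
  apply euler_scal, euler_ex, Hq.
Qed.

Lemma euler_Mf q : (Cmod q < 1)%R -> euler Mf q ((P2 q * P4 q - P6 q) / 3 -
  9 * (2 * A3 q * (A3 q * P2 q / 6 + P4 q / 12 - A3 q * A3 q / 4))).
Proof.
intros Hq. eapply euler_eq.
- apply euler_minus; [apply euler_P4, Hq|]. apply euler_scal, euler_mult; apply euler_A3, Hq.
- ring.
Qed.

Lemma euler_Nf q : (Cmod q < 1)%R -> euler Nf q ((P2 q * P4 q - P6 q) / 3 -
  2 * A3 q * (A3 q * P2 q / 6 + P4 q / 12 - A3 q * A3 q / 4)).
Proof.
intros Hq. eapply euler_eq.
- apply euler_minus; [apply euler_P4, Hq|]. apply euler_mult; apply euler_A3, Hq.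
- ring.
Qed.

Lemma euler_Ph_Mf q : (Cmod q < 1)%R -> Mf q <> 0 -> euler (fun x => Ph x / Mf x) q 0.
Proof.
intros Hq HM. destruct (euler_Ph q Hq) as [v Hv].
assert (HMf := euler_Mf q Hq).
set (m := (P2 q * P4 q - P6 q) / 3 - 9 * (2 * A3 q * (A3 q * P2 q / 6 + P4 q / 12 - A3 q * A3 q / 4))) in *.
assert (H := euler_div _ _ _ _ _ Hv HMf HM).
destruct (Ceq_dec q 0) as [->|Hq0].
{ now rewrite (euler_at_0 _ _ H) in H. }
eapply euler_eq; [exact H|].
assert (Ht := tf_neq_0 q Hq0).
assert (E1 : tf q * A3 q * Ph q + tf q * v = (P2 q * P4 q - P6 q) / 3 -
  2 * A3 q * (A3 q * P2 q / 6 + P4 q / 12 - A3 q * A3 q / 4)).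
{ apply (euler_unique (fun x => tf x * Ph x) q).
  - apply euler_mult; auto. apply euler_tf, Hq.
  - apply (euler_ext_open _ _ _ _ _ open_disc Hq) with (2 := euler_Nf q Hq).
    intros x Hx. symmetry. apply tf_Ph, Hx. }
assert (E2 := tf_Ph q Hq).
assert (E3 := division_polynomial q Hq).
assert (Key : tf q * (v * Mf q - Ph q * m) = 0).
{ replace (tf q * (v * Mf q - Ph q * m)) with
    ((tf q * A3 q * Ph q + tf q * v) * Mf q - A3 q * (tf q * Ph q) * Mf q - (tf q * Ph q) * m) by ring.
  rewrite E1, E2. unfold m, Nf, Mf.
  match goal with |- ?L = _ =>
    replace L with (A3 q / 3 * (8 * (A3 q * P6 q) - (27 * A3 q ^ 4 - 18 * (A3 q ^ 2 * P4 q) - P4 q ^ 2)))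
    by field end.
  rewrite E3. ring. }
destruct (Cmult_integral _ _ Key) as [E|E]; [contradiction|].
rewrite E. field. auto.
Qed.

Lemma El_neq_0 q : El q <> 0. Proof. apply Cexp_neq_0. Qed.

Lemma euler_El q : (Cmod q < 1)%R -> (Cmod (tf q) < 1)%R ->
  euler El q (El q * (- (2 / 3) * (tf q / (1 - tf q)) * A3 q)).
Proof.
intros Hq Ht. eapply euler_eq.
- apply euler_exp, euler_scal. apply (euler_CPS_comp logc tf q (A3 q)); auto using polyb_logc.
  apply euler_tf, Hq.
- rewrite CPS_theta_logc by auto. fold (El q). unfold Cdiv. ring.
Qed.

Lemma euler_Rf_gen q : (Cmod q < 1)%R -> (Cmod (tf q) < 1)%R ->
  euler Rf q ((A3 q * P2 q / 6 + P4 q / 12 - A3 q * A3 q / 4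
     - A3 q * ((P2 q - A3 q) / 6 - 2 / 3 * (tf q / (1 - tf q)) * A3 q)) / (bf q * bf q * El q)).
Proof.
intros Hq Ht. assert (H1 := bf_neq_0 q). assert (H2 := El_neq_0 q).
assert (H3 := one_minus_neq_0 _ Ht).
eapply euler_eq.
- apply (euler_div A3 (fun x => bf x * bf x * El x)).
  + apply euler_A3, Hq.
  + apply (euler_mult (fun x => bf x * bf x)); [apply euler_mult; apply euler_bf, Hq|].
    apply euler_El; auto.
  + repeat apply Cmult_neq_0; auto.
- field. auto.
Qed.

Lemma euler_Rf q : (Cmod q < 1)%R -> (Cmod (tf q) < 1)%R -> Ph q = Mf q -> euler Rf q 0.
Proof.
intros Hq Ht HP. eapply euler_eq; [apply euler_Rf_gen; auto|].
assert (H3 := one_minus_neq_0 _ Ht).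
assert (E := tf_Ph q Hq). rewrite HP in E. unfold Nf, Mf in E.
assert (E4 : P4 q = A3 q * A3 q * (1 - 9 * tf q) / (1 - tf q)).
{ apply (f_equal (fun x => x + A3 q * A3 q - tf q * P4 q)) in E.
  replace (P4 q) with ((P4 q - A3 q * A3 q + A3 q * A3 q - tf q * P4 q) / (1 - tf q)) by (field; auto).
  rewrite <- E. f_equal. ring. }
rewrite E4. assert (H1 := bf_neq_0 q). assert (H2 := El_neq_0 q). field. auto.
Qed.

Definition Om (q : C) : Prop := (Cmod q < 1)%R /\ (Cmod (tf q) < 1)%R.

Lemma open_Om : open Om.
Proof.
apply (open_Cmod_lt_1 _ tf open_disc). intros q Hq. eexists. apply euler_tf, Hq.
Qed.

Definition Zc (q : C) : Prop := Om q /\ Ph q = Mf q /\ Rf q = 1.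

Lemma Rf_1 q : Rf q = 1 -> A3 q = bf q * bf q * El q.
Proof.
intros E. assert (H1 := bf_neq_0 q). assert (H2 := El_neq_0 q).
unfold Rf in E. replace (A3 q) with (A3 q / (bf q * bf q * El q) * (bf q * bf q * El q)) by (field; auto).
rewrite E. ring.
Qed.

Lemma A3_neq_0 q : Rf q = 1 -> A3 q <> 0.
Proof.
intros E. rewrite (Rf_1 q E). repeat apply Cmult_neq_0; auto using bf_neq_0, El_neq_0.
Qed.

Lemma Zc_Mf q : Zc q -> Mf q <> 0.
Proof.
intros [[Hq _] [HP HR]] HM. assert (E := tf_Ph q Hq). rewrite HP, HM in E.
unfold Nf, Mf in *.
assert (A3 q * A3 q = 0).
{ replace (A3 q * A3 q) with (((P4 q - A3 q * A3 q) - (P4 q - 9 * (A3 q * A3 q))) / 8) by field.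
  rewrite HM, <- E. field. }
assert (N := A3_neq_0 q HR). destruct (Cmult_integral _ _ H); auto.
Qed.

Lemma open_Zc : open Zc.
Proof.
assert (O1 : open (fun q => Om q /\ Mf q <> 0)).
{ apply (open_neq_0 _ Mf open_Om). intros q [Hq _]. eexists. apply euler_Mf, Hq. }
assert (O2 : open (fun q => (Om q /\ Mf q <> 0) /\ Ph q / Mf q = 1)).
{ apply (euler_0_open _ (fun q => Ph q / Mf q) 1 O1). intros q [[Hq _] HM]. apply euler_Ph_Mf; auto. }
assert (PM : forall q, Mf q <> 0 -> Ph q / Mf q = 1 -> Ph q = Mf q).
{ intros q HM E. replace (Ph q) with (Ph q / Mf q * Mf q) by (field; auto). rewrite E. ring. }
eapply open_ext; [|apply (euler_0_open _ Rf 1 O2)].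
- intros q. split.
  + intros [[[H1 H2] H3] H4]. split; auto.
  + intros H. assert (HM := Zc_Mf q H). destruct H as [H1 [H2 H3]].
    repeat split; auto; try apply H1. rewrite H2. field. auto.
- intros q [[[Hq Ht] HM] E]. apply euler_Rf; auto.
Qed.

Lemma open_not_Zc : open (fun q => Om q /\ ~ Zc q).
Proof.
assert (O1 : open (fun q => Om q /\ Ph q - Mf q <> 0)).
{ apply (open_neq_0 _ (fun q => Ph q - Mf q) open_Om). intros q [Hq _].
  destruct (euler_Ph q Hq) as [v Hv]. eexists. apply euler_minus; [exact Hv|apply euler_Mf, Hq]. }
assert (O2 : open (fun q => Om q /\ Rf q - 1 <> 0)).
{ apply (open_neq_0 _ (fun q => Rf q - 1) open_Om). intros q [Hq Ht].
  eexists. apply euler_minus; [apply euler_Rf_gen; auto|apply euler_const]. }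
eapply open_ext; [|exact (open_or _ _ O1 O2)].
intros q. split.
- intros [[H1 H2]|[H1 H2]]; split; auto; intros [_ [E1 E2]]; apply H2; [rewrite E1|rewrite E2]; ring.
- intros [H1 H2]. destruct (Ceq_dec (Ph q - Mf q) 0) as [E1|E1]; [|left; auto].
  right. split; auto. intros E2. apply H2. repeat split; try apply H1.
  + replace (Ph q) with (Ph q - Mf q + Mf q) by ring. rewrite E1. ring.
  + replace (Rf q) with (Rf q - 1 + 1) by ring. rewrite E2. ring.
Qed.

Lemma Om_0 : Om 0.
Proof. split; [rewrite Cmod_0; lra|]. rewrite tf_0, Cmod_0. lra. Qed.

Lemma Zc_0 : Zc 0.
Proof.
split; [apply Om_0|]. split.
- rewrite Ph_0. unfold Mf. rewrite P4_0, A3_0. ring.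
- unfold Rf, El. rewrite A3_0, bf_0, tf_0, lam_0.
  replace (2 / 3 * 0) with (RtoC 0) by ring. rewrite Cexp_0. field.
Qed.

(** * The hypergeometric equation *)

Fixpoint hc (n : nat) : R :=
  match n with
  | O => 1
  | S m => hc m * ((INR m + 1 / 3) / (INR m + 1)) ^ 2
  end%R.

Lemma hc_pochhammer n :
  pochhammer (1 / 3) n * pochhammer (1 / 3) n / (pochhammer 1 n * INR (fact n)) = RtoC (hc n).
Proof.
assert (P : forall n, pochhammer 1 n = RtoC (INR (fact n))).
{ induction n0 as [|m IH]; [reflexivity|]. simpl pochhammer. rewrite IH, <- RtoC_plus, <- RtoC_mult.
  f_equal. rewrite fact_simpl, mult_INR, S_INR. ring. }
rewrite P. induction n as [|n IH]; [simpl; field|].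
assert (H1 : RtoC (INR (fact n)) <> 0).
{ intros E. apply RtoC_inj in E. exact (INR_fact_neq_0 n E). }
assert (H2 : (INR n + 1)%R <> 0%R) by (generalize (pos_INR n); lra).
assert (H3 : RtoC (INR n) + 1 <> 0).
{ rewrite <- RtoC_plus. intros E. apply RtoC_inj in E. auto. }
simpl hc. rewrite RtoC_mult, <- IH.
replace (RtoC (((INR n + 1 / 3) / (INR n + 1)) * ((INR n + 1 / 3) / (INR n + 1) * 1))%R)
  with ((RtoC (INR n) + 1 / 3) / (RtoC (INR n) + 1) * ((RtoC (INR n) + 1 / 3) / (RtoC (INR n) + 1))).
2:{ rewrite Rmult_1_r, RtoC_mult, RtoC_div by auto. rewrite !RtoC_plus, RtoC_div by lra. reflexivity. }
simpl pochhammer. rewrite fact_simpl, mult_INR, S_INR, RtoC_mult, RtoC_plus. field. auto.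
Qed.

Lemma hc_bounds n : (0 < hc n <= 1)%R.
Proof.
induction n as [|n IH]; [simpl; lra|]. simpl hc. rewrite Rmult_1_r.
assert (P := pos_INR n).
assert (B : (0 < (INR n + 1 / 3) / (INR n + 1) <= 1)%R).
{ split; [apply Rdiv_lt_0_compat; lra|]. apply Rmult_le_reg_r with (INR n + 1)%R; [lra|].
  unfold Rdiv. rewrite Rmult_assoc, Rinv_l; lra. }
set (r := ((INR n + 1 / 3) / (INR n + 1))%R) in *.
assert (0 < r * r <= 1)%R by (split; nra). split; nra.
Qed.

Lemma polyb_hc : polyb hc.
Proof.
apply polyb_le with (fun _ => 1%R); [apply polyb_const|]. intros n.
generalize (hc_bounds n). intros. rewrite Rabs_right; lra.
Qed.

Lemma hyp2F1_CPS z : hyp2F1 (1 / 3) (1 / 3) 1 z = CPS hc z.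
Proof.
unfold hyp2F1, CPS. f_equal. apply functional_extensionality. intros n. now rewrite hc_pochhammer.
Qed.

Lemma hc_rec n : ((INR n + 1) ^ 2 * hc (S n) = (INR n + 1 / 3) ^ 2 * hc n)%R.
Proof. simpl hc. generalize (pos_INR n). intros. field. lra. Qed.

(* The power series [hd] is such that [F log t + hd(t)] is a second solution
   of the hypergeometric equation at its singular point [0]. *)
Fixpoint he (n : nat) : R :=
  match n with
  | O => 0
  | S m => he m + (2 / (INR m + 1 / 3) - 2 / (INR m + 1))
  end%R.

Definition hd (n : nat) : R := (hc n * he n)%R.

Lemma polyb_hd : polyb hd.
Proof.
apply polyb_mult; [apply polyb_hc|].
apply polyb_le with (fun n => 4 * INR n)%R; [apply polyb_scal, polyb_INR|].
induction n as [|n IH]; [simpl; rewrite Rabs_R0; lra|].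
rewrite S_INR. simpl he. eapply Rle_trans; [apply Rabs_triang|].
assert (P := pos_INR n).
assert (E : (2 / (INR n + 1 / 3) - 2 / (INR n + 1) = (4 / 3) / ((INR n + 1 / 3) * (INR n + 1)))%R)
  by (field; lra).
assert (B : (0 <= 2 / (INR n + 1 / 3) - 2 / (INR n + 1) <= 4)%R).
{ rewrite E. assert (Q : (1 / 3 <= (INR n + 1 / 3) * (INR n + 1))%R) by nra. split.
  - left. apply Rdiv_lt_0_compat; lra.
  - apply Rmult_le_reg_r with ((INR n + 1 / 3) * (INR n + 1))%R; [lra|].
    unfold Rdiv. rewrite Rmult_assoc, Rinv_l; lra. }
rewrite (Rabs_right (_ - _)) by lra. lra.
Qed.

Definition F0 : C -> C := CPS hc.
Definition F1 : C -> C := CPS (theta hc).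
Definition F2 : C -> C := CPS (theta (theta hc)).
Definition H0 : C -> C := CPS hd.
Definition H1 : C -> C := CPS (theta hd).
Definition H2 : C -> C := CPS (theta (theta hd)).

Lemma hyp_ode z : (Cmod z < 1)%R -> F2 z = z * (F2 z + (2 / 3 * F1 z + 1 / 9 * F0 z)).
Proof.
intros Hz. unfold F2 at 1. rewrite CPS_decr; auto.
2:{ do 2 apply polyb_theta. apply polyb_hc. }
replace (RtoC (theta (theta hc) 0)) with (RtoC 0) by (unfold theta; simpl; f_equal; ring).
rewrite Cplus_0_l. f_equal.
transitivity (CPS (fun n => theta (theta hc) n + (2 / 3 * theta hc n + 1 / 9 * hc n))%R z).
- apply CPS_ext; auto; [|apply (polyb_shift (theta (theta hc))); do 2 apply polyb_theta; apply polyb_hc].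
  intros n. unfold theta. rewrite S_INR.
  replace ((INR n + 1) * ((INR n + 1) * hc (S n)))%R with ((INR n + 1) ^ 2 * hc (S n))%R by ring.
  rewrite hc_rec. field.
- assert (P := polyb_hc). rewrite !CPS_plus, !CPS_scal; auto; repeat first [apply polyb_theta | apply polyb_plus | apply polyb_scal]; auto.
  rtoc. reflexivity.
Qed.

Lemma hyp_ode_second z : (Cmod z < 1)%R ->
  H2 z + 2 * F1 z = z * (H2 z + (2 / 3 * H1 z + (1 / 9 * H0 z + (2 * F1 z + 2 / 3 * F0 z)))).
Proof.
intros Hz. assert (P := polyb_hc). assert (Q := polyb_hd).
transitivity (CPS (fun n => theta (theta hd) n + 2 * theta hc n)%R z).
{ rewrite CPS_plus, CPS_scal; auto; repeat first [apply polyb_theta | apply polyb_plus | apply polyb_scal]; auto. }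
rewrite CPS_decr; auto.
2:{ repeat first [apply polyb_theta | apply polyb_plus | apply polyb_scal]; auto. }
match goal with |- RtoC ?x + _ = _ => replace x with 0%R by (unfold theta; simpl; ring) end.
rewrite Cplus_0_l. f_equal.
transitivity (CPS (fun n => theta (theta hd) n + (2 / 3 * theta hd n + (1 / 9 * hd n
   + (2 * theta hc n + 2 / 3 * hc n))))%R z).
- apply CPS_ext; auto.
  2:{ apply (polyb_shift (fun n => theta (theta hd) n + 2 * theta hc n)%R).
      repeat first [apply polyb_theta | apply polyb_plus | apply polyb_scal]; auto. }
  intros n. unfold theta, hd. rewrite S_INR. simpl he.
  assert (PI := pos_INR n).
  replace (hc (S n)) with ((INR n + 1 / 3) ^ 2 * hc n / (INR n + 1) ^ 2)%R
    by (rewrite <- hc_rec; field; lra).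
  field. lra.
- rewrite !CPS_plus, !CPS_scal; auto; repeat first [apply polyb_theta | apply polyb_plus | apply polyb_scal]; auto.
  rtoc. reflexivity.
Qed.

Definition wr (z : C) : C := F0 z * F0 z + F0 z * H1 z - H0 z * F1 z.

Lemma F0_0 : F0 0 = 1.
Proof. unfold F0. rewrite (CPS_0 _ polyb_hc). reflexivity. Qed.

Lemma F1_0 : F1 0 = 0.
Proof.
unfold F1. rewrite (CPS_0 _ (polyb_theta _ polyb_hc)). unfold theta. simpl. f_equal. ring.
Qed.

Lemma H0_0 : H0 0 = 0.
Proof. unfold H0. rewrite (CPS_0 _ polyb_hd). unfold hd. simpl. f_equal. ring. Qed.

Lemma H1_0 : H1 0 = 0.
Proof.
unfold H1. rewrite (CPS_0 _ (polyb_theta _ polyb_hd)). unfold theta. simpl. f_equal. ring.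
Qed.

Lemma wronskian z : (Cmod z < 1)%R -> wr z * Cexp (2 / 3 * lam z) = 1.
Proof.
intros Hz. assert (P := polyb_hc). assert (Q := polyb_hd).
transitivity (wr 0 * Cexp (2 / 3 * lam 0)).
2:{ unfold wr. rewrite F0_0, F1_0, H0_0, H1_0, lam_0.
    replace (2 / 3 * 0) with (RtoC 0) by ring. rewrite Cexp_0. ring. }
apply (euler_0_ball (fun z => wr z * Cexp (2 / 3 * lam z)) 0 1); [|now left|
  replace (z - 0) with z by ring; exact Hz].
clear z Hz. intros z Hz. replace (z - 0) with z in Hz by ring.
assert (E0 : euler F0 z (F1 z)) by (apply euler_CPS; auto).
assert (E1 : euler F1 z (F2 z)) by (apply euler_CPS; auto using polyb_theta).
assert (G0 : euler H0 z (H1 z)) by (apply euler_CPS; auto).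
assert (G1 : euler H1 z (H2 z)) by (apply euler_CPS; auto using polyb_theta).
assert (L : euler lam z (- (z / (1 - z)))).
{ eapply euler_eq; [apply (euler_CPS logc z polyb_logc Hz)|]. apply CPS_theta_logc, Hz. }
assert (D := one_minus_neq_0 z Hz).
eapply euler_eq.
- apply (euler_mult wr (fun z => Cexp (2 / 3 * lam z))).
  + apply (euler_minus (fun z => F0 z * F0 z + F0 z * H1 z) (fun z => H0 z * F1 z)).
    * apply (euler_plus (fun z => F0 z * F0 z) (fun z => F0 z * H1 z)); apply euler_mult; eassumption.
    * apply euler_mult; eassumption.
  + apply euler_exp, euler_scal, L.
- assert (O1 := hyp_ode z Hz). assert (O2 := hyp_ode_second z Hz).
  assert (O1' : F2 z = z * (2 / 3 * F1 z + 1 / 9 * F0 z) / (1 - z)).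
  { replace (F2 z) with ((F2 z - z * F2 z) / (1 - z)) by (field; auto). f_equal.
    rewrite O1 at 1. ring. }
  assert (O2' : H2 z = (z * (2 / 3 * H1 z + (1 / 9 * H0 z + (2 * F1 z + 2 / 3 * F0 z))) - 2 * F1 z) / (1 - z)).
  { replace (H2 z) with ((H2 z + 2 * F1 z - z * H2 z - 2 * F1 z) / (1 - z)) by (field; auto). f_equal.
    rewrite O2 at 1. ring. }
  rewrite O1', O2'. unfold wr. field. auto.
Qed.

(** * Hypergeometric uniformisation on the component *)

Definition zf (q : C) : C := (P2 q - A3 q) / (12 * A3 q).
Definition kap (q : C) : C := bf q * (F1 (tf q) - zf q * F0 (tf q)) * El q.
Definition gf (q : C) : C := F0 (tf q) / bf q.
Definition Xf (q : C) : C := Cexp (- (H0 (tf q) / F0 (tf q)) - ex q).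

Lemma Zc_P4 q : Zc q -> P4 q = A3 q * A3 q * (1 - 9 * tf q) / (1 - tf q).
Proof.
intros [[Hq Ht] [HP _]].
assert (E3 := one_minus_neq_0 _ Ht).
assert (E := tf_Ph q Hq). rewrite HP in E. unfold Nf, Mf in E.
apply (f_equal (fun x => x + A3 q * A3 q - tf q * P4 q)) in E.
replace (P4 q) with ((P4 q - A3 q * A3 q + A3 q * A3 q - tf q * P4 q) / (1 - tf q)) by (field; auto).
rewrite <- E. f_equal. ring.
Qed.

Lemma euler_F_tf (a : nat -> R) q : polyb a -> Om q ->
  euler (fun x => CPS a (tf x)) q (CPS (theta a) (tf q) * A3 q).
Proof. intros Ha [Hq Ht]. apply euler_CPS_comp; auto. apply euler_tf, Hq. Qed.

Lemma euler_zf q : Zc q -> euler zf q (A3 q * (- (zf q * zf q)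
   + tf q / (18 * (1 - tf q)) * (1 + 12 * zf q + 1))).
Proof.
intros HZ. assert (E4 := Zc_P4 q HZ). assert (HZ' := HZ). destruct HZ' as [[Hq Ht] [HP HR]].
assert (NA := A3_neq_0 q HR). assert (E3 := one_minus_neq_0 _ Ht).
assert (N12 : 12 * A3 q <> 0).
{ apply Cmult_neq_0; auto. intros E. apply (f_equal fst) in E. simpl in E. lra. }
eapply euler_eq.
- apply (euler_div (fun x => P2 x - A3 x) (fun x => 12 * A3 x)); [|apply euler_scal, euler_A3, Hq|auto].
  apply euler_minus; [apply euler_P2, Hq|apply euler_A3, Hq].
- unfold zf. rewrite E4. field. auto.
Qed.

Lemma euler_kap q : Zc q -> euler kap q 0.
Proof.
intros HZ. assert (HO := proj1 HZ). destruct HO as [Hq Ht].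
assert (E3 := one_minus_neq_0 _ Ht).
eapply euler_eq.
- apply (euler_mult (fun q => bf q * (F1 (tf q) - zf q * F0 (tf q))) El).
  + apply (euler_mult bf (fun q => F1 (tf q) - zf q * F0 (tf q))); [apply euler_bf, Hq|].
    apply euler_minus.
    * apply (euler_F_tf (theta hc)); [apply polyb_theta, polyb_hc|split; auto].
    * apply euler_mult; [apply euler_zf, HZ|]. apply (euler_F_tf hc); [apply polyb_hc|split; auto].
  + apply euler_El; auto.
- fold (F0 (tf q)) (F1 (tf q)) (F2 (tf q)).
  assert (O1 := hyp_ode _ Ht).
  assert (O1' : F2 (tf q) = tf q * (2 / 3 * F1 (tf q) + 1 / 9 * F0 (tf q)) / (1 - tf q)).
  { replace (F2 (tf q)) with ((F2 (tf q) - tf q * F2 (tf q)) / (1 - tf q)) by (field; auto). f_equal.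
    rewrite O1 at 1. ring. }
  change (CPS (theta (theta hc)) (tf q)) with (F2 (tf q)).
  change (CPS (theta hc) (tf q)) with (F1 (tf q)).
  rewrite O1'.
  assert (EA : P2 q - A3 q = 12 * A3 q * zf q).
  { unfold zf. field. apply A3_neq_0, HZ. }
  rewrite EA. field. auto.
Qed.

Lemma kap_0 : kap 0 = 0.
Proof. unfold kap, zf. rewrite tf_0, F1_0, P2_0, A3_0. field. Qed.

Lemma kap_F1 q : kap q = 0 -> F1 (tf q) = zf q * F0 (tf q).
Proof.
intros E. unfold kap in E.
destruct (Cmult_integral _ _ E) as [E'|E']; [|now apply El_neq_0 in E'].
destruct (Cmult_integral _ _ E') as [E''|E'']; [now apply bf_neq_0 in E''|].
replace (F1 (tf q)) with (F1 (tf q) - zf q * F0 (tf q) + zf q * F0 (tf q)) by ring. rewrite E''. ring.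
Qed.

Lemma euler_gf q : Zc q -> kap q = 0 -> euler gf q 0.
Proof.
intros HZ Hk. assert (HO := proj1 HZ). destruct HO as [Hq Ht].
assert (NA := A3_neq_0 q (proj2 (proj2 HZ))).
eapply euler_eq.
- apply (euler_div (fun q => F0 (tf q)) bf).
  + apply (euler_F_tf hc); [apply polyb_hc|split; auto].
  + apply euler_bf, Hq.
  + apply bf_neq_0.
- change (CPS (theta hc) (tf q)) with (F1 (tf q)). rewrite (kap_F1 q Hk). unfold zf.
  field. split; auto using bf_neq_0.
Qed.

Lemma gf_0 : gf 0 = 1.
Proof. unfold gf. rewrite tf_0, F0_0, bf_0. field. Qed.

Lemma gf_F0 q : gf q = 1 -> F0 (tf q) = bf q.
Proof.
intros E. unfold gf in E. assert (N := bf_neq_0 q).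
replace (F0 (tf q)) with (F0 (tf q) / bf q * bf q) by (field; auto). rewrite E. ring.
Qed.

Lemma euler_Xf q : Zc q -> gf q = 1 -> euler Xf q 0.
Proof.
intros HZ Hg. assert (HO := proj1 HZ). assert (HO' := HO). destruct HO' as [Hq Ht].
assert (HF := gf_F0 q Hg).
assert (NF : F0 (tf q) <> 0) by (rewrite HF; apply bf_neq_0).
assert (W := wronskian _ Ht). fold (El q) in W.
assert (HA := Rf_1 q (proj2 (proj2 HZ))). rewrite <- HF in HA.
eapply euler_eq.
- apply euler_exp, (euler_minus (fun q => - (H0 (tf q) / F0 (tf q))) ex); [|apply euler_ex, Hq].
  apply euler_ext with (fun q => (- (1)) * (H0 (tf q) / F0 (tf q))); [intros; ring|].
  apply euler_scal, (euler_div (fun q => H0 (tf q)) (fun q => F0 (tf q))); auto.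
  + apply (euler_F_tf hd); [apply polyb_hd|auto].
  + apply (euler_F_tf hc); [apply polyb_hc|auto].
- change (CPS (theta hc) (tf q)) with (F1 (tf q)). change (CPS (theta hd) (tf q)) with (H1 (tf q)).
  rewrite HA.
  match goal with |- ?L * _ = _ => replace L with (1 - wr (tf q) * El q) end.
  + rewrite W. ring.
  + unfold wr. field. auto.
Qed.

Lemma Xf_0 : Xf 0 = 1.
Proof.
unfold Xf. rewrite tf_0, H0_0, F0_0, ex_0. rewrite <- Cexp_0. f_equal. unfold Cdiv. ring.
Qed.

Lemma component_identities (K : C -> Prop) :
  Cconnected K -> (forall M : R, exists z, K z /\ (M < Im z)%R) ->
  (forall z, K z -> Om (nome z)) ->
  forall z, K z -> let q := nome z in
    Zc q /\ kap q = 0 /\ F0 (tf q) = bf q /\ Xf q = 1.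
Proof.
intros Kc Kinf KOm z Kz q.
assert (G0 : good K Om) by (split; [apply open_Om|split; [apply Om_0|exact KOm]]).
assert (G1 : good K Zc).
{ apply (good_clopen K Kc Kinf Om); auto using open_Zc, open_not_Zc, Zc_0. now intros x [H _]. }
assert (G2 := good_const K Kc Kinf Zc kap 0 G1 euler_kap kap_0).
assert (G3 := good_const K Kc Kinf _ gf 1 G2 (fun x H => euler_gf x (proj1 H) (proj2 H)) gf_0).
assert (G4 := good_const K Kc Kinf _ Xf 1 G3 (fun x H => euler_Xf x (proj1 (proj1 H)) (proj2 H)) Xf_0).
destruct G4 as [_ [_ G4]]. destruct (G4 z Kz) as [[[Z1 Z2] Z3] Z4].
split; [exact Z1|split; [exact Z2|split; [apply gf_F0, Z3|exact Z4]]].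
Qed.

(** * Principal powers *)

Lemma Carg_bounds (z : C) : z <> 0 ->
  ((0 <= Im z)%R -> (0 <= Carg z <= PI)%R) /\ ((Im z < 0)%R -> (- PI <= Carg z <= 0)%R).
Proof.
intros Hz. unfold Carg. assert (B := acos_bound (Re z / Cmod z)).
destruct (Rle_dec 0 (Im z)); split; intros; lra.
Qed.

Lemma Cexp_Clog (z : C) : z <> 0 -> Cexp (Clog z) = z.
Proof.
intros Hz. assert (Hm : (0 < Cmod z)%R) by (apply Cmod_gt_0; auto).
unfold Clog, Cexp. unfold Re at 1 2, Im at 1 2. simpl fst. simpl snd.
rewrite exp_ln by auto.
assert (Hx := Rabs_Re_le z). apply Rabs_le_between in Hx.
set (x := (Re z / Cmod z)%R).
assert (Bx : (-1 <= x <= 1)%R).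
{ unfold x. split.
  - apply Rmult_le_reg_r with (Cmod z); auto. unfold Rdiv. rewrite Rmult_assoc, Rinv_l; lra.
  - apply Rmult_le_reg_r with (Cmod z); auto. unfold Rdiv. rewrite Rmult_assoc, Rinv_l; lra. }
assert (Hsq : (Cmod z ^ 2 = Re z ^ 2 + Im z ^ 2)%R) by apply Cmod2_alt.
assert (Hs : (Cmod z * sqrt (1 - x²) = Rabs (Im z))%R).
{ rewrite <- (sqrt_pow2 (Cmod z)) at 1 by lra. rewrite <- sqrt_mult.
  - rewrite <- sqrt_Rsqr_abs. f_equal. unfold x, Rsqr.
    replace (Cmod z ^ 2 * (1 - Re z / Cmod z * (Re z / Cmod z)))%R with (Cmod z ^ 2 - Re z ^ 2)%R by (field; lra).
    rewrite Hsq. ring.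
  - apply pow2_ge_0.
  - unfold Rsqr. nra. }
assert (Hc : (Cmod z * x = Re z)%R) by (unfold x; field; lra).
unfold Carg. fold x. destruct (Rle_dec 0 (Im z)) as [H|H].
- rewrite cos_acos, sin_acos by auto. rewrite Hc, Hs, Rabs_right by lra. now destruct z.
- rewrite cos_neg, sin_neg, cos_acos, sin_acos by auto.
  replace (Cmod z * - sqrt (1 - x²))%R with (- (Cmod z * sqrt (1 - x²)))%R by ring.
  rewrite Hc, Hs, Rabs_left by lra. rewrite Ropp_involutive. now destruct z.
Qed.

Lemma cos_Im_lam z : (Cmod z < 1)%R -> (0 < cos (Im (lam z)))%R.
Proof.
intros Hz. assert (E := Cexp_lam z Hz). apply (f_equal Re) in E.
change (exp (Re (lam z)) * cos (Im (lam z)) = 1 + - Re z)%R in E.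
assert (H := Rabs_Re_le z). apply Rabs_le_between in H.
assert (P := exp_pos (Re (lam z))).
apply Rmult_lt_reg_l with (exp (Re (lam z))); auto. rewrite Rmult_0_r. lra.
Qed.

Lemma Im_lam_bound z : (Cmod z < 1)%R -> (Rabs (Im (lam z)) < PI / 2)%R.
Proof.
intros Hz. apply Rnot_le_lt. intros Hge.
assert (PP := PI_RGT_0).
set (f := fun s : R => (Rabs (Im (lam (s * z))) - PI / 2)%R).
assert (Hs : forall s : R, (0 <= s <= 1)%R -> (Cmod (s * z) < 1)%R).
{ intros s H. rewrite Cmod_mult, Cmod_R, Rabs_right by lra.
  assert (0 <= Cmod z)%R by apply Cmod_ge_0. nra. }
assert (Hroot : forall s : R, (0 <= s <= 1)%R -> f s <> 0%R).
{ intros s H E. assert (C := cos_Im_lam _ (Hs s H)). unfold f in E.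
  assert (A : Rabs (Im (lam (s * z))) = (PI / 2)%R) by lra.
  unfold Rabs in A. destruct (Rcase_abs _) in A.
  - replace (Im (lam (s * z))) with (- (PI / 2))%R in C by lra. rewrite cos_neg, cos_PI2 in C. lra.
  - rewrite A, cos_PI2 in C. lra. }
assert (F0 : (f 0%R < 0)%R).
{ unfold f. rewrite Cmult_0_l, lam_0. simpl. rewrite Rabs_R0. lra. }
assert (F1 : (0 < f 1%R)%R).
{ assert (0 <= f 1%R)%R by (unfold f; rewrite Cmult_1_l; lra).
  assert (f 1%R <> 0%R) by (apply Hroot; lra). lra. }
assert (Hcont : forall s : R, (0 <= s <= 1)%R -> continuity_pt f s).
{ intros s H eps He.
  destruct (euler_CPS logc (s * z) polyb_logc (Hs s H)) as [l [Hl _]].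
  destruct (Cder_cont _ _ _ Hl eps He) as [d [Hd Hc]].
  exists d. split; [exact Hd|]. intros t [_ Ht].
  change (Rabs (t - s) < d)%R in Ht.
  change (Rabs (f t - f s) < eps)%R. unfold f.
  replace (Rabs (Im (lam (t * z))) - PI / 2 - (Rabs (Im (lam (s * z))) - PI / 2))%R
    with (Rabs (Im (lam (t * z))) - Rabs (Im (lam (s * z))))%R by ring.
  eapply Rle_lt_trans; [apply Rabs_triang_inv2|].
  replace (Im (lam (t * z)) - Im (lam (s * z)))%R with (Im (lam (t * z) - lam (s * z))) by reflexivity.
  eapply Rle_lt_trans; [apply Rabs_Im_le|]. apply Hc.
  replace (t * z - s * z) with (RtoC (t - s) * z) by (rewrite RtoC_minus; ring).
  rewrite Cmod_mult, Cmod_R. assert (P := Rabs_pos (t - s)). assert (Q := Cmod_ge_0 z). nra. }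
destruct (IVT_interv f 0 1 Hcont) as [s [H E]]; auto; [lra|].
exact (Hroot s H E).
Qed.

Lemma cos_eq_1_small x : cos x = 1%R -> (- (2 * PI) < x < 2 * PI)%R -> x = 0%R.
Proof.
intros Hc Hx.
assert (S : sin (x / 2) = 0%R).
{ assert (E : (cos x = 1 - 2 * sin (x / 2) * sin (x / 2))%R).
  { rewrite <- cos_2a_sin. f_equal. field. }
  rewrite Hc in E. assert (sin (x / 2) * sin (x / 2) = 0)%R by lra.
  apply Rmult_integral in H. tauto. }
destruct (Rtotal_order x 0) as [L|[L|L]]; auto.
- assert (0 < sin (- (x / 2)))%R by (apply sin_gt_0; lra). rewrite sin_neg in H. lra.
- assert (0 < sin (x / 2))%R by (apply sin_gt_0; lra). lra.
Qed.

Lemma Clog_minus_1 (u t : C) : u * t = 1 -> (Cmod t < 1)%R -> Clog (u - 1) = Clog u + lam t.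
Proof.
intros Hut Ht.
assert (Hu : u <> 0).
{ intros E. rewrite E, Cmult_0_l in Hut. apply C1_nz. auto. }
assert (E1 : u - 1 = u * (1 - t)) by (replace (u * (1 - t)) with (u - u * t) by ring; now rewrite Hut).
assert (Hu1 : u - 1 <> 0).
{ rewrite E1. apply Cmult_neq_0; auto. apply one_minus_neq_0, Ht. }
set (w := Clog (u - 1) - (Clog u + lam t)).
assert (Hw : Cexp w = 1).
{ unfold w. rewrite Cexp_minus, Cexp_plus, !Cexp_Clog, Cexp_lam by auto.
  rewrite <- E1. field. auto. }
assert (Re0 : Re w = 0%R).
{ apply exp_inv. rewrite <- Cmod_Cexp, Hw, exp_0. apply Cmod_1. }
assert (Im0 : Im w = 0%R).
{ apply cos_eq_1_small.
  - assert (C := f_equal Re Hw). change (exp (Re w) * cos (Im w) = 1)%R in C.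
    rewrite Re0, exp_0 in C. lra.
  - assert (L := Im_lam_bound t Ht). apply Rabs_def2 in L.
    change (Im w) with (Carg (u - 1) - (Carg u + Im (lam t)))%R.
    destruct (Carg_bounds u Hu) as [B1 B2]. destruct (Carg_bounds (u - 1) Hu1) as [B3 B4].
    assert (Im (u - 1) = Im u) by (destruct u; unfold Im; simpl; ring).
    assert (P := PI_RGT_0).
    destruct (Rle_dec 0 (Im u)) as [H'|H'].
    + specialize (B1 H'). specialize (B3 ltac:(lra)). lra.
    + specialize (B2 ltac:(lra)). specialize (B4 ltac:(lra)). lra. }
assert (W : w = 0) by (apply injective_projections; assumption).
replace (Clog (u - 1)) with (w + (Clog u + lam t)) by (unfold w; ring). rewrite W. ring.
Qed.

Lemma Cpowr_product (u t : C) : u * t = 1 -> (Cmod t < 1)%R ->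
  Cpowr u (2 / 3) * Cpowr (u - 1) (1 / 3) = u * Cexp (1 / 3 * lam t).
Proof.
intros Hut Ht.
assert (Hu : u <> 0).
{ intros E. rewrite E, Cmult_0_l in Hut. apply C1_nz. auto. }
unfold Cpowr. rewrite (Clog_minus_1 u t Hut Ht), <- Cexp_plus.
transitivity (Cexp (Clog u) * Cexp (1 / 3 * lam t)); [|now rewrite Cexp_Clog].
rewrite <- Cexp_plus. f_equal. rtoc. field.
Qed.

(** * Exclusion of the value 9 *)

Lemma Im_CPS_real a (x : R) : polyb a -> (Rabs x < 1)%R -> CPS a (RtoC x) = RtoC (Re (CPS a (RtoC x))).
Proof.
intros Ha Hx.
assert (H := CPS_correct a (RtoC x) Ha ltac:(now rewrite Cmod_R)).
apply is_series_Im in H.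
assert (E : forall n, Im (RtoC (a n) * RtoC x ^ n) = 0%R).
{ intros n. rewrite <- RtoC_pow, <- RtoC_mult. reflexivity. }
assert (Z : is_series (fun n => Im (RtoC (a n) * RtoC x ^ n)) 0%R).
{ assert (E' : forall n, (0 * 0 ^ n)%R = Im (RtoC (a n) * RtoC x ^ n)) by (intros n; rewrite E; ring).
  apply is_series_ext with (1 := E').
  assert (G := is_series_geom 0 ltac:(rewrite Rabs_R0; lra)).
  apply (@is_series_scal R_AbsRing R_NormedModule 0%R) in G.
  assert (E0 : @scal R_AbsRing R_NormedModule 0%R (/ (1 - 0))%R = 0%R) by apply Rmult_0_l.
  rewrite E0 in G. exact G. }
apply is_series_unique in H. apply is_series_unique in Z. rewrite H in Z.
apply injective_projections; [reflexivity|exact Z].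
Qed.

Lemma tf_neq_ninth z : (0 < Im z)%R -> (Rabs (Re z) < 1 / 2)%R ->
  F0 (tf (nome z)) <> 0 -> Xf (nome z) = 1 -> tf (nome z) <> / 9.
Proof.
intros Hy Hx HF HX E.
set (q := nome z) in *.
assert (E9 : tf q = RtoC (/ 9)) by (rewrite E, RtoC_inv by lra; reflexivity).
assert (L9 : (Rabs (/ 9) < 1)%R) by (rewrite Rabs_right; lra).
unfold Xf in HX. rewrite E9 in HX, HF.
assert (EF := Im_CPS_real hc (/ 9) polyb_hc L9). fold F0 in EF.
assert (EH := Im_CPS_real hd (/ 9) polyb_hd L9). fold H0 in EH.
set (f := Re (F0 (RtoC (/ 9)))) in *. set (h := Re (H0 (RtoC (/ 9)))) in *.
rewrite EF in HF. rewrite EF, EH in HX.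
assert (Hf : f <> 0%R) by (intros Z; apply HF; now rewrite Z).
assert (Eex : Cexp (ex q) = RtoC (exp (- (h / f)))).
{ rewrite <- Cexp_RtoC. rewrite Cexp_minus in HX.
  assert (N := Cexp_neq_0 (ex q)).
  replace (RtoC (- (h / f))) with (- (RtoC h / RtoC f)) by (rewrite RtoC_opp, RtoC_div; auto).
  replace (Cexp (- (h / f))) with (Cexp (- (h / f)) / Cexp (ex q) * Cexp (ex q)) by (field; auto).
  rewrite HX. ring. }
unfold tf in E9. rewrite Eex in E9. set (p := exp (- (h / f))) in *.
assert (Hp : (0 < p)%R) by apply exp_pos.
assert (Eq : (Re q < 0)%R /\ Im q = 0%R).
{ assert (A := f_equal Re E9). assert (B := f_equal Im E9).
  destruct q as [x y]. unfold Re, Im in *. simpl in A, B |- *. split.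
  - assert (27 * (x * p) = - / 9)%R by lra. nra.
  - assert (y * p = 0)%R by lra. apply Rmult_integral in H. destruct H; lra. }
destruct Eq as [A B].
assert (Hq : q = Cexp (2 * PI * Ci * z)) by reflexivity.
destruct z as [x y]. unfold Re, Im in Hx, Hy. simpl in Hx, Hy.
assert (P := PI_RGT_0).
apply Rabs_def2 in Hx.
assert (ER : Re q = (exp (- (2 * PI * y)) * cos (2 * PI * x))%R).
{ rewrite Hq. unfold Cexp, Re, Im. simpl. f_equal; f_equal; ring. }
assert (EI : Im q = (exp (- (2 * PI * y)) * sin (2 * PI * x))%R).
{ rewrite Hq. unfold Cexp, Re, Im. simpl. f_equal; f_equal; ring. }
rewrite EI in B. rewrite ER in A. assert (Pe := exp_pos (- (2 * PI * y))).
apply Rmult_integral in B. destruct B as [B|B]; [lra|].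
destruct (Rtotal_order x 0) as [L|[L|L]].
- assert (0 < sin (- (2 * PI * x)))%R by (apply sin_gt_0; nra). rewrite sin_neg in H. lra.
- rewrite L, Rmult_0_r, cos_0 in A. lra.
- assert (0 < sin (2 * PI * x))%R by (apply sin_gt_0; nra). lra.
Qed.

Lemma C_derive_F2 (u t : C) : u * t = 1 -> (Cmod t < 1)%R ->
  C_derive (fun x : C => hyp2F1 (1 / 3) (1 / 3) 1 (1 / x) ^ 2) u = - (2) * F0 t * t * F1 t.
Proof.
intros Hut Ht.
assert (Hu : u <> 0).
{ intros E. rewrite E, Cmult_0_l in Hut. apply C1_nz. auto. }
assert (Et : t = / u) by (replace (/ u) with (/ u * (u * t)) by (rewrite Hut; ring); field; auto).
apply is_C_derive_unique.
destruct (Cder_CPS hc t polyb_hc Ht) as [l [Hl E]].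
change (CPS (fun n => INR n * hc n)%R t) with (F1 t) in E.
assert (D : Cder (fun x => F0 (/ x)) u (- / (u * u) * l)).
{ apply (Cder_comp F0 Cinv); [rewrite <- Et; exact Hl|apply Cder_inv, Hu]. }
apply Cder_ext with (fun x => F0 (/ x) * F0 (/ x)).
- intros x. rewrite hyp2F1_CPS. unfold Cdiv. rewrite Cmult_1_l. unfold F0. simpl. ring.
- eapply Cder_eq; [apply (Cder_mult _ _ _ _ _ D D)|].
  rewrite <- E, <- Et. replace (/ (u * u)) with (t * t) by (rewrite Et; field; auto). ring.
Qed.

Theorem mainTheorem13 :
  forall (a b c d : Z) (tau : C),
    (0 < a)%Z ->
    Z.gcd (Z.gcd a b) c = 1%Z ->
    (- d = b ^ 2 - 4 * a * c)%Z ->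
    tau = (- IZR b + Ci * sqrt (IZR d)) / (2 * IZR a) ->
    IZR a * tau ^ 2 + IZR b * tau + IZR c = 0 ->
    C_inf tau ->
    (* s2 tau is defined *)
    E6 tau <> 0 ->
    let u := u3B tau in
    let F := fun x : C => hyp2F1 (1 / 3) (1 / 3) 1 (1 / x) in
    F u ^ 2 / 6 * ((u - 1) - (u ^ 2 + 18 * u - 27) / (u - 9) * s2 tau)
      - u * (u - 1) * C_derive (fun x : C => F x ^ 2) u
    = IZR a / (PI * sqrt (IZR d)) * Cpowr u (2 / 3) * Cpowr (u - 1) (1 / 3).
Proof.
intros a b c d tau Ha _ _ Htau _ [K [[_ [HKA [HKc _]]] [HKinf HK]]] HE6 u F.
assert (HIm : forall z, K z -> (0 < Im z)%R) by (intros z Kz; apply HKA in Kz; apply Kz).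
assert (HOm : forall z, K z -> Om (nome z)).
{ intros z Kz. split; [apply Cmod_nome_lt_1; auto|].
  destruct (HKA z Kz) as [_ H]. rewrite u3B_tf in H by auto.
  assert (N := tf_neq_0 _ (nome_neq_0 z)).
  replace (1 / / tf (nome z)) with (tf (nome z)) in H by (field; auto). exact H. }
destruct (component_identities K HKc HKinf HOm tau HK) as [HZ [Hk [HF HX]]].
assert (Hy := HIm tau HK).
set (q := nome tau) in *. set (t := tf q) in *.
assert (HZ' := HZ). destruct HZ' as [[Hq Ht] [HP HR]]. fold t in Ht.
assert (Nt : t <> 0) by apply tf_neq_0, nome_neq_0.
assert (Eu : u = / t) by (apply u3B_tf; auto).
assert (Hut : u * t = 1) by (rewrite Eu; field; auto).
assert (Hu : u <> 0) by (rewrite Eu; intros E; apply C1_nz; rewrite <- Hut, Eu, E; ring).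
assert (N1 := one_minus_neq_0 t Ht).
assert (Eu1 : u - 1 = u * (1 - t)).
{ replace (u * (1 - t)) with (u - u * t) by ring. now rewrite Hut. }
assert (Nu1 : u - 1 <> 0) by (rewrite Eu1; apply Cmult_neq_0; auto).
assert (Nb := bf_neq_0 q).
assert (Hu9 : u - 9 <> 0).
{ intros E. assert (E9 : u = 9) by (replace u with (u - 9 + 9) by ring; rewrite E; ring).
  apply (tf_neq_ninth tau); auto.
  - apply HKA in HK. apply HK.
  - fold q t. rewrite HF. exact Nb.
  - fold q t. rewrite <- E9, Eu. field. auto. }
assert (EtC : t = / u) by (rewrite Eu; field; auto).
assert (NA := A3_neq_0 q HR). assert (EA := Rf_1 q HR).
set (A := A3 q) in *. set (B := bf q) in *.
assert (HE4 : E4 tau = A * A * (u - 9) / (u - 1)).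
{ rewrite E4_P4 by auto. fold q. rewrite (Zc_P4 q HZ). fold A t. rewrite EtC. field.
  repeat split; auto. }
assert (H6 : E6 tau = A * A * A * (u ^ 2 + 18 * u - 27) / ((u - 1) * (u - 1))).
{ assert (D := division_polynomial q Hq). rewrite E4_P4 in HE4 by auto. fold q in HE4.
  rewrite HE4 in D. rewrite E6_P6 by auto. fold q. fold A in D.
  replace (P6 q) with (8 * (A * P6 q) / (8 * A)).
  - rewrite D. field. auto.
  - field. auto. }
set (Q := u ^ 2 + 18 * u - 27) in *.
assert (NQ : Q <> 0).
{ intros E. apply HE6. rewrite H6, E. field. auto. }
assert (Hs2 : Q / (u - 9) * s2 tau = (u - 1) / A * (P2 q - (3 / (PI * Im tau))%R)).
{ unfold s2, E2star. rewrite H6, HE4, E2_P2 by auto. fold q. field. repeat split; auto. }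
assert (HFu : F u = B).
{ unfold F. rewrite hyp2F1_CPS. replace (1 / u) with t by (rewrite EtC; field; auto). exact HF. }
unfold F at 2. rewrite (C_derive_F2 u t Hut Ht), HFu, Hs2.
rewrite <- (Cmult_assoc _ (Cpowr u (2 / 3))), (Cpowr_product u t Hut Ht).
assert (HF1 : F1 t = zf q * B) by (rewrite <- HF; exact (kap_F1 q Hk)).
rewrite HF, HF1. unfold zf. fold A.
assert (Ha' : (0 < IZR a)%R) by (apply IZR_lt; auto).
assert (HImtau : (Im tau = sqrt (IZR d) / (2 * IZR a))%R).
{ rewrite Htau. replace (2 * IZR a) with (RtoC (2 * IZR a)) by (now rewrite RtoC_mult).
  unfold Cdiv. rewrite <- RtoC_inv by lra. unfold Im. simpl. field. lra. }
assert (Hsd : (0 < sqrt (IZR d))%R).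
{ rewrite HImtau in Hy. apply Rmult_lt_reg_r with (/ (2 * IZR a))%R.
  - apply Rinv_0_lt_compat. lra.
  - rewrite Rmult_0_l. exact Hy. }
assert (PP := PI_RGT_0).
assert (Hcoef : RtoC (3 / (PI * Im tau))%R = 6 * (IZR a / (PI * sqrt (IZR d)))).
{ rewrite HImtau. rewrite <- RtoC_mult, <- RtoC_div, <- RtoC_mult by nra. f_equal. field. lra. }
rewrite Hcoef. set (k := IZR a / (PI * sqrt (IZR d))).
transitivity (k * (B * B * (u - 1) / A)).
{ replace (u * (u - 1) * (- (2) * B * t * ((P2 q - A) / (12 * A) * B)))
    with (u * t * (u - 1) * (- (2) * B * ((P2 q - A) / (12 * A) * B))) by ring.
  rewrite Hut. field. auto. }
f_equal. rewrite EA, Eu1, <- (Cexp_lam t Ht). unfold El. fold t B.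
replace (lam t) with (2 / 3 * lam t + 1 / 3 * lam t) at 1 by field.
rewrite Cexp_plus. field. split; auto using Cexp_neq_0.
Qed.
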